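(* The following assertions are valid. (i) The operator $T\colon L\log L\to L^1$ is not injective. (ii) Let $g\in L\log L$. Then $\widehat T(g)\in L^1$ and $T(\widehat T(g))=g$. Moreover, $\int_{-1}^1\widehat T(g)(x)\,dx=0$. (iii) The operator $P\colon L\log L\to L\log L$ given by $$P(f)(x):=\Big(\frac1\pi\int_{-1}^1 f(t)\,dt\Big)\frac{1}{\sqrt{1-x^2}},\qquad |x|<1,\quad f\in L\log L,$$ is a bounded projection satisfying $$\|P\|_{L\log L\to L\log L}\le\frac1\pi\Big\|\frac1{\sqrt{1-x^2}}\Big\|_{L\log L}.$$ Furthermore, $TP\colon L\log L\to L^1$ is the zero operator. (iv) For each $f\in L\log L$ one has $f-P(f)=\widehat T(T(f))$. Moreover, $\widehat T T$ maps $L\log L$ into $L\log L$ and satisfies $$\|\widehat TT\|_{L\log L\to L\log L}\le 1+\frac1\pi\Big\|\frac1{\sqrt{1-x^2}}\Big\|_{L\log L}.$$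
   Context: All functions are complex-valued, Lebesgue measurable on $(-1,1)$, identified when equal a.e.; $L^1=L^1(-1,1)$. The decreasing rearrangement of $f$ is $f^*(t)=\inf\{\lambda\ge 0: |\{x\in(-1,1):|f(x)|>\lambda\}|\le t\}$, $0<t<2$. The Zygmund space $L\log L=L\log L(-1,1)$ consists of all measurable $f$ with $\|f\|_{L\log L}:=\int_0^2 f^*(t)\log\big(\tfrac{2e}{t}\big)\,dt<\infty$, with this norm; it is contained in $L^1$. For $f\in L^1$ the finite Hilbert transform is $$T(f)(t)=\lim_{\varepsilon\to0^+}\frac1\pi\Big(\int_{-1}^{t-\varepsilon}+\int_{t+\varepsilon}^1\Big)\frac{f(x)}{x-t}\,dx ,$$ which exists for a.e. $t\in(-1,1)$ and is measurable; $T$ maps $L\log L$ boundedly into $L^1$. For $g\in L^1$ the measurable function $\widehat T(g)$ is defined by $$\widehat T(g)(x)=\frac{-1}{\sqrt{1-x^2}}\,T\big(\sqrt{1-t^2}\,g(t)\big)(x)\quad\text{for a.e. }x\in(-1,1).$$ *)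

(* Defs.v *)
From mathcomp Require Import all_boot all_order all_algebra.
From mathcomp Require Export complex.
From mathcomp Require Import all_classical all_reals all_analysis.

Set Implicit Arguments.
Unset Strict Implicit.
Unset Printing Implicit Defensive.

Import Order.TTheory GRing.Theory Num.Theory numFieldNormedType.Exports.

Local Open Scope complex_scope.
Local Open Scope classical_set_scope.
Local Open Scope ring_scope.

(* An element of a space of (classes of) functions on (-1,1) is represented by
   a total function R -> R[i]: its values outside (-1,1) are irrelevant, and
   equality is equality almost everywhere on (-1,1). *)

Section FiniteHilbertTransform.
Context {R : realType}.
Implicit Types (f g : R -> R[i]) (D : set R) (S : (R -> R[i]) -> R -> R[i]).
Implicit Types X Y : set (R -> R[i]).

(* Lebesgue (and not only Borel) measurability: the completed measure and its
   sigma-algebra. *)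
Local Notation mu := (@completed_lebesgue_measure R).

Definition I11 : set R := `]-1, 1[.

Definition ae_equal f g : Prop := f = g %[ae mu in I11].

(* On R the domain carries the Lebesgue sigma-algebra and the codomain the
   Borel one. *)
Definition lebesgue_measurable (D : set R) (h : R -> R) : Prop :=
  @measurable_fun _ _ (caratheodory_type (wlength (@idfun R))^*%mu)
    (measurableTypeR R) D h.

Definition cmeasurable f : Prop :=
  lebesgue_measurable I11 (fun x => complex.Re (f x)) /\
  lebesgue_measurable I11 (fun x => complex.Im (f x)).

Definition cintegral D f : R[i] :=
  (\int[mu]_(x in D) complex.Re (f x)) +i* (\int[mu]_(x in D) complex.Im (f x)).

Definition L1 : set (R -> R[i]) :=
  [set f | cmeasurable f /\
           (\int[mu]_(x in I11) (Normc.normc (f x))%:E < +oo)%E].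

(* The infimum is taken in the extended reals, so that it is +oo on the empty
   set. *)
Definition rearrangement f (t : R) : \bar R :=
  ereal_inf [set l%:E | l in [set l : R | 0 <= l /\
    (mu (I11 `&` [set x | (l < Normc.normc (f x))%R]) <= t%:E)%E]].

Definition llogl_norm f : \bar R :=
  (\int[mu]_(t in (`]0%R, 2%R[ : set R))
     (rearrangement f t * (ln (2 * expR 1 / t))%:E))%E.

Definition LlogL : set (R -> R[i]) :=
  [set f | cmeasurable f /\ (llogl_norm f < +oo)%E].

Definition truncated_hilbert f (t e : R) : R[i] :=
  (pi^-1)%:C *
  (cintegral `]-1, (t - e)[ (fun x => f x / (x - t)%:C) +
   cintegral `](t + e), 1[ (fun x => f x / (x - t)%:C)).

(* The topology of the complex numbers is that of R[i] as a numFieldType,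
   carried by R[i]^o. *)
Definition hilbert f (t : R) : R[i] :=
  lim ((truncated_hilbert f t e : R[i]^o) @[e --> 0^'+]).

Definition weight (x : R) : R := Num.sqrt (1 - x ^+ 2).

Definition inv_weight (x : R) : R[i] := ((weight x)^-1)%:C.

Definition hilbert_hat g (x : R) : R[i] :=
  (-1 / weight x)%:C * hilbert (fun t => (weight t)%:C * g t) x.

Definition llogl_proj f (x : R) : R[i] :=
  ((pi^-1)%:C * cintegral I11 f) * inv_weight x.

(* S induces a map from X to Y, both taken modulo a.e. equality. *)
Definition operator X Y S : Prop :=
  (forall f, X f -> Y (S f)) /\
  (forall f g, X f -> X g -> ae_equal f g -> ae_equal (S f) (S g)).

Definition injective_operator X S : Prop :=
  forall f g, X f -> X g -> ae_equal (S f) (S g) -> ae_equal f g.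

Definition linear_operator X S : Prop :=
  forall (a : R[i]) f g, X f -> X g ->
    ae_equal (S (fun x => a * f x + g x)) (fun x => a * S f x + S g x).

Definition llogl_opnorm S : \bar R :=
  ereal_sup [set llogl_norm (S f) | f in
    [set f | LlogL f /\ (llogl_norm f <= 1)%E]].

Definition bounded_projection S : Prop :=
  [/\ operator LlogL LlogL S, linear_operator LlogL S,
      (llogl_opnorm S < +oo)%E
    & forall f, LlogL f -> ae_equal (S (S f)) (S f)].

End FiniteHilbertTransform.

(* Main.v *)
Require Import Defs.
From mathcomp Require Import all_boot all_order all_algebra.
From mathcomp Require Import all_classical all_reals all_analysis measurable_realfun.
From mathcomp Require Import ring lra.

(* For z = x + iy with y > 0 let C f(z) be the integral of f(t) / (t - z) over
   D = (-1, 1), and let w(x) = sqrt(1 - x^2).  If |f| <= 1/pi, then the imaginary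
   part of C f stays in [-1, 1] and the analyticity of exp(C f) bounds the integral
   of exp |Re C f(x + iy)| over D uniformly in y.  By duality and Young's inequality
   a b <= a ln(1 + a) + e^b, the maps sending f to Re C f(. + iy) and to
   w^-1 Re C(w f)(. + iy) are bounded from L log L to L^1, uniformly in y.

   For bounded Lipschitz f let V and w U be the principal value integrals of f and
   w f.  Partial fractions and the vanishing of the principal value integral of 1/w
   express C(w V) and C U through C f and C(w f); by density and the bounds above
   these identities hold for every f in L log L.  As y -> 0 at Lebesgue points their
   imaginary parts identify V and U with the principal values of f and w f, while
   their real parts give the principal values of w V and U, that is, both inversion
   formulas.  As y -> oo they give that U has mean zero.

   The triangle inequality in L log L follows from ln(2e/t) = 1 + int_t^2 ds/s and
   from int_0^s f* = min_l (int (|f| - l)^+ + s l). *)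

(** Almost everywhere existence of principal values is usually drawn from a maximal inequality; here
    algebra replaces it. The imaginary part of the identity for C(w V) is linear in Re C f, with a
    coefficient tending to pi w(x) > 0. At a common Lebesgue point of f and w V it can be solved for
    Re C f, whose convergence is thus a conclusion. In the same way the identity for C U is solved
    for Re C(w f). Until then V and U are only L^1 limits along an approximating sequence.

    The a priori bounds are not homogeneous: at every scale N they read (1/N)(int Psi(N |f|) +
    constant), where Psi(a) = a ln(1 + a). Approximation is therefore measured by int Psi(N |f - g|)
    with N = 2^n, which gives geometric rates and needs no dual of L log L. The norm of the theorem
    comes in only afterwards: a finite norm makes int Psi(|f|) finite, the norm dominates the L^1
    norm, it is subadditive, and it is finite at 1/w. In terms of the operators, T f = V / pi and
    the transform with a hat is - U / pi. *)

Set Implicit Arguments.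
Unset Strict Implicit.
Unset Printing Implicit Defensive.
Import Order.TTheory GRing.Theory Num.Theory numFieldNormedType.Exports.
Local Open Scope classical_set_scope.
Local Open Scope ring_scope.

(** * Integration *)

Section IntegralTools.
Context d (T : measurableType d) (R : realType).
Variable mu : {measure set T -> \bar R}.
Implicit Types (A : set T) (f g h : T -> R).

Definition intble A f := mu.-integrable A (EFin \o f).

Lemma intble_measurable A f : intble A f -> measurable_fun A f.
Proof. by move=> /integrableP[/measurable_EFinP]. Qed.

Lemma intble_bounded A f (M : R) : measurable A -> (mu A < +oo)%E ->
  measurable_fun A f -> (forall x, A x -> `|f x| <= M) -> intble A f.
Proof.
move=> mA Afin mf fM; apply: measurable_bounded_integrable => //.
exists M; split; first exact: num_real.
by move=> N MN x Ax; apply: le_trans (fM _ Ax) (ltW MN).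
Qed.

Lemma intble_le A f g : measurable A -> measurable_fun A f ->
  (forall x, A x -> `|f x| <= g x) -> intble A g -> intble A f.
Proof.
move=> mA mf fg ig; apply: le_integrable ig => //; first exact/measurable_EFinP.
move=> x Ax /=; rewrite lee_fin (le_trans (fg _ Ax))//; exact: ler_norm.
Qed.

Lemma eq_intble A f g : measurable A -> (forall x, A x -> f x = g x) ->
  intble A f -> intble A g.
Proof.
move=> mA fg; apply: eq_integrable => // x /set_mem Ax /=; by rewrite fg.
Qed.

Lemma intbleD A f g : measurable A -> intble A f -> intble A g ->
  intble A (fun x => f x + g x).
Proof. by move=> mA If Ig; exact: (integrableD mA If Ig). Qed.

Lemma intbleB A f g : measurable A -> intble A f -> intble A g ->
  intble A (fun x => f x - g x).
Proof. by move=> mA If Ig; exact: (integrableB mA If Ig). Qed.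

Lemma intbleZ A f (k : R) : measurable A -> intble A f ->
  intble A (fun x => k * f x).
Proof. by move=> mA If; exact: (integrableZl mA k If). Qed.

Lemma intbleN A f : measurable A -> intble A f -> intble A (fun x => - f x).
Proof.
move=> mA /(intbleZ (-1) mA); apply: eq_intble => // x _; by rewrite mulN1r.
Qed.

Lemma intble_norm A f : intble A f -> intble A (fun x => `|f x|).
Proof. exact: integrable_norm. Qed.

Lemma intbleS A B f : measurable A -> measurable B -> B `<=` A ->
  intble A f -> intble B f.
Proof. by move=> mA mB BA; exact: integrableS. Qed.

Lemma intbleM A f g (M : R) : measurable A -> intble A f ->
  measurable_fun A g -> (forall x, A x -> `|g x| <= M) ->
  intble A (fun x => f x * g x).
Proof.
move=> mA If mg gM; apply: (@intble_le _ _ (fun x => M * `|f x|)) => //.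
- by apply: measurable_funM => //; exact: intble_measurable.
- by move=> x Ax; rewrite normrM mulrC ler_wpM2r// gM.
- exact/intbleZ/intble_norm.
Qed.

Lemma intble0 A : measurable A -> intble A (fun=> 0).
Proof. by move=> mA; exact: integrable0. Qed.

Lemma intble_cst A (k : R) : measurable A -> (mu A < +oo)%E -> intble A (fun=> k).
Proof.
by move=> mA fA; apply: (@intble_bounded _ _ `|k|).
Qed.

Lemma RintE A f : measurable A -> intble A f ->
  (\int[mu]_(x in A) (f x)%:E)%E = (\int[mu]_(x in A) f x)%:E.
Proof.
by move=> mA If; rewrite /Rintegral fineK//; exact: integrable_fin_num.
Qed.

Lemma le_Rint_norm A f g : measurable A -> measurable_fun A f ->
  intble A g -> (forall x, A x -> `|f x| <= g x) ->
  `|\int[mu]_(x in A) f x| <= \int[mu]_(x in A) g x.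
Proof.
move=> mA mf Ig fg; have If : intble A f by exact: intble_le Ig.
apply: (le_trans (le_normr_Rintegral _ _)) => //.
by apply: le_Rintegral => //; exact: intble_norm.
Qed.

Lemma Rint_cvg_ae A (f_ : nat -> T -> R) f g : measurable A ->
  (forall n, measurable_fun A (f_ n)) -> measurable_fun A f ->
  {ae mu, forall x, A x -> f_ n x @[n --> \oo] --> f x} ->
  intble A g ->
  (forall n x, A x -> `|f_ n x| <= g x) ->
  \int[mu]_(x in A) f_ n x @[n --> \oo] --> \int[mu]_(x in A) f x.
Proof.
move=> mA mf_ mf f_f Ig fg.
have [||||If _ cvgf] := @dominated_convergence _ _ _ mu A mA
  (fun n x => (f_ n x)%:E) (EFin \o f) (EFin \o g) _ _ _ Ig.
- by move=> n; exact/measurable_EFinP.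
- exact/measurable_EFinP.
- apply: negligibleS f_f => x /= nh h; apply: nh => Ax.
  by apply: cvg_EFin; [exact: nearW|exact: h].
- by apply: aeW => x n Ax /=; rewrite lee_fin fg.
have If_ n : intble A (f_ n) by exact: intble_le (fg n) Ig.
apply: fine_cvg; rewrite fineK; last exact: integrable_fin_num.
exact: cvgf.
Qed.

(** Convergence at every point of [A] makes the limit measurable, which the almost everywhere
    version has to assume; this is how principal value functions are later seen to be integrable. *)
Lemma Rint_cvg A (f_ : nat -> T -> R) f g : measurable A ->
  (forall n, measurable_fun A (f_ n)) ->
  (forall x, A x -> f_ n x @[n --> \oo] --> f x) ->
  intble A g ->
  (forall n x, A x -> `|f_ n x| <= g x) ->
  intble A f /\
  \int[mu]_(x in A) f_ n x @[n --> \oo] --> \int[mu]_(x in A) f x.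
Proof.
move=> mA mf_ f_f Ig fg.
have mf : measurable_fun A f by apply: (measurable_fun_cvg mf_) => // x /f_f.
split; last by apply: Rint_cvg_ae Ig fg => //; apply: aeW => x; exact: f_f.
apply: (intble_le mA mf _ Ig) => x Ax.
apply: (cvgr_to_le (cvg_norm (f_f x Ax))).
by apply: nearW => n; exact: fg.
Qed.

Lemma Rint_cvg_at_right A (f_ : R -> T -> R) f g (r : R) : measurable A -> 0 < r ->
  (forall y, 0 < y < r -> measurable_fun A (f_ y)) ->
  (forall x, A x -> f_ y x @[y --> 0^'+] --> f x) ->
  intble A g ->
  (forall y x, 0 < y < r -> A x -> `|f_ y x| <= g x) ->
  \int[mu]_(x in A) f_ y x @[y --> 0^'+] --> \int[mu]_(x in A) f x.
Proof.
move=> mA r0 mf_ f_f Ig fg; apply/cvg_at_rightP => u [u0 ucvg].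
have /cvgrPdist_lt/(_ _ r0)[N _ uN] := ucvg.
have uNr n : 0 < u (n + N)%N < r.
  rewrite u0/=; have := uN (n + N)%N (leq_addl _ _).
  by rewrite sub0r normrN gtr0_norm.
(* The first terms of the test sequence may exceed [r], where no domination is assumed; the shift by
   [N] drops them. *)
rewrite -(cvg_shiftn N).
apply: (@Rint_cvg A (fun n => f_ (u (n + N)%N)) f g _ _ _ Ig _).2 => //.
- by move=> n; exact: mf_.
- move=> x Ax; rewrite (cvg_shiftn N (fun n => f_ (u n) x)).
  by have /cvg_at_rightP := f_f x Ax; apply.
- by move=> n x Ax; exact: fg.
Qed.

Lemma intble_patch A f : measurable A -> intble A f -> intble setT (f \_ A).
Proof.
move=> mA /(integrable_mkcond _ mA); apply: eq_integrable => // x _ /=.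
by rewrite /patch; case: ifP.
Qed.
End IntegralTools.

(** * Exchange of integrals on rectangles *)

Section FubiniTools.
Context d1 d2 (T1 : measurableType d1) (T2 : measurableType d2) (R : realType).
Variable m1 : {sigma_finite_measure set T1 -> \bar R}.
Variable m2 : {sigma_finite_measure set T2 -> \bar R}.
Implicit Types (A : set T1) (B : set T2) (F : T1 * T2 -> R).

Lemma tonelli_on A B (F : T1 * T2 -> \bar R) : measurable A -> measurable B ->
  measurable_fun setT F -> (forall z, (0 <= F z)%E) ->
  (\int[m1]_(x in A) \int[m2]_(t in B) F (x, t) =
   \int[m2]_(t in B) \int[m1]_(x in A) F (x, t))%E.
Proof.
move=> mA mB mF F0.
pose G := F \_ (A `*` B).
have mG : measurable_fun setT G.
  apply/(measurable_restrictT _ _).1; first exact: measurableX.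
  exact: measurable_funTS.
have G0 z : (0 <= G z)%E by apply: erestrict_ge0.
have := @fubini_tonelli _ _ T1 T2 R m1 m2 G mG G0.
rewrite [in X in X -> _](_ : (fun x => \int[m2]_t G (x, t))%E =
  (fun x => \int[m2]_(t in B) F (x, t))%E \_ A); last first.
  apply/funext => x; rewrite /G /patch; case: ifPn => xA.
    rewrite [RHS]integral_mkcond; apply: eq_integral => t _.
    by rewrite /patch in_setX/= xA.
  under eq_integral do rewrite in_setX/= (negbTE xA)/=.
  by rewrite integral0.
rewrite -integral_mkcond => ->.
rewrite [in X in X = _](_ : (fun t => \int[m1]_x G (x, t))%E =
  (fun t => \int[m1]_(x in A) F (x, t))%E \_ B); last first.
  apply/funext => t; rewrite /G /patch; case: ifPn => tB.
    rewrite [RHS]integral_mkcond; apply: eq_integral => x _.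
    by rewrite /patch in_setX/= tB andbT.
  under eq_integral do rewrite in_setX/= (negbTE tB)/= andbF.
  by rewrite integral0.
by rewrite -integral_mkcond.
Qed.

Lemma measurable_ge0_inner B (F : T1 * T2 -> \bar R) : measurable B ->
  measurable_fun setT F -> (forall z, (0 <= F z)%E) ->
  measurable_fun setT (fun x => \int[m2]_(t in B) F (x, t))%E.
Proof.
move=> mB mF F0.
pose G := F \_ (setT `*` B).
have mG : measurable_fun setT G.
  apply/(measurable_restrictT _ _).1; first exact: measurableX.
  exact: measurable_funTS.
have G0 z : (0 <= G z)%E by apply: erestrict_ge0.
have := @measurable_fun_fubini_tonelli_F _ _ T1 T2 R m2 G mG G0.
congr (measurable_fun _ _); apply/funext => x.
rewrite [RHS]integral_mkcond; apply: eq_integral => t _.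
by rewrite /G /patch in_setX/= in_setT.
Qed.

Lemma measurable_inner B F : measurable B -> measurable_fun setT F ->
  measurable_fun setT (fun x => \int[m2]_(t in B) F (x, t)).
Proof.
move=> mB mF; apply: measurableT_comp => //=.
rewrite (_ : (fun x => _) = (fun x => \int[m2]_(t in B) (EFin \o F)^\+ (x, t) -
   \int[m2]_(t in B) (EFin \o F)^\- (x, t))%E); last first.
  by apply/funext => x; rewrite integralE; congr (_ - _)%E;
    apply: eq_integral => t _; rewrite ?funepos.unlock ?funeneg.unlock.
apply: emeasurable_funB; apply: measurable_ge0_inner => //.
  by apply: measurable_funepos; exact/measurable_EFinP.
by apply: measurable_funeneg; exact/measurable_EFinP.
Qed.

(** A majorant in product form gives absolute integrability on the rectangle by Tonelli. Extension
    by zero transfers the problem to the whole product space. *)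
Lemma fubini_on A B F (a : T1 -> R) (b : T2 -> R) :
  measurable A -> measurable B -> measurable_fun setT F ->
  intble m1 A a -> intble m2 B b ->
  (forall x t, A x -> B t -> `|F (x, t)| <= a x * b t) ->
  \int[m1]_(x in A) (\int[m2]_(t in B) F (x, t)) =
  \int[m2]_(t in B) (\int[m1]_(x in A) F (x, t)).
Proof.
move=> mA mB mF Ia Ib Fab.
pose G := F \_ (A `*` B).
have mG : measurable_fun setT G.
  apply/(measurable_restrictT _ _).1; first exact: measurableX.
  exact: measurable_funTS.
have IG : (m1 \x m2)%E.-integrable setT (EFin \o G).
  apply/integrable12ltyP; first exact/measurable_EFinP.
  have mab : measurable_fun setT (fun z : T1 * T2 => `|(a \_ A) z.1| * `|(b \_ B) z.2|).
    apply: measurable_funM; apply: measurableT_comp => //.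
      apply: (@measurableT_comp _ _ _ _ _ _ (a \_ A) _ fst) => //.
      by apply/(measurable_restrictT _ _).1 => //; exact: intble_measurable Ia.
    apply: (@measurableT_comp _ _ _ _ _ _ (b \_ B) _ snd) => //.
    by apply/(measurable_restrictT _ _).1 => //; exact: intble_measurable Ib.
  apply: (@le_lt_trans _ _ (\int[m1]_x (\int[m2]_t (`|(a \_ A) x| * `|(b \_ B) t|)%:E))%E).
    apply: ge0_le_integral => //.
    - by move=> x _; exact: integral_ge0.
    - have := @measurable_ge0_inner setT (fun z => `|(EFin \o G) z|%E) measurableT _ _.
      by apply=> //; apply: measurableT_comp => //; exact/measurable_EFinP.
    - apply: (@measurable_ge0_inner setT
        (fun z => (`|(a \_ A) z.1| * `|(b \_ B) z.2|)%:E) measurableT).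
        exact/measurable_EFinP.
      by move=> z; rewrite lee_fin mulr_ge0.
    - move=> x _; apply: ge0_le_integral => //.
      + apply: measurableT_comp => //; apply/measurable_EFinP.
        exact: measurableT_comp.
      + apply/measurable_EFinP; apply: measurable_funM => //.
        apply: measurableT_comp => //; apply/(measurable_restrictT _ _).1 => //.
        exact: intble_measurable Ib.
      + move=> t _; rewrite /G/= /patch in_setX/= lee_fin.
        case: ifPn => [|_]; last by rewrite normr0 mulr_ge0.
        move=> /andP[/set_mem/= Ax /set_mem/= Bt].
        have h := Fab _ _ Ax Bt; rewrite !mem_set//.
        by rewrite (le_trans h)// -normrM ler_norm.
  under eq_integral => x _.
    under eq_integral do rewrite EFinM.
    rewrite ge0_integralZl//; last first.
      apply/measurable_EFinP; apply: measurableT_comp => //.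
      by apply/(measurable_restrictT _ _).1 => //; exact: intble_measurable Ib.
    over.
  have [_ Ib'] := integrableP _ _ _ (intble_norm (intble_patch mB Ib)).
  have [_ Ia'] := integrableP _ _ _ (intble_norm (intble_patch mA Ia)).
  move: Ia' Ib'.
  under eq_integral do rewrite /= normr_id.
  move=> Ia'; under eq_integral do rewrite /= normr_id.
  move=> Ib'.
  rewrite ge0_integralZr//.
  - rewrite lte_mul_pinfty//; first exact: integral_ge0.
    by rewrite ge0_fin_numE//; exact: integral_ge0.
  - apply/measurable_EFinP; apply: measurableT_comp => //.
    by apply/(measurable_restrictT _ _).1 => //; exact: intble_measurable Ia.
  - exact: integral_ge0.
have FG x : A x -> \int[m2]_(t in B) F (x, t) = \int[m2]_t G (x, t).
  move=> Ax; rewrite Rintegral_mkcond; apply: eq_Rintegral => t _.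
  by rewrite /G /patch in_setX/= (mem_set Ax).
have FG' t : B t -> \int[m1]_(x in A) F (x, t) = \int[m1]_x G (x, t).
  move=> Bt; rewrite Rintegral_mkcond; apply: eq_Rintegral => x _.
  by rewrite /G /patch in_setX/= (mem_set Bt) andbT.
transitivity (\int[m1]_x (\int[m2]_t G (x, t))).
  rewrite Rintegral_mkcond; apply: eq_Rintegral => x _.
  rewrite /patch; case: ifPn => [/set_mem/FG//|xA].
  rewrite /Rintegral [X in fine X]integral0_eq// => t _.
  by rewrite /G /patch in_setX/= (negbTE xA).
transitivity (\int[m2]_t (\int[m1]_x G (x, t))); last first.
  rewrite [RHS]Rintegral_mkcond; apply: eq_Rintegral => t _.
  rewrite /patch; case: ifPn => [/set_mem/FG'//|xA].
  rewrite /Rintegral [X in fine X]integral0_eq// => x _.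
  by rewrite /G /patch in_setX/= (negbTE xA) andbF.
have Ix x : intble m2 setT (fun t => G (x, t)).
  have [Ax|nAx] := pselect (A x); last first.
    apply: (@eq_intble _ _ _ m2 setT (fun=> 0)) => //; last exact: intble0.
    move=> t _; by rewrite /G /patch in_setX/= memNset.
  have /intbleZ -/(_ (a x) mB) := Ib.
  move=> /(@intble_le _ _ _ _ _ (fun t => F (x, t)) _ mB) h.
  have {h} h1 : intble m2 B (fun t => F (x, t)).
    apply: h; last by move=> t Bt; exact: Fab.
    by apply: measurable_funTS; exact: (measurableT_comp mF).
  apply: eq_intble (intble_patch mB h1) => // t _ /=.
  by rewrite /G /patch in_setX/= (mem_set Ax).
have Iy t : intble m1 setT (fun x => G (x, t)).
  have [Bt|nBt] := pselect (B t); last first.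
    apply: (@eq_intble _ _ _ m1 setT (fun=> 0)) => //; last exact: intble0.
    move=> x _; by rewrite /G /patch in_setX/= (memNset nBt) andbF.
  have /intbleZ -/(_ (b t) mA) := Ia.
  move=> /(@intble_le _ _ _ _ _ (fun x => F (x, t)) _ mA) h.
  have {h} h1 : intble m1 A (fun x => F (x, t)).
    apply: h; last by move=> x Ax; rewrite mulrC; exact: Fab.
    by apply: measurable_funTS; exact: (measurableT_comp mF).
  apply: eq_intble (intble_patch mA h1) => // x _ /=.
  by rewrite /G /patch in_setX/= (mem_set Bt) andbT.
have := Fubini IG.
under eq_integral => x _ do rewrite /= (RintE measurableT)//.
move=> /(congr1 fine); rewrite [in X in _ = X -> _](_ : (fun y => _) =
   (fun t => (\int[m1]_x G (x, t))%:E)); last first.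
  by apply/funext => t; rewrite /= (RintE measurableT).
by [].
Qed.
End FubiniTools.

(** * Derivatives and the fundamental theorem of calculus *)

Section DerivativeTools.
Context (R : realType).
Implicit Types (f g F : R -> R) (x a b : R).
Notation mu := (@lebesgue_measure R).

(** Derivatives are computed by composing the rules below as terms; the expression that results is
    brought to the desired form through this lemma, usually by [ring] or [field]. *)
Lemma der_eq f x a b : is_derive x 1 f a -> a = b -> is_derive x 1 f b.
Proof. by move=> + <-. Qed.

Lemma derC (k x : R) : is_derive x 1 (fun=> k) 0.
Proof. exact: is_derive_cst. Qed.

Lemma derI (x : R) : is_derive x 1 (fun t : R => t) 1.
Proof. exact: is_derive_id. Qed.

Lemma derD f g x a b : is_derive x 1 f a -> is_derive x 1 g b ->
  is_derive x 1 (fun t => f t + g t) (a + b).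
Proof. by move=> df dg; exact: is_deriveD. Qed.

Lemma derB f g x a b : is_derive x 1 f a -> is_derive x 1 g b ->
  is_derive x 1 (fun t => f t - g t) (a - b).
Proof. by move=> df dg; exact: is_deriveB. Qed.

Lemma derN f x a : is_derive x 1 f a -> is_derive x 1 (fun t => - f t) (- a).
Proof. by move=> df; exact: is_deriveN. Qed.

Lemma derM f g x a b : is_derive x 1 f a -> is_derive x 1 g b ->
  is_derive x 1 (fun t => f t * g t) (f x * b + g x * a).
Proof. by move=> df dg; exact: is_deriveM. Qed.

Lemma derZ f x (k a : R) : is_derive x 1 f a -> is_derive x 1 (fun t => k * f t) (k * a).
Proof.
by move=> df; apply: der_eq (derM (derC k x) df) _; rewrite mulr0 addr0.
Qed.

Lemma der_comp f g x a b : is_derive (g x) 1 f a -> is_derive x 1 g b ->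
  is_derive x 1 (fun t => f (g t)) (b * a).
Proof. by move=> df dg; apply: der_eq (is_derive1_comp df dg) _; rewrite mulrC. Qed.

Lemma derV f x a : f x != 0 -> is_derive x 1 f a ->
  is_derive x 1 (fun t => (f t)^-1) (- (f x) ^- 2 * a).
Proof. by move=> f0 df; exact: is_deriveV. Qed.

Lemma derX2 f x a : is_derive x 1 f a ->
  is_derive x 1 (fun t => f t ^+ 2) (2 * f x * a).
Proof.
move=> df; have := derM df df.
rewrite (_ : (fun t => f t * f t) = (fun t => f t ^+ 2)); last first.
  by apply/funext => t; rewrite expr2.
by move=> h; apply: der_eq h _; ring.
Qed.

Lemma der_cont f x a : is_derive x 1 f a -> {for x, continuous f}.
Proof.
by move=> [df _]; apply: differentiable_continuous; apply/derivable1_diffP.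
Qed.

Lemma open_continuous_measurable (a b : R) f :
  (forall x, a < x < b -> {for x, continuous f}) -> measurable_fun `]a, b[ f.
Proof.
move=> cf; apply: open_continuous_measurable_fun; first exact: interval_open.
by move=> x /set_mem/=; rewrite in_itv/=; exact: cf.
Qed.

Lemma ftc_cc f F a b : a < b ->
  (forall x, a <= x <= b -> is_derive x 1 F (f x)) ->
  (forall x, a <= x <= b -> {for x, continuous f}) ->
  \int[mu]_(x in `[a, b]) f x = F b - F a.
Proof.
move=> ab dF cf; rewrite /Rintegral (@continuous_FTC2 _ f F)//.
- apply: continuous_in_subspaceT => x /set_mem/=; rewrite in_itv/= => xab; exact: cf.
- split.
  + move=> x; rewrite in_itv/= => /andP[ax xb].
    by have [] := dF x; rewrite ?(ltW ax) ?(ltW xb).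
  + apply: cvg_at_right_filter; apply: (@der_cont F a (f a)).
    by apply: dF; rewrite lexx ltW.
  + apply: cvg_at_left_filter; apply: (@der_cont F b (f b)).
    by apply: dF; rewrite lexx ltW.
- move=> x; rewrite in_itv/= => /andP[ax xb]; rewrite derive1E.
  by have [|_ ->//] := dF x; rewrite (ltW ax) (ltW xb).
Qed.

Lemma continuous_intble f a b :
  (forall x, a <= x <= b -> {for x, continuous f}) -> intble mu `[a, b] f.
Proof.
move=> cf; apply: continuous_compact_integrable; first exact: segment_compact.
apply: continuous_in_subspaceT => x /set_mem/=; rewrite in_itv/= => xab; exact: cf.
Qed.

(** Meant for integrands that blow up at the end points, such as the inverse weight. The sign
    hypothesis makes the integrals over an exhausting sequence of closed intervals monotone, so the
    one-sided limits of the primitive yield integrability and value together. *)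
Lemma ftc_oo f F a b : a < b ->
  (forall x, a < x < b -> is_derive x 1 F (f x)) ->
  (forall x, a < x < b -> {for x, continuous f}) ->
  (forall x, a < x < b -> 0 <= f x) ->
  F x @[x --> a^'+] --> F a -> F x @[x --> b^'-] --> F b ->
  intble mu `]a, b[ f /\ \int[mu]_(x in `]a, b[) f x = F b - F a.
Proof.
move=> ab dF cf f0 Fa Fb.
have [r r0 br] : exists2 r : R, 0 < r & b = a + 2 * r.
  by exists ((b - a) / 2); [rewrite divr_gt0// subr_gt0|field].
have [q [rn dec c0]] : exists q : nat -> R, [/\ forall n, 0 < q n < r,
    forall n m, (n <= m)%N -> q m <= q n & q n @[n --> \oo] --> (0:R)].
  (* Since [r] is half the length of the interval, [q n < r] ensures [a + q n < b - q n] for every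
     [n]. *)
  exists (fun n => r / 2 / n.+1%:R); split.
  - move=> n; rewrite divr_gt0 ?divr_gt0//= ltr_pdivrMr//.
    have n1 : (1 : R) <= n.+1%:R by rewrite ler1n.
    by apply: (@lt_le_trans _ _ r); [lra|rewrite ler_peMr// ltW].
  - by move=> n m nm; rewrite ler_wpM2l ?divr_ge0 ?(ltW r0)// lef_pV2 ?posrE// ler_nat.
  - rewrite -(mulr0 (r / 2)); apply: cvgM; first exact: cvg_cst.
    exact: cvg_harmonic.
pose c (n : nat) := a + q n; pose d (n : nat) := b - q n.
have cd n : c n < d n.
  have /andP[rn1 rn2] := rn n; rewrite /c /d; lra.
have acn n : a < c n.
  have /andP[rn1 rn2] := rn n; rewrite /c; lra.
have dbn n : d n < b.
  have /andP[rn1 rn2] := rn n; rewrite /d; lra.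
have mf : measurable_fun `]a, b[ f by exact: open_continuous_measurable.
have sub n : `[c n, d n] `<=` `]a, b[.
  move=> x /=; rewrite !in_itv/= => /andP[cx xd].
  by rewrite (lt_le_trans (acn n) cx) (le_lt_trans xd (dbn n)).
pose J (n : nat) : set R := `[c n, d n]%classic.
have UI : \bigcup_n J n = `]a, b[%classic.
  apply/seteqP; split => [x [n _ /sub//]|x /=].
  rewrite in_itv/= => /andP[ax xb].
  have e0 : 0 < Num.min (x - a) (b - x) by rewrite lt_min !subr_gt0 ax.
  have /cvgrPdist_lt/(_ _ e0)[N _ /(_ N (leqnn _))] := c0.
  rewrite sub0r normrN gtr0_norm; last by case/andP: (rn N).
  rewrite lt_min => /andP[h1 h2]; exists N => //=; rewrite /J/= in_itv/= /c /d.
  by apply/andP; split; lra.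
have Icd n : (\int[mu]_(x in `[c n, d n]) (f x)%:E = (F (d n) - F (c n))%:E)%E.
  have cfn x : c n <= x <= d n -> {for x, continuous f}.
    move=> xcd; apply: cf; have /= := sub n x; rewrite !in_itv/=; exact.
  rewrite RintE//; last exact: continuous_intble.
  congr EFin; apply: ftc_cc => // x xcd; apply: dF.
  by have /= := sub n x; rewrite !in_itv/=; exact.
have h1 : ((F (d n) - F (c n))%:E @[n --> \oo] --> \int[mu]_(x in `]a, b[) (f x)%:E)%E.
  rewrite -UI; under eq_fun do rewrite -Icd.
  apply: ge0_nondecreasing_set_cvg_integral.
  - move=> n m nm; rewrite subsetEset => x; rewrite /J/= !in_itv/= => /andP[].
    rewrite /c /d => h1 h2; have := dec _ _ nm; move: h1 h2.
    by move=> *; apply/andP; split; lra.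
  - by move=> n; exact: measurable_itv.
  - by move=> n; apply/measurable_EFinP; apply: (measurable_funS _ (@sub n) mf).
  - move=> n x /sub/=; rewrite in_itv/= lee_fin; exact: f0.
have h2 : ((F (d n) - F (c n))%:E @[n --> \oo] --> (F b - F a)%:E)%E.
  apply: cvg_EFin; first exact: nearW.
  apply: cvgB.
    move/cvg_at_leftP : Fb; apply; split; first exact: dbn.
    rewrite -[X in _ --> X]subr0; apply: cvgB => //; exact: cvg_cst.
  move/cvg_at_rightP : Fa; apply; split; first exact: acn.
  rewrite -[X in _ --> X]addr0; apply: cvgD => //; exact: cvg_cst.
have E : (\int[mu]_(x in `]a, b[) (f x)%:E = (F b - F a)%:E)%E.
  exact: (cvg_unique _ h1 h2).
split; last by rewrite /Rintegral E.
apply/integrableP; split; first exact/measurable_EFinP.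
under eq_integral => x /set_mem/=; rewrite ?in_itv/=.
  move=> xab; rewrite /= ger0_norm; last exact: f0.
  over.
by rewrite E ltry.
Qed.
End DerivativeTools.

(** * Cauchy integrals on (-1, 1) *)

Section Kernels.
Context (R : realType).
Implicit Types (x y u t : R).
Notation mu := (@lebesgue_measure R).

(* With s = u + iy: kp = Re (1/s), kq = - Im (1/s), ka = Re (1/s^2), kb = - Im (1/s^2). *)
Definition kp y u : R := u / (u ^+ 2 + y ^+ 2).
Definition kq y u : R := y / (u ^+ 2 + y ^+ 2).
Definition ka y u : R := (u ^+ 2 - y ^+ 2) / (u ^+ 2 + y ^+ 2) ^+ 2.
Definition kb y u : R := 2 * u * y / (u ^+ 2 + y ^+ 2) ^+ 2.

Lemma sqD_gt0 y u : 0 < y -> 0 < u ^+ 2 + y ^+ 2.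
Proof. by move=> y0; rewrite ltr_wpDl ?sqr_ge0// exprn_gt0. Qed.

Lemma sqD_neq0 y u : 0 < y -> u ^+ 2 + y ^+ 2 != 0.
Proof. by move=> /(sqD_gt0 u) /lt0r_neq0. Qed.

Lemma der_kp_u y u : 0 < y -> is_derive u 1 (kp y) (- ka y u).
Proof.
move=> y0; have n0 := sqD_neq0 u y0.
apply: der_eq (derM (derI u) (derV (f := fun u => u ^+ 2 + y ^+ 2) n0
  (derD (derX2 (derI u)) (derC _ _)))) _.
by rewrite /ka; field.
Qed.

Lemma der_kq_u y u : 0 < y -> is_derive u 1 (kq y) (- kb y u).
Proof.
move=> y0; have n0 := sqD_neq0 u y0.
apply: der_eq (derM (derC y u) (derV (f := fun u => u ^+ 2 + y ^+ 2) n0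
  (derD (derX2 (derI u)) (derC _ _)))) _.
by rewrite /kb; field.
Qed.

Lemma der_kp_y y u : 0 < y -> is_derive y 1 (kp ^~ u) (- kb y u).
Proof.
move=> y0; have n0 := sqD_neq0 u y0.
apply: der_eq (derM (derC u y) (derV (f := fun y => u ^+ 2 + y ^+ 2) n0
  (derD (derC _ _) (derX2 (derI y))))) _.
by rewrite /kb; field.
Qed.

Lemma der_kq_y y u : 0 < y -> is_derive y 1 (kq ^~ u) (ka y u).
Proof.
move=> y0; have n0 := sqD_neq0 u y0.
apply: der_eq (derM (derI y) (derV (f := fun y => u ^+ 2 + y ^+ 2) n0
  (derD (derC _ _) (derX2 (derI y))))) _.
by rewrite /ka; field.
Qed.

Lemma kp_cont y : 0 < y -> continuous (kp y).
Proof. by move=> y0 u; exact: der_cont (der_kp_u u y0). Qed.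

Lemma kq_cont y : 0 < y -> continuous (kq y).
Proof. by move=> y0 u; exact: der_cont (der_kq_u u y0). Qed.

Lemma ka_cont y : 0 < y -> continuous (ka y).
Proof.
move=> y0 u; have n0 : (u ^+ 2 + y ^+ 2) ^+ 2 != 0 by rewrite expf_neq0// sqD_neq0.
exact: der_cont (derM (derB (derX2 (derI u)) (derC _ _))
  (derV (f := fun u => (u ^+ 2 + y ^+ 2) ^+ 2) n0
  (derX2 (derD (derX2 (derI u)) (derC _ _))))).
Qed.

Lemma kb_cont y : 0 < y -> continuous (kb y).
Proof.
move=> y0 u; have n0 : (u ^+ 2 + y ^+ 2) ^+ 2 != 0 by rewrite expf_neq0// sqD_neq0.
exact: der_cont (derM (derM (derM (derC 2 u) (derI u)) (derC y u))
  (derV (f := fun u => (u ^+ 2 + y ^+ 2) ^+ 2) n0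
  (derX2 (derD (derX2 (derI u)) (derC _ _))))).
Qed.

Lemma kp_measurable y : 0 < y -> measurable_fun setT (kp y).
Proof. by move=> y0; apply: continuous_measurable_fun; exact: kp_cont. Qed.

Lemma kq_measurable y : 0 < y -> measurable_fun setT (kq y).
Proof. by move=> y0; apply: continuous_measurable_fun; exact: kq_cont. Qed.

Lemma kpN y u : kp y (- u) = - kp y u.
Proof. by rewrite /kp sqrrN mulNr. Qed.

Lemma kq_ge0 y u : 0 < y -> 0 <= kq y u.
Proof. by move=> y0; rewrite divr_ge0// ?(ltW y0)// ltW// sqD_gt0. Qed.

Lemma kq_le y u : 0 < y -> kq y u <= y^-1.
Proof.
move=> y0; rewrite /kq ler_pdivrMr ?sqD_gt0// mulrC ler_pdivlMr//.
by rewrite -expr2 lerDr sqr_ge0.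
Qed.

Lemma kp_le y u : 0 < y -> `|kp y u| <= y^-1.
Proof.
move=> y0; rewrite /kp normrM normfV (gtr0_norm (sqD_gt0 u y0)).
rewrite ler_pdivrMr ?sqD_gt0// mulrC ler_pdivlMr// -(real_normK (num_real u)).
have := sqr_ge0 (`|u| - y); have := sqr_ge0 (`|u| + y); nra.
Qed.

Lemma kp_leV y u : 0 < y -> u != 0 -> `|kp y u| <= `|u|^-1.
Proof.
move=> y0 u0; rewrite /kp normrM normfV (gtr0_norm (sqD_gt0 u y0)).
rewrite ler_pdivrMr ?sqD_gt0// mulrC ler_pdivlMr ?normr_gt0//.
by rewrite -expr2 (real_normK (num_real u)) lerDl sqr_ge0.
Qed.

Lemma kq_leV2 y u : 0 < y -> u != 0 -> kq y u <= y / u ^+ 2.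
Proof.
move=> y0 u0; rewrite /kq ler_wpM2l ?(ltW y0)// lef_pV2 ?posrE ?sqD_gt0//.
  by rewrite lerDl sqr_ge0.
by rewrite exprn_even_gt0//= u0.
Qed.

(** The source of uniformity in [y]: a numerator that vanishes linearly at the singularity absorbs
    the kernel with a constant that does not depend on [y]. *)
Lemma kp_mul_le y u : 0 < y -> `|u * kp y u| <= 1.
Proof.
move=> y0; rewrite /kp mulrA -expr2 ger0_norm; last first.
  by rewrite divr_ge0 ?sqr_ge0// ltW// sqD_gt0.
by rewrite ler_pdivrMr ?sqD_gt0// mul1r lerDl sqr_ge0.
Qed.

Lemma ka_le y u : 0 < y -> `|ka y u| <= y ^- 2.
Proof.
move=> y0; rewrite /ka normrM normfV (gtr0_norm (exprn_gt0 2 (sqD_gt0 u y0))).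
rewrite ler_pdivrMr ?exprn_gt0 ?sqD_gt0// mulrC ler_pdivlMr ?exprn_gt0//.
have : `|u ^+ 2 - y ^+ 2| <= u ^+ 2 + y ^+ 2.
  by rewrite ler_norml; have := sqr_ge0 u; have := sqr_ge0 y; move=> *; apply/andP; split; lra.
have := sqr_ge0 u; have := sqr_ge0 y; have := normr_ge0 (u ^+ 2 - y ^+ 2); nra.
Qed.

Lemma kb_le y u : 0 < y -> `|kb y u| <= y ^- 2.
Proof.
move=> y0; rewrite /kb normrM normfV (gtr0_norm (exprn_gt0 2 (sqD_gt0 u y0))).
rewrite ler_pdivrMr ?exprn_gt0 ?sqD_gt0// (mulrC (y ^- 2)) ler_pdivlMr ?exprn_gt0//.
have : `|2 * u * y| <= u ^+ 2 + y ^+ 2.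
  by rewrite ler_norml; have := sqr_ge0 (u - y); have := sqr_ge0 (u + y); move=> *; apply/andP; split; nra.
have := sqr_ge0 u; have := sqr_ge0 y; have := normr_ge0 (2 * u * y); nra.
Qed.

Lemma int_kq (a b x y : R) : a < b -> 0 < y ->
  \int[mu]_(t in `[a, b]) kq y (t - x) = atan ((b - x) / y) - atan ((a - x) / y).
Proof.
move=> ab y0; apply: (@ftc_cc _ _ (fun t => atan ((t - x) / y))) => // t _.
  have n0 := sqD_neq0 (t - x) y0.
  apply: der_eq (der_comp (g := fun t => (t - x) / y) (is_derive1_atan _)
    (derM (derB (derI t) (derC x t)) (derC _ _))) _.
  have y1 : y != 0 by rewrite gt_eqF.
  have n1 : 1 + ((t - x) / y) ^+ 2 != 0 by rewrite gt_eqF// ltr_pwDl// sqr_ge0.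
  by rewrite /kq; field; rewrite y1 n0.
apply: (@continuous_comp _ _ _ (fun t => t - x) (kq y)); last exact: kq_cont.
exact: der_cont (derB (derI t) (derC x t)).
Qed.

End Kernels.
Arguments kp {R} y u.
Arguments kq {R} y u.
Arguments ka {R} y u.
Arguments kb {R} y u.

(** * Integrals depending on a parameter *)

Section UnderIntegral.
Context (R : realType).
Notation mu := (@lebesgue_measure R).

Lemma der_under_int (D : set R) (F dF : R -> R -> R) (G : R -> R) (a u v : R) :
  measurable D -> u < a < v ->
  (forall x, u < x < v -> intble mu D (F x)) ->
  (forall x t, u < x < v -> is_derive x 1 (F ^~ t) (dF x t)) ->
  (forall x t, u < x < v -> D t -> `|dF x t| <= G t) ->
  (forall t, 0 <= G t) -> intble mu D G ->
  is_derive a 1 (fun x => \int[mu]_(t in D) F x t) (\int[mu]_(t in D) dF a t).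
Proof.
move=> mD uav IF dFF dFG G0 IG.
have I x : `]u, v[%classic x -> u < x < v by rewrite /= in_itv.
have d1 x t : u < x < v -> partial1of2 F x t = dF x t.
  by move=> uxv; rewrite partial1of2E; have [_ ->] := dFF x t uxv.
have Ia : `]u, v[%classic a by rewrite /= in_itv.
have h1 x : `]u, v[%classic x -> mu.-integrable D (EFin \o F x) by move=> /I; exact: IF.
have h2 x y : `]u, v[%classic x -> D y -> derivable (F ^~ y) x 1.
  by move=> /I uxv _; have [] := dFF x y uxv.
have h3 x y : `]u, v[%classic x -> D y -> `|partial1of2 F x y| <= G y.
  by move=> /I uxv Dy; rewrite d1//; exact: dFG.
have D1 := @derivable_under_integral R _ _ mu F D mD a u v Ia h1 h2 G G0 IG h3.
have D2 := @differentiation_under_integral R _ _ mu F D mD a u v Ia h1 h2 G G0 IG h3.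
apply: DeriveDef => //; rewrite -derive1E D2.
by apply: eq_Rintegral => t _; rewrite d1.
Qed.

Lemma cont_under_int (D : set R) (F : R -> R -> R) (G : R -> R) (a u v : R) :
  measurable D -> u < a < v ->
  (forall x, u < x < v -> intble mu D (F x)) ->
  (forall x t, u < x < v -> {for x, continuous (F ^~ t)}) ->
  (forall x t, u < x < v -> D t -> `|F x t| <= G t) ->
  intble mu D G ->
  {for a, continuous (fun x => \int[mu]_(t in D) F x t)}.
Proof.
move=> mD uav IF cF FG IG.
have I x : `]u, v[%classic x -> u < x < v by rewrite /= in_itv.
have Ia : `]u, v[%classic a by rewrite /= in_itv.
apply: (@continuity_under_integral _ _ _ mu F D mD u v _ _ G IG _ a (mem_set Ia)).
- by move=> x /I; exact: IF.
- by apply: aeW => t Dt x /set_mem/I; exact: cF.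
- by move=> x /I uxv; apply: aeW => t Dt; exact: FG.
Qed.
End UnderIntegral.

(** * Conjugate Poisson and Poisson integrals on the interval *)

Section Potentials.
Context (R : realType).
Notation mu := (@lebesgue_measure R).
Notation D := (`]-1, 1[%classic : set R).
Implicit Types (f g h : R -> R) (x y t : R).

Lemma muD : mu D = 2%:E.
Proof.
by rewrite lebesgue_measure_itv/= lte_fin ifT ?EFinN ?opprK; [congr EFin; ring|lra].
Qed.

Lemma muD_fin : (mu D < +oo)%E.
Proof. by rewrite muD ltry. Qed.

Lemma mD : measurable D.
Proof. exact: measurable_itv. Qed.
Hint Resolve mD muD_fin : core.

(* Sk kp f y x and Sk kq f y x are the real and imaginary parts of the integral of
   f(t) / (t - z) for z = x + iy; they tend to the principal value at x and to pi f(x). *)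
Definition Sk (k : R -> R -> R) f y x := \int[mu]_(t in D) (f t * k y (t - x)).

Lemma shift_cont (k : R -> R) x : continuous k -> continuous (fun t => k (t - x)).
Proof.
move=> ck t; apply: (@continuous_comp _ _ _ (fun t => t - x) k); last exact: ck.
exact: der_cont (derB (derI t) (derC x t)).
Qed.

Lemma Sk_intble (k : R -> R -> R) f (y x M : R) : intble mu D f -> continuous (k y) ->
  (forall u, `|k y u| <= M) -> intble mu D (fun t => f t * k y (t - x)).
Proof.
move=> If ck kM; apply: (@intbleM _ _ _ _ _ _ _ M) => //.
by apply: measurable_funTS; apply: continuous_measurable_fun; exact: shift_cont.
Qed.

Lemma Skp_intble f y x : 0 < y -> intble mu D f -> intble mu D (fun t => f t * kp y (t - x)).
Proof.
move=> y0 If; apply: (@Sk_intble kp _ _ _ y^-1) => //; first exact: kp_cont.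
by move=> u; exact: kp_le.
Qed.

Lemma Skq_intble f y x : 0 < y -> intble mu D f -> intble mu D (fun t => f t * kq y (t - x)).
Proof.
move=> y0 If; apply: (@Sk_intble kq _ _ _ y^-1) => //; first exact: kq_cont.
by move=> u; rewrite ger0_norm ?kq_ge0//; exact: kq_le.
Qed.

Lemma Ska_intble f y x : 0 < y -> intble mu D f -> intble mu D (fun t => f t * ka y (t - x)).
Proof.
move=> y0 If; apply: (@Sk_intble ka _ _ _ (y ^- 2)) => //; first exact: ka_cont.
by move=> u; exact: ka_le.
Qed.

Lemma Skb_intble f y x : 0 < y -> intble mu D f -> intble mu D (fun t => f t * kb y (t - x)).
Proof.
move=> y0 If; apply: (@Sk_intble kb _ _ _ (y ^- 2)) => //; first exact: kb_cont.
by move=> u; exact: kb_le.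
Qed.

Lemma der_Skp_x f y x : 0 < y -> intble mu D f -> is_derive x 1 (Sk kp f y) (Sk ka f y x).
Proof.
move=> y0 If; apply: (@der_under_int _ _ _ (fun x t => f t * ka y (t - x))
  (fun t => y ^- 2 * `|f t|) _ (x - 1) (x + 1)).
- exact: mD.
- by apply/andP; split; lra.
- by move=> *; exact: Skp_intble.
- move=> z t _; apply: der_eq (derZ (f t) (der_comp (f := kp y) (g := fun z => t - z)
    (der_kp_u _ y0) (derB (derC t z) (derI z)))) _; ring.
- by move=> z t _ _; rewrite normrM mulrC ler_wpM2r// ka_le.
- by move=> t; rewrite mulr_ge0// invr_ge0 exprn_ge0// ltW.
- by apply: intbleZ => //; exact: intble_norm.
Qed.

Lemma der_Skq_x f y x : 0 < y -> intble mu D f -> is_derive x 1 (Sk kq f y) (Sk kb f y x).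
Proof.
move=> y0 If; apply: (@der_under_int _ _ _ (fun x t => f t * kb y (t - x))
  (fun t => y ^- 2 * `|f t|) _ (x - 1) (x + 1)).
- exact: mD.
- by apply/andP; split; lra.
- by move=> *; exact: Skq_intble.
- move=> z t _; apply: der_eq (derZ (f t) (der_comp (f := kq y) (g := fun z => t - z)
    (der_kq_u _ y0) (derB (derC t z) (derI z)))) _; ring.
- by move=> z t _ _; rewrite normrM mulrC ler_wpM2r// kb_le.
- by move=> t; rewrite mulr_ge0// invr_ge0 exprn_ge0// ltW.
- by apply: intbleZ => //; exact: intble_norm.
Qed.

(** Derivatives in [y] are taken on the neighbourhood (y/2, 2y); this is the common majorant there
    of the kernel bounds [z ^- 2]. *)
Lemma inv_sqr_le y z : 0 < y -> y / 2 < z -> z ^- 2 <= (y / 2) ^- 2.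
Proof.
move=> y0 yz; have z0 : 0 < z by lra.
rewrite lef_pV2 ?posrE ?exprn_gt0 ?divr_gt0//.
by rewrite ler_sqr ?nnegrE ?ltW// divr_gt0.
Qed.

Lemma der_Skp_y f y x : 0 < y -> intble mu D f ->
  is_derive y 1 (fun y => Sk kp f y x) (- Sk kb f y x).
Proof.
move=> y0 If; apply: der_eq; first
  apply: (@der_under_int _ _ (fun y t => f t * kp y (t - x)) (fun y t => f t * - kb y (t - x))
  (fun t => (y / 2) ^- 2 * `|f t|) _ (y / 2) (2 * y)).
- exact: mD.
- by apply/andP; split; lra.
- by move=> z /andP[yz _]; apply: Skp_intble => //; lra.
- move=> z t /andP[yz _]; have z0 : 0 < z by lra.
  by apply: der_eq (derZ (f t) (der_kp_y (t - x) z0)) _.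
- move=> z t /andP[yz _] _; have z0 : 0 < z by lra.
  rewrite normrM mulrC ler_wpM2r// normrN (le_trans (kb_le _ z0))//.
  exact: inv_sqr_le.
- by move=> t; rewrite mulr_ge0// invr_ge0 exprn_ge0// divr_ge0// ltW.
- by apply: intbleZ => //; exact: intble_norm.
- rewrite /Sk /= -[RHS]mulN1r -RintegralZl//; last exact: Skb_intble.
  by apply: eq_Rintegral => t _; rewrite mulN1r mulrN.
Qed.

Lemma der_Skq_y f y x : 0 < y -> intble mu D f ->
  is_derive y 1 (fun y => Sk kq f y x) (Sk ka f y x).
Proof.
move=> y0 If.
apply: (@der_under_int _ _ (fun y t => f t * kq y (t - x)) (fun y t => f t * ka y (t - x))
  (fun t => (y / 2) ^- 2 * `|f t|) _ (y / 2) (2 * y)).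
- exact: mD.
- by apply/andP; split; lra.
- by move=> z /andP[yz _]; apply: Skq_intble => //; lra.
- move=> z t /andP[yz _]; have z0 : 0 < z by lra.
  by apply: der_eq (derZ (f t) (der_kq_y (t - x) z0)) _.
- move=> z t /andP[yz _] _; have z0 : 0 < z by lra.
  rewrite normrM mulrC ler_wpM2r// (le_trans (ka_le _ z0))//.
  exact: inv_sqr_le.
- by move=> t; rewrite mulr_ge0// invr_ge0 exprn_ge0// divr_ge0// ltW.
- by apply: intbleZ => //; exact: intble_norm.
Qed.

Lemma Ska_cont f y : 0 < y -> intble mu D f -> continuous (Sk ka f y).
Proof.
move=> y0 If x; apply: (@cont_under_int _ _ _ (fun t => y ^- 2 * `|f t|) _ (x - 1) (x + 1)) => //.
- by apply/andP; split; lra.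
- by move=> *; exact: Ska_intble.
- move=> z t _; apply: (@continuousM _ _ (fun=> f t)); first exact: cst_continuous.
  apply: (@continuous_comp _ _ _ (fun z => t - z) (ka y)); last exact: ka_cont.
  exact: der_cont (derB (derC t z) (derI z)).
- by move=> z t _ _; rewrite normrM mulrC ler_wpM2r// ka_le.
- by apply: intbleZ => //; exact: intble_norm.
Qed.

Lemma Skb_cont f y : 0 < y -> intble mu D f -> continuous (Sk kb f y).
Proof.
move=> y0 If x; apply: (@cont_under_int _ _ _ (fun t => y ^- 2 * `|f t|) _ (x - 1) (x + 1)) => //.
- by apply/andP; split; lra.
- by move=> *; exact: Skb_intble.
- move=> z t _; apply: (@continuousM _ _ (fun=> f t)); first exact: cst_continuous.
  apply: (@continuous_comp _ _ _ (fun z => t - z) (kb y)); last exact: kb_cont.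
  exact: der_cont (derB (derC t z) (derI z)).
- by move=> z t _ _; rewrite normrM mulrC ler_wpM2r// kb_le.
- by apply: intbleZ => //; exact: intble_norm.
Qed.

Lemma Skp_cont f y : 0 < y -> intble mu D f -> continuous (Sk kp f y).
Proof. by move=> y0 If x; exact: der_cont (der_Skp_x x y0 If). Qed.

Lemma Skq_cont f y : 0 < y -> intble mu D f -> continuous (Sk kq f y).
Proof. by move=> y0 If x; exact: der_cont (der_Skq_x x y0 If). Qed.

Lemma Skp_measurable f y : 0 < y -> intble mu D f -> measurable_fun setT (Sk kp f y).
Proof. by move=> y0 If; apply: continuous_measurable_fun; exact: Skp_cont. Qed.

Lemma Sk_le (k : R -> R -> R) f (y x M : R) : intble mu D f -> continuous (k y) ->
  (forall t, D t -> `|k y (t - x)| <= M) -> `|Sk k f y x| <= M * \int[mu]_(t in D) `|f t|.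
Proof.
move=> If ck kM; rewrite -RintegralZl//; last exact: intble_norm.
apply: le_Rint_norm => //.
- apply: measurable_funM; first exact: intble_measurable If.
  by apply: measurable_funTS; apply: continuous_measurable_fun; exact: shift_cont.
- by apply: intbleZ => //; exact: intble_norm.
- by move=> t Dt; rewrite normrM mulrC ler_wpM2r// kM.
Qed.

(** The maximum principle: by its [atan] primitive, the kernel [kq] has mass at most [pi] on any
    interval. *)
Lemma Skq_bound f (y x M : R) : 0 < y -> measurable_fun D f ->
  (forall t, D t -> `|f t| <= M) -> `|Sk kq f y x| <= M * pi.
Proof.
move=> y0 mf fM.
have M0 : 0 <= M by apply: le_trans (normr_ge0 _) (fM 0 _); rewrite /= in_itv/=; lra.
have If : intble mu D f by apply: (@intble_bounded _ _ _ _ _ _ M).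
have I1 : intble mu `[-1, 1] (fun t => kq y (t - x)).
  by apply: continuous_intble => t _; apply: shift_cont; exact: kq_cont.
have I2 : intble mu D (fun t => kq y (t - x)).
  by apply: intbleS I1 => //; exact: subset_itv_oo_cc.
apply: (@le_trans _ _ (\int[mu]_(t in D) (M * kq y (t - x)))).
  apply: le_Rint_norm => //; [|exact: intbleZ|].
  - exact/intble_measurable/Skq_intble.
  - move=> t Dt; rewrite normrM (ger0_norm (kq_ge0 _ y0)) ler_wpM2r ?kq_ge0//.
    exact: fM.
rewrite RintegralZl// ler_wpM2l//.
apply: (@le_trans _ _ (\int[mu]_(t in `[-1, 1]) kq y (t - x))).
  rewrite -lee_fin -RintE// -RintE//; apply: ge0_subset_integral => //.
  - by apply/measurable_EFinP; exact: intble_measurable I1.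
  - by move=> t _; rewrite lee_fin kq_ge0.
  - exact: subset_itv_oo_cc.
rewrite int_kq//.
have := atan_ltpi2 ((1 - x) / y); have := atan_gtNpi2 ((-1 - x) / y); lra.
Qed.

(* The prefix D marks identities for integrals over (-1, 1), DI integrability there. *)
Lemma DZl f (k : R) : intble mu D f ->
  \int[mu]_(x in D) (k * f x) = k * \int[mu]_(x in D) f x.
Proof. by move=> If; apply: RintegralZl. Qed.

Lemma DZr f (k : R) : intble mu D f ->
  \int[mu]_(x in D) (f x * k) = (\int[mu]_(x in D) f x) * k.
Proof. by move=> If; apply: RintegralZr. Qed.

Lemma DD f g : intble mu D f -> intble mu D g ->
  \int[mu]_(x in D) (f x + g x) = \int[mu]_(x in D) f x + \int[mu]_(x in D) g x.
Proof. by move=> If Ig; apply: RintegralD. Qed.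

Lemma DB f g : intble mu D f -> intble mu D g ->
  \int[mu]_(x in D) (f x - g x) = \int[mu]_(x in D) f x - \int[mu]_(x in D) g x.
Proof. by move=> If Ig; apply: RintegralB. Qed.

Lemma Dle f g : intble mu D f -> intble mu D g -> (forall x, -1 < x < 1 -> f x <= g x) ->
  \int[mu]_(x in D) f x <= \int[mu]_(x in D) g x.
Proof. by move=> If Ig fg; apply: le_Rintegral => // x /=; rewrite in_itv; exact: fg. Qed.

Lemma Dle_norm f g : measurable_fun D f -> intble mu D g ->
  (forall x, -1 < x < 1 -> `|f x| <= g x) ->
  `|\int[mu]_(x in D) f x| <= \int[mu]_(x in D) g x.
Proof. by move=> If Ig fg; apply: le_Rint_norm => // x /=; rewrite in_itv; exact: fg. Qed.

Lemma Deq f g : (forall x, -1 < x < 1 -> f x = g x) ->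
  \int[mu]_(x in D) f x = \int[mu]_(x in D) g x.
Proof. by move=> fg; apply: eq_Rintegral => x /set_mem/=; rewrite in_itv; exact: fg. Qed.

Lemma DI_le f g : measurable_fun D f -> (forall x, -1 < x < 1 -> `|f x| <= g x) ->
  intble mu D g -> intble mu D f.
Proof. by move=> mf fg Ig; apply: (@intble_le _ _ _ mu D f g) => // x /=; rewrite in_itv; exact: fg. Qed.

Lemma DI_eq f g : (forall x, -1 < x < 1 -> f x = g x) -> intble mu D f -> intble mu D g.
Proof. by move=> fg; apply: eq_intble => // x /=; rewrite in_itv; exact: fg. Qed.

Lemma DI_bd f (M : R) : measurable_fun D f -> (forall x, -1 < x < 1 -> `|f x| <= M) ->
  intble mu D f.
Proof. by move=> mf fM; apply: (@intble_bounded _ _ _ mu D f M) => // x /=; rewrite in_itv; exact: fM. Qed.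

Lemma DI_M f g (M : R) : intble mu D f -> measurable_fun D g ->
  (forall x, -1 < x < 1 -> `|g x| <= M) -> intble mu D (fun x => f x * g x).
Proof. by move=> If mg gM; apply: (intbleM _ If mg) => // x /=; rewrite in_itv; exact: gM. Qed.

Lemma DI_D f g : intble mu D f -> intble mu D g -> intble mu D (fun x => f x + g x).
Proof. by move=> If Ig; apply: intbleD. Qed.

Lemma DI_B f g : intble mu D f -> intble mu D g -> intble mu D (fun x => f x - g x).
Proof. by move=> If Ig; apply: intbleB. Qed.

Lemma DI_Z f (k : R) : intble mu D f -> intble mu D (fun x => k * f x).
Proof. by move=> If; apply: intbleZ. Qed.

Lemma DI_N f : intble mu D f -> intble mu D (fun x => - f x).
Proof. by move=> If; apply: intbleN. Qed.

Lemma DI_norm f : intble mu D f -> intble mu D (fun x => `|f x|).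
Proof. by move=> If; apply: intble_norm. Qed.

Lemma DI_mf f : intble mu D f -> measurable_fun D f.
Proof. by move=> If; apply: intble_measurable If. Qed.

Lemma DI_C (k : R) : intble mu D (fun=> k).
Proof. by apply: intble_cst. Qed.

Lemma DI_cont f : (forall x, -1 <= x <= 1 -> {for x, continuous f}) -> intble mu D f.
Proof.
move=> cf; apply: (@intbleS _ _ _ mu `[-1, 1]) => //; first exact: subset_itv_oo_cc.
exact: continuous_intble.
Qed.
End Potentials.
#[export] Hint Resolve mD : core.
#[export] Hint Extern 0 (is_true (_ < +oo)%E) => solve [apply: muD_fin] : core.

(** * Exponential integrability of the conjugate Poisson integral *)

Section ExpBound.
Context (R : realType).
Notation mu := (@lebesgue_measure R).
Notation D := (`]-1, 1[%classic : set R).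
Implicit Types (f g h : R -> R) (x y t : R).

Lemma ge0_Rint_subset (A B : set R) f : measurable A -> measurable B -> A `<=` B ->
  (forall x, B x -> 0 <= f x) -> intble mu B f ->
  \int[mu]_(x in A) f x <= \int[mu]_(x in B) f x.
Proof.
move=> mA mB AB f0 If; rewrite -lee_fin -RintE//; last exact: intbleS If.
rewrite -RintE//; apply: ge0_subset_integral => //.
by apply/measurable_EFinP; exact: intble_measurable If.
Qed.

(** With [c = b - ln (1 + a)] the claim becomes a c <= (1 + a) e^c, which follows from 1 + c <=
    e^c. *)
Lemma young_expR (a b : R) : 0 <= a -> a * b <= a * ln (1 + a) + expR b.
Proof.
move=> a0; set c := b - ln (1 + a).
have a1 : 0 < 1 + a by rewrite ltr_pwDl.
have -> : b = ln (1 + a) + c by rewrite /c; ring.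
rewrite expRD lnK ?posrE// mulrDr lerD2l.
apply: (@le_trans _ _ (a * expR c)).
  by rewrite ler_wpM2l// (le_trans _ (expR_ge1Dx c))// lerDr.
by rewrite ler_wpM2r ?expR_ge0// lerDr.
Qed.

Lemma SkN (k : R -> R -> R) f y x : intble mu D (fun t => f t * k y (t - x)) ->
  Sk k (fun t => - f t) y x = - Sk k f y x.
Proof.
move=> If; rewrite /Sk -[RHS]mulN1r -RintegralZl//.
by apply: eq_Rintegral => t _; rewrite mulN1r mulNr.
Qed.

Lemma one_le_norm_sub (x t : R) : `|x| = 2 -> -1 < t < 1 -> 1 <= `|t - x|.
Proof.
case: (ger0P x) => x0 xx /andP[t1 t2].
  by rewrite ler0_norm; lra.
by rewrite ger0_norm; lra.
Qed.

(** The arithmetic of [M_le]: [m1] and [m] are the values of [M] at heights 1 and [y], and [b1],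
    [b2] are boundary terms at an intermediate height, so the two values differ by at most 2 e. *)
Lemma le_of_mvt (m1 m b1 b2 y e : R) : m1 - m = - (b1 - b2) * (1 - y) ->
  0 < y < 1 -> `|b1| <= e -> `|b2| <= e -> m1 <= 4 * e -> m <= 6 * e.
Proof.
move=> E /andP[y0 y1]; rewrite !ler_norml => /andP[h1 h2] /andP[h3 h4] h5.
have : m - m1 = (b1 - b2) * (1 - y) by rewrite -opprB E; ring.
nra.
Qed.

Lemma cos1_le_cos (u : R) : `|u| <= 1 -> cos 1 <= cos u.
Proof.
have p2 := @pi_ge2 R.
rewrite -(cos_norm u) le_eqVlt => /predU1P[->//|u1]; apply: ltW.
by rewrite ltr_cos// in_itv/= ?normr_ge0 ?ler01/= (le_trans _ p2)// ?(le_trans (ltW u1)) ?ler1n.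
Qed.

Section bounded.
Variables (f : R -> R).
Hypothesis mf : measurable_fun D f.
Hypothesis f_le : forall t, D t -> `|f t| <= pi^-1.

Lemma If_ : intble mu D f.
Proof. by apply: (@intble_bounded _ _ _ _ _ _ pi^-1). Qed.

(** The bound 1/pi on [f] serves twice: here it gives mass at most 2/pi <= 1, and through
    [Skq_bound] it gives |u| <= 1, which keeps cos u away from 0. *)
Lemma norm_f_le1 : \int[mu]_(t in D) `|f t| <= 1.
Proof.
apply: (@le_trans _ _ (\int[mu]_(t in D) pi^-1)).
  by apply: le_Rintegral => //; [exact: (intble_norm If_)|exact: intble_cst].
rewrite Rintegral_cst// [X in fine X]muD/= mulrC ler_pdivrMr ?pi_gt0// mul1r.
exact: pi_ge2.
Qed.

Let v y x := Sk kp f y x.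
Let u y x := Sk kq f y x.
Let a y x := Sk ka f y x.
Let b y x := Sk kb f y x.
(* A and B are the real and imaginary parts of the analytic function exp (v + iu).
   Since |u| <= 1, A >= cos 1 * exp v; the y-derivative of the integral of A over
   [-2, 2] only involves B at the end points, which are at distance 1 from D. *)
Let A y x := expR (v y x) * cos (u y x).
Let B y x := expR (v y x) * sin (u y x).
Let dB y x := expR (v y x) * (a y x * sin (u y x) + b y x * cos (u y x)).

Lemma v_le y x : 0 < y -> `|v y x| <= y^-1.
Proof.
move=> y0; apply: (le_trans (@Sk_le _ kp f y x y^-1 If_ (kp_cont y0) _)).
  by move=> t _; exact: kp_le.
by rewrite ler_piMr ?norm_f_le1// invr_ge0 ltW.
Qed.

Lemma a_le y x : 0 < y -> `|a y x| <= y ^- 2.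
Proof.
move=> y0; apply: (le_trans (@Sk_le _ ka f y x (y ^- 2) If_ (ka_cont y0) _)).
  by move=> t _; exact: ka_le.
by rewrite ler_piMr ?norm_f_le1// invr_ge0 exprn_ge0 ?ltW.
Qed.

Lemma b_le y x : 0 < y -> `|b y x| <= y ^- 2.
Proof.
move=> y0; apply: (le_trans (@Sk_le _ kb f y x (y ^- 2) If_ (kb_cont y0) _)).
  by move=> t _; exact: kb_le.
by rewrite ler_piMr ?norm_f_le1// invr_ge0 exprn_ge0 ?ltW.
Qed.

Lemma v_end y x : 0 < y -> `|x| = 2 -> `|v y x| <= 1.
Proof.
move=> y0 x2; apply: (le_trans (@Sk_le _ kp f y x 1 If_ (kp_cont y0) _)); last by rewrite mul1r norm_f_le1.
move=> t; rewrite /= in_itv/= => /andP[t1 t2].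
have h : 1 <= `|t - x|.
  by apply: one_le_norm_sub => //; rewrite t1.
have h0 : t - x != 0 by rewrite -normr_gt0; apply: lt_le_trans h.
by apply: (le_trans (kp_leV y0 h0)); rewrite invf_le1// (lt_le_trans _ h).
Qed.

(** Together with [der_B] this is the Cauchy-Riemann equation dA/dy = - dB/dx. *)
Lemma der_A y x : 0 < y -> is_derive y 1 (A ^~ x) (- dB y x).
Proof.
move=> y0.
have dv := der_Skp_y x y0 If_; have du := der_Skq_y x y0 If_.
apply: der_eq (derM (der_comp (is_derive_expR _) dv) (der_comp (is_derive_cos _) du)) _.
rewrite /dB /a /b /u /v; ring.
Qed.

Lemma der_B y x : 0 < y -> is_derive x 1 (B y) (dB y x).
Proof.
move=> y0.
have dv := der_Skp_x x y0 If_; have du := der_Skq_x x y0 If_.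
apply: der_eq (derM (der_comp (is_derive_expR _) dv) (der_comp (is_derive_sin _) du)) _.
rewrite /dB /a /b /u /v; ring.
Qed.

Lemma A_cont y : 0 < y -> continuous (A y).
Proof.
move=> y0 x; apply: (@continuousM _ _ (fun x => expR (v y x)) (fun x => cos (u y x))).
  exact: der_cont (der_comp (is_derive_expR _) (der_Skp_x x y0 If_)).
exact: der_cont (der_comp (is_derive_cos _) (der_Skq_x x y0 If_)).
Qed.

Lemma dB_cont y : 0 < y -> continuous (dB y).
Proof.
move=> y0 x.
have ce : {for x, continuous (fun x => expR (v y x))}.
  exact: der_cont (der_comp (is_derive_expR _) (der_Skp_x x y0 If_)).
have cs : {for x, continuous (fun x => sin (u y x))}.
  exact: der_cont (der_comp (is_derive_sin _) (der_Skq_x x y0 If_)).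
have cc : {for x, continuous (fun x => cos (u y x))}.
  exact: der_cont (der_comp (is_derive_cos _) (der_Skq_x x y0 If_)).
have ca := Ska_cont y0 If_ (x := x); have cb := Skb_cont y0 If_ (x := x).
apply: (@continuousM _ _ (fun x => expR (v y x))
  (fun x => a y x * sin (u y x) + b y x * cos (u y x))) => //.
apply: (@continuousD _ _ _ (fun x => a y x * sin (u y x)) (fun x => b y x * cos (u y x))).
  exact: (@continuousM _ _ (a y) (fun x => sin (u y x)) x ca cs).
exact: (@continuousM _ _ (b y) (fun x => cos (u y x)) x cb cc).
Qed.

Lemma dB_le y x : 0 < y -> `|dB y x| <= expR y^-1 * (2 * y ^- 2).
Proof.
move=> y0; rewrite /dB normrM ler_pM//.
  rewrite ger0_norm ?expR_ge0// ler_expR (le_trans (ler_norm _))//; exact: v_le.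
rewrite mulr_natl mulr2n (le_trans (ler_normD _ _))// lerD// normrM.
  rewrite (le_trans (ler_wpM2l _ (_ : _ <= 1))) ?mulr1// ?a_le//.
  by rewrite ler_norml sin_geN1 sin_le1.
rewrite (le_trans (ler_wpM2l _ (_ : _ <= 1))) ?mulr1// ?b_le//.
by rewrite ler_norml cos_geN1 cos_le1.
Qed.

Let M y := \int[mu]_(x in `[-2, 2]) A y x.

Lemma A_intble y : 0 < y -> intble mu `[-2, 2] (A y).
Proof. by move=> y0; apply: continuous_intble => x _; exact: A_cont. Qed.

Lemma mu22 : mu `[-2, 2] = 4%:E.
Proof.
rewrite lebesgue_measure_itv/= lte_fin ifT ?EFinN; last lra.
by rewrite oppeK -EFinD; congr EFin; ring.
Qed.

Lemma der_M y : 0 < y -> is_derive y 1 M (- (B y 2 - B y (-2))).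
Proof.
move=> y0.
have dint : \int[mu]_(x in `[-2, 2]) dB y x = B y 2 - B y (-2).
  apply: ftc_cc => [|x _|x _]; [lra|exact: der_B|exact: dB_cont].
have IdB : intble mu `[-2, 2] (dB y).
  by apply: continuous_intble => x _; exact: dB_cont.
apply: der_eq; first apply: (@der_under_int _ _ A (fun y x => - dB y x)
    (fun=> expR (y / 2)^-1 * (2 * (y / 2) ^- 2)) _ (y / 2) (2 * y)).
- exact: measurable_itv.
- by apply/andP; split; lra.
- by move=> z /andP[yz _]; apply: A_intble; lra.
- by move=> z x /andP[yz _]; apply: der_A; lra.
- move=> z x /andP[yz _] _; have z0 : 0 < z by lra.
  rewrite normrN (le_trans (dB_le x z0))// ler_pM ?expR_ge0//.
  + by rewrite mulr_ge0// invr_ge0 exprn_ge0// ltW.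
  + by rewrite ler_expR lef_pV2 ?posrE//; lra.
  + by rewrite ler_wpM2l//; exact: inv_sqr_le.
- by move=> t; rewrite mulr_ge0 ?expR_ge0// mulr_ge0// invr_ge0 exprn_ge0// divr_ge0// ltW.
- by apply: intble_cst; [exact: measurable_itv|rewrite [X in (X < _)%E]mu22 ltry].
- rewrite -dint -[RHS]mulN1r -RintegralZl//.
  by apply: eq_Rintegral => x _; rewrite mulN1r.
Qed.

Lemma M_le y : 0 < y < 1 -> M y <= 6 * expR 1.
Proof.
move=> /andP[y0 y1].
(* At height 1 the crude bound [v_le] gives |v| <= 1 everywhere, and the interval has length 4. *)
have M1 : M 1 <= 4 * expR 1.
  apply: (@le_trans _ _ (\int[mu]_(x in `[-2, 2]) (expR 1))).
    apply: le_Rintegral => //.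
    - exact: A_intble.
    - by apply: intble_cst; [exact: measurable_itv|rewrite [X in (X < _)%E]mu22 ltry].
    - move=> x _; rewrite /A (le_trans (ler_wpM2l (expR_ge0 _) (cos_le1 _)))// mulr1.
      by rewrite ler_expR (le_trans (ler_norm _))// (le_trans (v_le x ltr01))// invr1.
  by rewrite Rintegral_cst// [X in fine X]mu22/= mulrC.
have cM : {within `[y, 1], continuous M}.
  apply: continuous_in_subspaceT => x /set_mem/=; rewrite in_itv/= => /andP[yx _].
  by apply: der_cont (der_M _); lra.
have dM x : x \in `]y, 1[ -> is_derive x 1 M (- (B x 2 - B x (-2))).
  by rewrite in_itv/= => /andP[yx _]; apply: der_M; lra.
have [c] := MVT y1 dM cM; rewrite in_itv/= => /andP[yc c1] E.
have c0 : 0 < c by exact: lt_trans yc.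
have Bl x : `|x| = 2 -> `|B c x| <= expR 1.
  move=> x2; rewrite /B normrM (ger0_norm (expR_ge0 _)).
  rewrite (le_trans (ler_wpM2l (expR_ge0 _) (_ : _ <= 1))) ?mulr1//.
    by rewrite ler_norml sin_geN1 sin_le1.
  by rewrite ler_expR (le_trans (ler_norm _))// v_end.
apply: (le_of_mvt E) => //; first by rewrite y0.
  by apply: Bl; rewrite ger0_norm.
by apply: Bl; rewrite normrN ger0_norm.
Qed.

Lemma expR_int_le y : 0 < y < 1 ->
  \int[mu]_(x in D) expR (Sk kp f y x) <= 6 * expR 1 / cos 1.
Proof.
move=> y01; have /andP[y0 y1] := y01.
rewrite ler_pdivlMr ?cos1_gt0// mulrC.
have ce x : {for x, continuous (fun x => expR (v y x))}.
  exact: der_cont (der_comp (is_derive_expR _) (der_Skp_x x y0 If_)).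
have Ie : intble mu `[-2, 2] (fun x => expR (v y x)).
  by apply: continuous_intble.
have sD : D `<=` `[-2, 2].
  by move=> x /=; rewrite !in_itv/= => /andP[? ?]; apply/andP; split; lra.
apply: (le_trans _ (M_le y01)).
apply: (@le_trans _ _ (cos 1 * \int[mu]_(x in `[-2, 2]) expR (v y x))).
  rewrite ler_wpM2l ?(ltW (@cos1_gt0 R))//.
  by apply: ge0_Rint_subset => // x _; exact: expR_ge0.
rewrite -RintegralZl//; apply: le_Rintegral => //.
- exact: intbleZ.
- exact: A_intble.
- move=> x _; rewrite /A mulrC ler_wpM2l ?expR_ge0//.
  have u1 : `|u y x| <= 1.
    apply: (le_trans (@Skq_bound _ f y x pi^-1 y0 mf f_le)).
    by rewrite mulVf// gt_eqF// pi_gt0.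
  exact: cos1_le_cos.
Qed.
End bounded.

(** Uses e^|v| <= e^v + e^(-v), where - v is the potential of - f, to which the one-sided bound
    applies as well. *)
Lemma expR_norm_int_le f y : measurable_fun D f ->
  (forall t, D t -> `|f t| <= pi^-1) -> 0 < y < 1 ->
  \int[mu]_(x in D) expR `|Sk kp f y x| <= 12 * expR 1 / cos 1.
Proof.
move=> mf fle y01; have /andP[y0 y1] := y01.
have If : intble mu D f by apply: (@intble_bounded _ _ _ _ _ _ pi^-1).
have SN x : Sk kp (fun t => - f t) y x = - Sk kp f y x.
  by apply: SkN; exact: Skp_intble.
have h1 := expR_int_le mf fle y01.
have mfN : measurable_fun D (fun t => - f t) by exact: measurable_funN.
have h2 : \int[mu]_(x in D) expR (- Sk kp f y x) <= 6 * expR 1 / cos 1.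
  have := @expR_int_le (fun t => - f t) mfN _ y y01.
  by under eq_Rintegral do rewrite SN; apply => t Dt; rewrite normrN fle.
have cS x : {for x, continuous (Sk kp f y)} by exact: Skp_cont.
have I1 (s : R -> R) : continuous s -> intble mu D (fun x => expR (s (Sk kp f y x))).
  move=> cs; apply: (@intbleS _ _ _ mu `[-1, 1]) => //; first exact: subset_itv_oo_cc.
  apply: continuous_intble => x _; apply: (@continuous_comp _ _ _ (Sk kp f y) (expR \o s)).
    exact: cS.
  by apply: continuous_comp; [exact: cs|exact: continuous_expR].
have Ip := I1 id (fun x => @cvg_id _ _); have In := I1 (fun x => - x) (fun x => der_cont (derN (derI x))).
have cn : continuous (fun x : R => `|x|) by move=> x; exact: norm_continuous.
have Ia := I1 _ cn.
apply: (@le_trans _ _ (\int[mu]_(x in D) (expR (Sk kp f y x) + expR (- Sk kp f y x)))).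
  apply: le_Rintegral => //; first exact: intbleD.
  move=> x _; case: (ger0P (Sk kp f y x)) => _; rewrite ?lerDl ?lerDr expR_ge0//.
by rewrite RintegralD//; lra.
Qed.
End ExpBound.

(** * The weight and the principal value of its inverse *)

Section Weights.
Context (R : realType).
Notation mu := (@lebesgue_measure R).
Notation D := (`]-1, 1[%classic : set R).
Implicit Types (f g h : R -> R) (x y t s : R).
Local Notation w := (@weight R).

Lemma ctD f g x : {for x, continuous f} -> {for x, continuous g} ->
  {for x, continuous (fun t => f t + g t)}.
Proof. by move=> cf cg; exact: (@continuousD _ _ _ f g x). Qed.

Lemma ctB f g x : {for x, continuous f} -> {for x, continuous g} ->
  {for x, continuous (fun t => f t - g t)}.
Proof. by move=> cf cg; exact: (@continuousB _ _ _ f g x). Qed.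

Lemma ctM f g x : {for x, continuous f} -> {for x, continuous g} ->
  {for x, continuous (fun t => f t * g t)}.
Proof. by move=> cf cg; exact: (@continuousM _ _ f g x). Qed.

Lemma ctC (k x : R) : {for x, continuous (fun=> k)}.
Proof. exact: cst_continuous. Qed.

Lemma ctI (x : R) : {for x, continuous (fun t : R => t)}.
Proof. exact: cvg_id. Qed.

Lemma ctV f x : f x != 0 -> {for x, continuous f} ->
  {for x, continuous (fun t => (f t)^-1)}.
Proof. by move=> f0 cf; exact: (@continuousV _ _ f x). Qed.

Lemma ct_comp f g x : {for g x, continuous f} -> {for x, continuous g} ->
  {for x, continuous (fun t => f (g t))}.
Proof. by move=> cf cg; exact: (@continuous_comp _ _ _ g f). Qed.

Lemma inD x : D x <-> -1 < x < 1.
Proof. by rewrite /= in_itv. Qed.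

Lemma kp_cvg (u : R) : kp y u @[y --> 0^'+] --> u^-1.
Proof.
(* At [u = 0] the kernel vanishes for every [y], in agreement with the convention 0^-1 = 0. *)
have [->|u0] := eqVneq u 0.
  rewrite invr0 (_ : (fun y => kp y 0) = cst 0) ; first exact: cvg_cst.
  by apply/funext => y; rewrite /kp mul0r.
apply: cvg_at_right_filter; rewrite (_ : u^-1 = kp 0 u); last first.
  by rewrite /kp expr0n/= addr0 expr2 invfM mulrA mulfV// mul1r.
apply: (@der_cont _ (kp ^~ u) 0 (- kb 0 u)).
have n0 : u ^+ 2 + 0 ^+ 2 != 0 by rewrite expr0n/= addr0 expf_neq0.
apply: der_eq (derM (derC u 0) (derV (f := fun y => u ^+ 2 + y ^+ 2) n0
  (derD (derC _ _) (derX2 (derI 0))))) _.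
by rewrite /kb; field.
Qed.

(** Inversion is discontinuous at 0, but it is the pointwise limit, at 0 included, of the continuous
    kernels [kp]. *)
Lemma measurable_inv : measurable_fun setT (@GRing.inv R).
Proof.
apply: (@measurable_fun_cvg _ _ _ setT (fun n u => kp n.+1%:R^-1 u)) => //.
- by move=> n; apply: kp_measurable; rewrite invr_gt0.
- move=> u _; have /cvg_at_rightP := @kp_cvg u; apply.
  by split => [n|]; [rewrite invr_gt0|exact: cvg_harmonic].
Qed.

Lemma weight_cont : continuous w.
Proof.
move=> x; apply: (@continuous_comp _ _ _ (fun x : R => 1 - x ^+ 2) Num.sqrt).
  exact: der_cont (derB (derC 1 x) (derX2 (derI x))).
exact: sqrt_continuous.
Qed.

Lemma weight_measurable : measurable_fun setT w.
Proof. exact: continuous_measurable_fun weight_cont. Qed.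

Lemma inv_weight_measurable : measurable_fun setT (fun x => (w x)^-1).
Proof. exact: measurableT_comp measurable_inv weight_measurable. Qed.

Lemma sq1_gt0 x : -1 < x < 1 -> 0 < 1 - x ^+ 2.
Proof. by move=> /andP[x1 x2]; nra. Qed.

Lemma weight_gt0 x : -1 < x < 1 -> 0 < w x.
Proof. by move=> x1; rewrite sqrtr_gt0 sq1_gt0. Qed.

Lemma weight_ge0 x : 0 <= w x.
Proof. exact: sqrtr_ge0. Qed.

Lemma weight_sqr x : -1 <= x <= 1 -> w x ^+ 2 = 1 - x ^+ 2.
Proof. by move=> /andP[x1 x2]; rewrite sqr_sqrtr//; nra. Qed.

Lemma weight_le1 x : w x <= 1.
Proof. by rewrite -sqrtr1 ler_wsqrtr// gerBl sqr_ge0. Qed.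

Lemma weight1 : w 1 = 0.
Proof. by rewrite /weight expr1n subrr sqrtr0. Qed.

Lemma weightN1 : w (-1) = 0.
Proof. by rewrite /weight sqrrN expr1n subrr sqrtr0. Qed.

Lemma der_weight x : -1 < x < 1 -> is_derive x 1 w (- x / w x).
Proof.
move=> x1; have s0 := sq1_gt0 x1.
apply: der_eq (der_comp (g := fun x => 1 - x ^+ 2) (is_derive1_sqrt s0)
  (derB (derC 1 x) (derX2 (derI x)))) _.
have := weight_gt0 x1; rewrite /weight; set q := Num.sqrt _ => q0.
by field; rewrite gt_eqF.
Qed.

Lemma inv_weight_cont x : -1 < x < 1 -> {for x, continuous (fun x => (w x)^-1)}.
Proof.
move=> x1; have w0 : w x != 0 by rewrite gt_eqF ?weight_gt0.
exact: der_cont (derV w0 (der_weight x1)).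
Qed.

Lemma int_inv_weight : intble mu D (fun x => (w x)^-1) /\
  \int[mu]_(x in D) (w x)^-1 = pi.
Proof.
have w1 x : 1 + w x != 0 by rewrite gt_eqF// ltr_pwDl// weight_ge0.
(* This is the arcsine by the half-angle formula. As [1 + w x] never vanishes, it is continuous up
   to the end points, where its derivative blows up. *)
pose F x := 2 * atan (x / (1 + w x)).
have cF x : {for x, continuous F}.
  apply: ctM; first exact: ctC.
  apply: (@ct_comp atan); first exact: continuous_atan.
  apply: (@ctM (fun t => t)); first exact: ctI.
  by apply: ctV => //; apply: ctD; [exact: ctC|exact: weight_cont].
have [] := @ftc_oo _ (fun x => (w x)^-1) F (-1) 1.
- lra.
- move=> x x1; have w0 : w x != 0 by rewrite gt_eqF ?weight_gt0.
  apply: der_eq (derZ 2 (der_comp (g := fun x => x / (1 + w x)) (is_derive1_atan _)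
    (derM (derI x) (derV (f := fun x => 1 + w x) (w1 x) (derD (derC 1 x) (der_weight x1)))))) _.
  have x11 : -1 <= x <= 1 by case/andP: x1 => ? ?; rewrite !ltW.
  have xw : x ^+ 2 = 1 - w x ^+ 2 by rewrite weight_sqr//; ring.
  have := w1 x; move: w0 xw; move: (w x) => q q0 xq q1.
  have E : 1 + (x / (1 + q)) ^+ 2 = 2 / (1 + q).
    by rewrite expr_div_n xq; field.
  rewrite E (_ : x * (- (1 + q) ^- 2 * (0 + - x / q)) = x ^+ 2 / (q * (1 + q) ^+ 2)); last by field; rewrite q0 q1.
  by rewrite xq; field; rewrite q0 q1.
- by move=> x; exact: inv_weight_cont.
- by move=> x x1; rewrite invr_ge0 weight_ge0.
- by apply: cvg_at_right_filter; exact: cF.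
- by apply: cvg_at_left_filter; exact: cF.
move=> If ->; split => //.
by rewrite /F weight1 weightN1 !addr0 !divr1 atanN atan1; field.
Qed.

(* ln (|s - t| / pvN t s) / w t is an antiderivative in s of 1 / (w s * (s - t)). *)
Definition pvN t s := 1 - s * t + w s * w t.

Lemma pvN_gt0 t s : -1 < t < 1 -> -1 <= s <= 1 -> 0 < pvN t s.
Proof.
move=> /andP[t1 t2] /andP[s1 s2]; rewrite /pvN.
have : 0 <= w s * w t by rewrite mulr_ge0 ?weight_ge0.
have : s * t < 1 by case: (leP 0 t) => t0; nra.
by lra.
Qed.

Lemma pvN_cont t : continuous (pvN t).
Proof.
move=> s; apply: (@continuousD _ _ _ (fun s => 1 - s * t) (fun s => w s * w t)).
  exact: der_cont (derB (derC 1 s) (derM (derI s) (derC t s))).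
apply: (@continuousM _ _ w (fun=> w t)); [exact: weight_cont|exact: cst_continuous].
Qed.

Lemma der_ln_pvN t s : -1 < t < 1 -> -1 < s < 1 ->
  is_derive s 1 (fun s => ln (pvN t s)) ((- t - s / w s * w t) / pvN t s).
Proof.
move=> t1 s1; have s11 : -1 <= s <= 1 by case/andP: s1 => ? ?; rewrite !ltW.
have w0 : w s != 0 by rewrite gt_eqF ?weight_gt0.
have p0 := pvN_gt0 t1 s11.
apply: der_eq (der_comp (g := pvN t) (is_derive1_ln p0)
  (derD (derB (derC 1 s) (derM (derI s) (derC t s))) (derM (der_weight s1) (derC (w t) s)))) _.
by field; rewrite w0 gt_eqF.
Qed.

Lemma ln_pvN_cont t s : -1 < t < 1 -> -1 <= s <= 1 ->
  {for s, continuous (fun s => ln (pvN t s))}.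
Proof.
move=> t1 s1; apply: (@ct_comp (@ln R)); last exact: pvN_cont.
by apply: continuous_ln; exact: pvN_gt0.
Qed.

(** The derivative of the primitive with [a], [b] in place of [w s], [w t]: only their squares
    matter. The fact [key] rationalizes the logarithmic derivative, after which [n] can be treated
    as a free variable. *)
Lemma pv_algebra t s (a b : R) : a ^+ 2 = 1 - s ^+ 2 -> b ^+ 2 = 1 - t ^+ 2 ->
  a != 0 -> b != 0 -> s - t != 0 -> 1 - s * t + a * b != 0 ->
  - b^-1 * ((- t - s / a * b) / (1 - s * t + a * b) - (s - t)^-1) = a^-1 / (s - t).
Proof.
move=> a2 b2 a0 b0 st0 n0.
set n := 1 - s * t + a * b in n0 *.
have key : (s - t) * (t * a + s * b) = (b - a) * n.
  have -> : (b - a) * n = (b - a) * (1 - s * t) + a * b ^+ 2 - b * a ^+ 2.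
    by rewrite /n; ring.
  by rewrite a2 b2; ring.
clearbody n.
have -> : - t - s / a * b = - ((b - a) * n / ((s - t) * a)).
  by rewrite -key; field; rewrite a0.
by field; rewrite a0 b0 st0 n0.
Qed.

Lemma pv_right (t e : R) : -1 < t < 1 -> 0 < e -> t + e < 1 ->
  intble mu `](t + e), 1[ (fun s => (w s)^-1 / (s - t)) /\
  \int[mu]_(s in `](t + e), 1[) ((w s)^-1 / (s - t)) =
   (ln (pvN t (t + e)) - ln e) / w t.
Proof.
move=> t1 e0 te1; have wt0 : w t != 0 by rewrite gt_eqF ?weight_gt0.
have /andP[t11 t12] := t1.
pose F s := - (w t)^-1 * (ln (pvN t s) - ln (s - t)).
have cF s : t + e <= s <= 1 -> {for s, continuous F}.
  move=> /andP[s1 s2].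
  apply: ctM; first exact: ctC.
  apply: ctB; first by apply: ln_pvN_cont => //; apply/andP; split; lra.
  apply: (@ct_comp (@ln R)); first by apply: continuous_ln; lra.
  exact: der_cont (derB (derI s) (derC t s)).
have st s : t + e < s < 1 -> (-1 < s < 1) * (0 < s - t).
  by move=> /andP[s1 s2]; split; [apply/andP; split; lra|lra].
have [] := @ftc_oo _ (fun s => (w s)^-1 / (s - t)) F (t + e) 1 te1.
- move=> s ss; have [s1 st0] := st s ss.
  have s11 : -1 <= s <= 1 by case/andP: s1 => ? ?; rewrite !ltW.
  have t111 : -1 <= t <= 1 by rewrite !ltW.
  apply: der_eq (derZ (- (w t)^-1) (derB (der_ln_pvN t1 s1)
    (der_comp (g := fun s => s - t) (is_derive1_ln st0) (derB (derI s) (derC t s))))) _.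
  rewrite subr0 mul1r pv_algebra ?weight_sqr// gt_eqF ?weight_gt0//.
  exact: pvN_gt0.
- move=> s ss; have [s1 st0] := st s ss.
  apply: (@continuousM _ _ (fun s => (w s)^-1) (fun s => (s - t)^-1)).
    exact: inv_weight_cont.
  apply: (@continuousV _ _ (fun s => s - t)); first by rewrite gt_eqF.
  exact: der_cont (derB (derI s) (derC t s)).
- by move=> s ss; have [s1 st0] := st s ss; rewrite divr_ge0// ?invr_ge0 ?weight_ge0// ltW.
- by apply: cvg_at_right_filter; apply: cF; rewrite lexx ltW.
- by apply: cvg_at_left_filter; apply: cF; rewrite lexx ltW.
move=> Iw ->; split => //.
(* At the end point 1 the two logarithms cancel, because [pvN t 1 = 1 - t]; only the cut at [t + e]
   contributes. *)
rewrite /F (addrC t e) addrK {1}/pvN weight1 mul0r addr0 mul1r subrr.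
by field.
Qed.

Lemma pv_left (t e : R) : -1 < t < 1 -> 0 < e -> -1 < t - e ->
  intble mu `]-1, (t - e)[ (fun s => (w s)^-1 / (s - t)) /\
  \int[mu]_(s in `]-1, (t - e)[) ((w s)^-1 / (s - t)) =
   - (ln (pvN t (t - e)) - ln e) / w t.
Proof.
move=> t1 e0 te1; have wt0 : w t != 0 by rewrite gt_eqF ?weight_gt0.
have /andP[t11 t12] := t1.
pose F s := (w t)^-1 * (ln (pvN t s) - ln (t - s)).
have cF s : -1 <= s <= t - e -> {for s, continuous F}.
  move=> /andP[s1 s2].
  apply: ctM; first exact: ctC.
  apply: ctB; first by apply: ln_pvN_cont => //; apply/andP; split; lra.
  apply: (@ct_comp (@ln R)); first by apply: continuous_ln; lra.
  exact: der_cont (derB (derC t s) (derI s)).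
have st s : -1 < s < t - e -> (-1 < s < 1) * (0 < t - s).
  by move=> /andP[s1 s2]; split; [apply/andP; split; lra|lra].
(* Left of [t] the integrand is negative, and [ftc_oo] asks for a nonnegative one. *)
have sE : (fun s => (w s)^-1 / (s - t)) = (fun s => - ((w s)^-1 / (t - s))).
  by apply/funext => s; rewrite -(opprB t s) invrN mulrN.
have [] := @ftc_oo _ (fun s => (w s)^-1 / (t - s)) F (-1) (t - e) te1.
- move=> s ss; have [s1 st0] := st s ss.
  have s11 : -1 <= s <= 1 by case/andP: s1 => ? ?; rewrite !ltW.
  have t111 : -1 <= t <= 1 by rewrite !ltW.
  apply: der_eq (derZ ((w t)^-1) (derB (der_ln_pvN t1 s1)
    (der_comp (g := fun s => t - s) (is_derive1_ln st0) (derB (derC t s) (derI s))))) _.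
  have st1 : s - t != 0 by rewrite -opprB oppr_eq0 gt_eqF.
  have ws0 : w s != 0 by rewrite gt_eqF ?weight_gt0.
  have n0 : 1 - s * t + w s * w t != 0 by rewrite gt_eqF//; exact: pvN_gt0.
  have E := pv_algebra (weight_sqr s11) (weight_sqr t111) ws0 wt0 st1 n0.
  have iv : (t - s)^-1 = - (s - t)^-1 by rewrite -invrN opprB.
  rewrite iv [RHS]mulrN -E -/(pvN t s); ring.
- move=> s ss; have [s1 st0] := st s ss.
  apply: (@continuousM _ _ (fun s => (w s)^-1) (fun s => (t - s)^-1)).
    exact: inv_weight_cont.
  apply: (@continuousV _ _ (fun s => t - s)); first by rewrite gt_eqF.
  exact: der_cont (derB (derC t s) (derI s)).
- by move=> s ss; have [s1 st0] := st s ss; rewrite divr_ge0// ?invr_ge0 ?weight_ge0// ltW.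
- by apply: cvg_at_right_filter; apply: cF; rewrite lexx ltW.
- by apply: cvg_at_left_filter; apply: cF; rewrite lexx ltW.
move=> Iw E; split.
  by rewrite sE; exact: intbleN.
rewrite sE -[LHS]opprK; under eq_Rintegral do rewrite -mulN1r.
rewrite RintegralZl// E mulN1r opprK.
rewrite /F (_ : t - (t - e) = e); last by ring.
rewrite {2}/pvN weightN1 mul0r addr0 (_ : 1 - -1 * t = t - -1); last by ring.
by rewrite subrr; field.
Qed.

(* No factor 1/pi here, unlike in truncated_hilbert. *)
Definition trunc_int f t e := \int[mu]_(s in `]-1, (t - e)[) (f s / (s - t)) +
  \int[mu]_(s in `](t + e), 1[) (f s / (s - t)).

(** The divergent terms [ln e] from the two sides cancel; what remains is a difference of values of
    [ln (pvN t _)] at [t + e] and [t - e], which tends to 0 by continuity. This is the kernel of the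
    finite Hilbert transform. *)
Lemma pv_inv_weight t : -1 < t < 1 ->
  trunc_int (fun s => (w s)^-1) t e @[e --> 0^'+] --> (0:R).
Proof.
move=> t1; have /andP[t11 t12] := t1.
have h : ((ln (pvN t (t + e)) - ln (pvN t (t - e))) / w t) @[e --> 0^'+] --> (0 : R).
  apply: cvg_at_right_filter.
  rewrite [X in _ --> X](_ : 0 = (ln (pvN t (t + 0)) - ln (pvN t (t - 0))) / w t); last first.
    by rewrite addr0 subr0 subrr mul0r.
  have c1 (q : R -> R) : q 0 = 0 -> continuous q -> {for 0, continuous (fun e => ln (pvN t (t + q e)))}.
    move=> q0 cq; apply: (@continuous_comp _ _ _ (fun e => t + q e) (fun s => ln (pvN t s))).
      by apply: (@continuousD _ _ _ (fun=> t) q); [exact: cst_continuous|exact: cq].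
    by rewrite q0 addr0; apply: ln_pvN_cont => //; rewrite !ltW.
  apply: (@continuousM _ _ (fun e => ln (pvN t (t + e)) - ln (pvN t (t - e))) (fun=> (w t)^-1)); last exact: cst_continuous.
  apply: (@continuousB _ _ _ (fun e => ln (pvN t (t + e))) (fun e => ln (pvN t (t - e)))).
    by apply: (c1 id) => // ?; exact: cvg_id.
  apply: (c1 -%R); rewrite ?oppr0// => ?; exact: der_cont (derN (derI _)).
apply: cvg_trans h; apply: near_eq_cvg; near=> e.
have e0 : 0 < e by near: e; exact: nbhs_right_gt.
have e1 : e < 1 - t by near: e; apply: nbhs_right_lt; lra.
have e2 : e < t + 1 by near: e; apply: nbhs_right_lt; lra.
rewrite /trunc_int (pv_left t1 e0 _).2; last lra.
rewrite (pv_right t1 e0 _).2; last lra.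
by rewrite -mulrDl; congr (_ / _); ring.
Unshelve. all: by end_near. Qed.
End Weights.

(** * A priori bounds in L log L *)

Section Apriori.
Context (R : realType).
Notation mu := (@lebesgue_measure R).
Notation D := (`]-1, 1[%classic : set R).
Implicit Types (f g h : R -> R) (x y t s : R).
Local Notation w := (@weight R).

(** A Young function of L log L, in the form in which it occurs in [young_expR]. *)
Definition Psi (a : R) := a * ln (1 + a).

Lemma Psi_ge0 (a : R) : 0 <= a -> 0 <= Psi a.
Proof. by move=> a0; rewrite mulr_ge0// ln_ge0// lerDl. Qed.

Lemma Psi_le (a b : R) : 0 <= a -> a <= b -> Psi a <= Psi b.
Proof.
move=> a0 ab; rewrite ler_pM// ?ln_ge0 ?lerDl// ler_ln ?posrE ?lerD2l//.
  by rewrite ltr_pwDl.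
by rewrite ltr_pwDl// (le_trans a0).
Qed.

Lemma measurable_Psi : measurable_fun setT Psi.
Proof.
apply: measurable_funM => //; apply: measurableT_comp; first exact: measurable_ln.
exact: measurable_funD.
Qed.

Lemma shift_measurable (k : R -> R) : measurable_fun setT k ->
  measurable_fun setT (fun z : R * R => k (z.2 - z.1)).
Proof.
move=> mk; apply: (measurableT_comp mk).
by apply: measurable_funB; [exact: measurable_snd|exact: measurable_fst].
Qed.

(** Fubini and the oddness of [kp y]. It turns the exponential bound for bounded functions into L^1
    bounds, and later moves the Cauchy integral from one factor to the other. *)
Lemma Skp_antisym f g y : 0 < y -> measurable_fun setT f -> measurable_fun setT g ->
  intble mu D f -> intble mu D g ->
  \int[mu]_(x in D) (Sk kp f y x * g x) = - \int[mu]_(t in D) (f t * Sk kp g y t).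
Proof.
move=> y0 mf mg If Ig.
pose F (z : R * R) := f z.2 * kp y (z.2 - z.1) * g z.1.
have mF : measurable_fun setT F.
  apply: measurable_funM; last exact: (measurableT_comp mg measurable_fst).
  apply: measurable_funM; first exact: (measurableT_comp mf measurable_snd).
  by apply: shift_measurable; exact: kp_measurable.
have Ia : intble mu D (fun x => y^-1 * `|g x|) by apply: intbleZ => //; exact: intble_norm.
have Fab x t : D x -> D t -> `|F (x, t)| <= y^-1 * `|g x| * `|f t|.
  move=> _ _; rewrite /F/= normrM normrM.
  apply: (@le_trans _ _ (`|f t| * y^-1 * `|g x|)).
    by rewrite ler_wpM2r// ler_wpM2l// kp_le.
  by rewrite le_eqVlt; apply/orP; left; apply/eqP; ring.
have IfS : intble mu D (fun t => f t * Sk kp g y t).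
  apply: (@intbleM _ _ _ mu D _ _ (y^-1 * \int[mu]_(t in D) `|g t|)) => //.
    by apply: measurable_funTS; exact: Skp_measurable.
  by move=> x _; apply: (Sk_le Ig (kp_cont y0)) => t _; exact: kp_le.
transitivity (\int[mu]_(x in D) \int[mu]_(t in D) F (x, t)).
  apply: eq_Rintegral => x _; by rewrite /Sk -DZr//; exact: Skp_intble.
rewrite (@fubini_on _ _ _ _ R mu mu D D F _ _ (@mD R) (@mD R) mF Ia (intble_norm If) Fab).
rewrite -[RHS]mulN1r -(DZl _ IfS).
apply: eq_Rintegral => t _; rewrite mulN1r -mulrN -SkN; last exact: Skp_intble.
have IN : intble mu D (fun x => - g x) by exact: intbleN.
rewrite /Sk -(DZl _ (Skp_intble t y0 IN)).
by apply: eq_Rintegral => x _; rewrite /F/= -(opprB x t) kpN; ring.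
Qed.

(** Write w(t) = w(x) + (w(t) - w(x)). The difference equals - (t - x)(t + x) / (w(x) + w(t)); its
    factor t - x cancels the singularity by [kp_mul_le], and |t + x| <= 2. *)
Lemma weighted_Skp_le h y x : 0 < y -> -1 < x < 1 -> intble mu D h ->
  `|Sk kp (fun t => w t * h t) y x| <=
  w x * `|Sk kp h y x| + \int[mu]_(t in D) (`|h t| * (2 / (w x + w t))).
Proof.
move=> y0 x1 Ih; have wx := weight_gt0 x1; have x1' := x1.
have mw : measurable_fun D w by apply: measurable_funTS; exact: weight_measurable.
have Iwh : intble mu D (fun t => w t * h t).
  apply: (@intble_le _ _ _ mu D _ (fun t => `|h t|)) => //.
  - by apply: measurable_funM => //; exact: intble_measurable Ih.
  - by move=> t _; rewrite normrM ger0_norm ?weight_ge0// ler_piMl// weight_le1.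
  - exact: intble_norm.
have IG : intble mu D (fun t => `|h t| * (2 / (w x + w t))).
  apply: (@intbleM _ _ _ mu D _ _ (2 / w x)) => //; first exact: intble_norm.
    apply: measurable_funM => //; apply: (measurableT_comp (@measurable_inv R)).
    exact: measurable_funD.
  move=> t _; rewrite ger0_norm; last by rewrite divr_ge0// addr_ge0 ?weight_ge0.
  by rewrite ler_wpM2l// lef_pV2 ?posrE ?lerDl ?ltr_pwDl ?weight_ge0.
have E : Sk kp (fun t => w t * h t) y x = w x * Sk kp h y x +
    \int[mu]_(t in D) (h t * ((w t - w x) * kp y (t - x))).
  rewrite /Sk -RintegralZl//; last exact: Skp_intble.
  rewrite -RintegralD//.
  - by apply: eq_Rintegral => t _; ring.
  - by apply: intbleZ => //; exact: Skp_intble.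
  - apply: (@eq_intble _ _ _ mu D (fun t => w t * h t * kp y (t - x) - w x * (h t * kp y (t - x)))) => //.
      by move=> t _; ring.
    by apply: intbleB => //; [exact: Skp_intble|apply: intbleZ => //; exact: Skp_intble].
rewrite E (le_trans (ler_normD _ _))// lerD//.
  by rewrite normrM ger0_norm// weight_ge0.
apply: le_Rint_norm => //.
  apply: measurable_funM; first exact: intble_measurable Ih.
  apply: measurable_funM; first exact: measurable_funB.
  apply: measurable_funTS; apply: continuous_measurable_fun.
  by apply: shift_cont; exact: kp_cont.
move=> t /inD t1; rewrite normrM ler_wpM2l//.
have wt := weight_gt0 t1; have s0 : 0 < w x + w t by exact: addr_gt0.
have -> : w t - w x = (t - x) * (- (t + x) / (w x + w t)).
  have : (w t - w x) * (w x + w t) = - (t - x) * (t + x).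
    have -> : (w t - w x) * (w x + w t) = w t ^+ 2 - w x ^+ 2 by ring.
    move: x1 t1 => /andP[? ?] /andP[? ?]; rewrite !weight_sqr ?ltW//; ring.
  move=> e; apply: (mulIf (lt0r_neq0 s0)); rewrite e; field; exact: lt0r_neq0.
rewrite mulrAC normrM (le_trans (ler_wpM2r _ (kp_mul_le _ y0)))// mul1r.
rewrite normrM normrN (gtr0_norm (_ : 0 < (w x + w t)^-1)) ?invr_gt0//.
rewrite ler_wpM2r ?invr_ge0 ?(ltW s0)// ler_norml.
by move: x1 t1 => /andP[? ?] /andP[? ?]; apply/andP; split; lra.
Qed.

(** The sign [c] selects an end point of the interval. With r = sqrt(1 + c x) a primitive is 2 c
    ln(r + b), and sqrt 2 + b <= 3 gives the constant. *)
Lemma int_sqrt_kernel (b c : R) : 0 < b <= 1 -> c = 1 \/ c = -1 ->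
  intble mu D (fun x => (Num.sqrt (1 + c * x) * (Num.sqrt (1 + c * x) + b))^-1) /\
  \int[mu]_(x in D) (Num.sqrt (1 + c * x) * (Num.sqrt (1 + c * x) + b))^-1 <=
  2 * ln (3 / b).
Proof.
move=> /andP[b0 b1] c1.
pose r x := Num.sqrt (1 + c * x).
have r0 x : 0 <= r x by exact: sqrtr_ge0.
have rb x : 0 < r x + b by rewrite ltr_wpDl.
have cr x : {for x, continuous r}.
  apply: (@ct_comp _ Num.sqrt (fun x => 1 + c * x)); first exact: sqrt_continuous.
  exact: der_cont (derD (derC 1 x) (derZ c (derI x))).
pose F x := 2 * c * ln (r x + b).
have cF x : {for x, continuous F}.
  apply: ctM; first exact: ctC.
  apply: (@ct_comp _ (@ln R)); first by apply: continuous_ln.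
  by apply: ctD; [exact: cr|exact: ctC].
have s0 x : -1 < x < 1 -> 0 < 1 + c * x.
  by move=> /andP[x1 x2]; case: c1 => ->; lra.
have rp x : -1 < x < 1 -> 0 < r x by move=> x1; rewrite sqrtr_gt0 s0.
have cc : c * c = 1 by case: c1 => ->; ring.
have [] := @ftc_oo _ (fun x => (r x * (r x + b))^-1) F (-1) 1.
- lra.
- move=> x x1; have rx := rp x x1.
  have dr : is_derive x 1 r (c / (2 * r x)).
    apply: der_eq (der_comp (g := fun x => 1 + c * x) (is_derive1_sqrt (s0 x x1))
      (derD (derC 1 x) (derZ c (derI x)))) _.
    by rewrite -/(r x) add0r mulr1.
  apply: der_eq (derZ (2 * c) (der_comp (g := fun x => r x + b) (is_derive1_ln (rb x))
    (derD dr (derC b x)))) _.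
  rewrite addr0; transitivity (c * c * (r x * (r x + b))^-1); last by rewrite cc mul1r.
  by field; rewrite !gt_eqF.
- move=> x x1; apply: (@ctV _ (fun x => r x * (r x + b))).
    by rewrite gt_eqF// mulr_gt0// rp.
  by apply: ctM; [exact: cr|apply: ctD; [exact: cr|exact: ctC]].
- by move=> x x1; rewrite invr_ge0 mulr_ge0// ltW.
- by apply: cvg_at_right_filter; exact: cF.
- by apply: cvg_at_left_filter; exact: cF.
move=> Ir ->; split => //.
have s2 : Num.sqrt 2 <= 2 :> R.
  by rewrite -ler_sqr ?nnegrE ?sqrtr_ge0// sqr_sqrtr//; lra.
have s2' : 0 <= Num.sqrt 2 :> R := sqrtr_ge0 _.
have -> : F 1 - F (-1) = 2 * (ln (Num.sqrt 2 + b) - ln b).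
  rewrite /F /r; case: c1 => ->; rewrite ?mulr1 ?mulrN1 ?mulNr ?opprK ?mul1r.
    by rewrite subrr sqrtr0 add0r (_ : 1 + 1 = 2)//; ring.
  by rewrite subrr sqrtr0 add0r (_ : 1 + 1 = 2)//; ring.
rewrite ler_wpM2l// -ln_div ?posrE//; last by rewrite ltr_wpDl.
rewrite ler_ln ?posrE ?divr_gt0//; last by rewrite ltr_wpDl.
by rewrite ler_wpM2r ?invr_ge0 ?(ltW b0)//; lra.
Qed.

(** On each half of the interval 1 - x^2 is at least the distance to the nearer end point, so the
    kernel is dominated by the one-ended kernels of [int_sqrt_kernel]. *)
Lemma int_weight_kernel (b : R) : 0 < b <= 1 ->
  intble mu D (fun x => 2 / (w x * (w x + b))) /\
  \int[mu]_(x in D) (2 / (w x * (w x + b))) <= 8 * ln (3 / b).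
Proof.
move=> b01; have /andP[b0 b1] := b01.
have [I1 l1] := int_sqrt_kernel b01 (or_introl erefl).
have [I2 l2] := int_sqrt_kernel b01 (or_intror erefl).
set f1 := fun x => _ in I1; set f2 := fun x => _ in I2.
have lk x : D x -> `|2 / (w x * (w x + b))| <= 2 * (f1 x + f2 x).
  move=> /inD x1; have wx := weight_gt0 x1; have /andP[x2 x3] := x1.
  rewrite ger0_norm; last by rewrite divr_ge0// mulr_ge0 ?addr_ge0// ltW.
  rewrite ler_wpM2l//.
  have aux (c : R) : 0 <= 1 + c * x -> 0 < 1 + c * x <= 1 - x ^+ 2 ->
      (w x * (w x + b))^-1 <= (Num.sqrt (1 + c * x) * (Num.sqrt (1 + c * x) + b))^-1.
    move=> _ /andP[c0 cx].
    have r0 : 0 < Num.sqrt (1 + c * x) by rewrite sqrtr_gt0.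
    have rw : Num.sqrt (1 + c * x) <= w x by exact: ler_wsqrtr.
    rewrite lef_pV2 ?posrE ?mulr_gt0 ?addr_gt0//.
    by apply: ler_pM; rewrite ?lerD2r// ?ltW// addr_gt0.
  have f10 : 0 <= f1 x by rewrite invr_ge0 mulr_ge0 ?addr_ge0 ?sqrtr_ge0// ltW.
  have f20 : 0 <= f2 x by rewrite invr_ge0 mulr_ge0 ?addr_ge0 ?sqrtr_ge0// ltW.
  case: (lerP 0 x) => x0.
    apply: (@le_trans _ _ (f2 x)); last by rewrite lerDr.
    by apply: aux; [lra|apply/andP; split; nra].
  apply: (@le_trans _ _ (f1 x)); last by rewrite lerDl.
  by apply: aux; [lra|apply/andP; split; nra].
have I3 : intble mu D (fun x => 2 * (f1 x + f2 x)) by apply: intbleZ => //; exact: intbleD.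
have mk : measurable_fun D (fun x => 2 / (w x * (w x + b))).
  apply: measurable_funTS; apply: measurable_funM => //.
  apply: (measurableT_comp (@measurable_inv R)); apply: measurable_funM.
    exact: weight_measurable.
  by apply: measurable_funD => //; exact: weight_measurable.
split; first exact: intble_le I3.
apply: (le_trans (ler_norm _)); apply: (le_trans (@le_Rint_norm _ _ _ mu D _ _ (@mD R) mk I3 lk)).
rewrite RintegralZl//; last exact: intbleD.
by rewrite RintegralD//; lra.
Qed.

(** The bound of [expR_norm_int_le]. *)
Definition K0 : R := 12 * expR 1 / cos 1.

(** The free scale [N] compensates for the lack of homogeneity: when the integral of [Psi (N |f|)]
    stays bounded, a large [N] makes the whole right side small, constant included. *)
Lemma apriori f (N y : R) : 0 < N -> 0 < y < 1 -> measurable_fun setT f -> intble mu D f ->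
  intble mu D (fun t => Psi (N * `|f t|)) ->
  \int[mu]_(x in D) `|Sk kp f y x| <= pi / N * (\int[mu]_(t in D) Psi (N * `|f t|) + K0).
Proof.
move=> N0 y01 mf If IPsi; have /andP[y0 y1] := y01.
have mv : measurable_fun setT (Sk kp f y) by exact: Skp_measurable.
(* The sign of the potential, scaled to the bound 1/pi that [expR_norm_int_le] asks for; the factor
   [pi] is restored in front of the integral. *)
pose s x := if 0 <= Sk kp f y x then pi^-1 else - pi^-1 : R.
have p0 : 0 < pi^-1 :> R by rewrite invr_gt0 pi_gt0.
have ms : measurable_fun setT s.
  apply: measurable_fun_ifT => //.
  by apply: measurable_fun_ler.
have sle t : D t -> `|s t| <= pi^-1.
  by move=> _; rewrite /s; case: ifP => _; rewrite ?normrN gtr0_norm.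
have msD : measurable_fun D s by exact: measurable_funTS.
have Is : intble mu D s by apply: (@intble_bounded _ _ _ mu D _ pi^-1).
have Iv : intble mu D (Sk kp f y).
  apply: (@intbleS _ _ _ mu `[-1, 1]) => //; first exact: subset_itv_oo_cc.
  by apply: continuous_intble => x _; exact: Skp_cont.
have E := Skp_antisym y0 mf ms If Is.
have {E} E : \int[mu]_(x in D) `|Sk kp f y x| =
    - (pi * \int[mu]_(t in D) (f t * Sk kp s y t)).
  rewrite -mulrN -E -RintegralZl//; last first.
    by apply: (@intbleM _ _ _ mu D _ _ pi^-1).
  apply: eq_Rintegral => x _; rewrite /s.
  have pn : pi != 0 :> R by rewrite gt_eqF// pi_gt0.
  case: (ger0P (Sk kp f y x)) => v0.
    by rewrite mulrCA mulfV// mulr1.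
  by rewrite mulrN mulrN mulrCA mulfV// mulr1.
rewrite E -mulrN -mulrA ler_wpM2l ?pi_ge0//.
have Ie : intble mu D (fun t => expR `|Sk kp s y t|).
  apply: (@intbleS _ _ _ mu `[-1, 1]) => //; first exact: subset_itv_oo_cc.
  apply: continuous_intble => x _.
  apply: (@ct_comp _ (@expR R) (fun x => `|Sk kp s y x|)); first exact: continuous_expR.
  apply: (@ct_comp _ (fun x => `|x|)); first exact: norm_continuous.
  exact: Skp_cont.
have mS : measurable_fun D (Sk kp s y) by apply: measurable_funTS; exact: Skp_measurable.
apply: (@le_trans _ _ (\int[mu]_(t in D) (N^-1 * (Psi (N * `|f t|) + expR `|Sk kp s y t|)))).
  apply: (le_trans (ler_norm _)); rewrite normrN; apply: le_Rint_norm => //.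
  - apply: measurable_funM => //; exact: intble_measurable If.
  - by apply: intbleZ => //; exact: intbleD.
  - move=> t _; rewrite ler_pdivlMl// normrM mulrA; apply: young_expR.
    by rewrite mulr_ge0// ltW.
rewrite RintegralZl//; last exact: intbleD.
rewrite ler_wpM2l ?invr_ge0 ?(ltW N0)// RintegralD// lerD2l.
exact: (expR_norm_int_le msD sle y01).
Qed.

(** Division of [weighted_Skp_le] by w(x) leaves the unweighted potential and a positive kernel.
    Integrated in x first, the kernel costs a factor 8 ln(3 / w(t)), which Young's inequality
    tolerates. Integrability of [|h| / w] justifies the exchange of integrals and does not enter the
    bound. *)
Lemma apriori_weighted h (N y : R) : 0 < N -> 0 < y < 1 -> measurable_fun setT h ->
  intble mu D h -> intble mu D (fun t => `|h t| / w t) ->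
  intble mu D (fun t => Psi (N * `|h t|)) ->
  \int[mu]_(x in D) (`|Sk kp (fun t => w t * h t) y x| / w x) <=
  pi / N * (\int[mu]_(t in D) Psi (N * `|h t|) + K0) +
  8 / N * (\int[mu]_(t in D) Psi (N * `|h t|) + 3 * pi).
Proof.
move=> N0 y01 mh Ih Ihw IPsi; have /andP[y0 y1] := y01.
have mw : measurable_fun setT w := @weight_measurable R.
pose F (z : R * R) := `|h z.2| * (2 / (w z.1 * (w z.1 + w z.2))).
have mF : measurable_fun setT F.
  apply: measurable_funM.
    by apply: measurableT_comp => //; exact: (measurableT_comp mh measurable_snd).
  apply: measurable_funM => //; apply: (measurableT_comp (@measurable_inv R)).
  apply: measurable_funM; first exact: (measurableT_comp mw measurable_fst).
  apply: measurable_funD; first exact: (measurableT_comp mw measurable_fst).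
  exact: (measurableT_comp mw measurable_snd).
have [Iiw _] := int_inv_weight R.
have F_le x t : D x -> D t -> `|F (x, t)| <= 2 * (w x)^-1 * (`|h t| / w t).
  move=> /inD x1 /inD t1; have wx := weight_gt0 x1; have wt := weight_gt0 t1.
  rewrite /F/= ger0_norm; last by rewrite mulr_ge0// divr_ge0// mulr_ge0 ?addr_ge0 ?ltW.
  rewrite mulrCA -mulrA ler_wpM2l//.
  rewrite invfM (mulrCA (w x)^-1) ler_wpM2l// ler_wpM2l ?invr_ge0 ?(ltW wx)//.
  by rewrite lef_pV2 ?posrE ?addr_gt0// lerDr ltW.
have Ia : intble mu D (fun x => 2 * (w x)^-1) by exact: intbleZ.
have IF x : D x -> intble mu D (fun t => F (x, t)).
  move=> Dx; apply: (@intble_le _ _ _ mu D _ (fun t => 2 * (w x)^-1 * (`|h t| / w t))) => //.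
  - by apply: measurable_funTS; exact: (measurableT_comp mF).
  - by move=> t Dt; exact: F_le.
  - exact: intbleZ.
have mFi : measurable_fun D (fun x => \int[mu]_(t in D) F (x, t)).
  by apply: measurable_funTS; exact: (@measurable_inner _ _ _ _ R mu D F).
have IFi : intble mu D (fun x => \int[mu]_(t in D) F (x, t)).
  apply: (@intble_le _ _ _ mu D _ (fun x => 2 * (w x)^-1 * \int[mu]_(t in D) (`|h t| / w t))) => //.
  - move=> x Dx; rewrite -RintegralZl//.
    apply: le_Rint_norm => //; [|exact: intbleZ|by move=> t Dt; exact: F_le].
    by apply: measurable_funTS; exact: (measurableT_comp mF).
  - apply: (@eq_intble _ _ _ mu D (fun x => \int[mu]_(t in D) (`|h t| / w t) * (2 * (w x)^-1))) => //.
      by move=> x _; rewrite mulrC.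
    exact: intbleZ.
have Iv : intble mu D (fun x => `|Sk kp h y x|).
  apply: intble_norm; apply: (@intbleS _ _ _ mu `[-1, 1]) => //; first exact: subset_itv_oo_cc.
  by apply: continuous_intble => x _; exact: Skp_cont.
have Iwh : intble mu D (fun t => w t * h t).
  apply: (@intble_le _ _ _ mu D _ (fun t => `|h t|)) => //.
  - by apply: measurable_funTS; exact: measurable_funM.
  - by move=> t _; rewrite normrM ger0_norm ?weight_ge0// ler_piMl// weight_le1.
  - exact: intble_norm.
apply: (@le_trans _ _ (\int[mu]_(x in D) (`|Sk kp h y x| + \int[mu]_(t in D) F (x, t)))).
  apply: le_Rintegral => //.
  - apply: (@eq_intble _ _ _ mu D (fun x => (w x)^-1 * `|Sk kp (fun t => w t * h t) y x|)) => //.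
      by move=> x _; rewrite mulrC.
    apply: (@intbleM _ _ _ mu D _ _ (y^-1 * \int[mu]_(t in D) `|w t * h t|)) => //.
      by apply: measurableT_comp => //; apply: measurable_funTS; exact: Skp_measurable.
    by move=> x _; rewrite normr_id; apply: (Sk_le Iwh (kp_cont y0)) => t _; exact: kp_le.
  - exact: intbleD.
  - move=> x Dx; have x1 := (inD x).1 Dx; have wx := weight_gt0 x1.
    rewrite ler_pdivrMr// (le_trans (weighted_Skp_le y0 x1 Ih))//.
    rewrite mulrDl (mulrC (w x)) lerD2l le_eqVlt; apply/orP; left; apply/eqP.
    rewrite -RintegralZr//; last exact: IF.
    apply: eq_Rintegral => t /set_mem/inD t1; have wt := weight_gt0 t1.
    by rewrite /F/=; field; rewrite !gt_eqF ?addr_gt0.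
rewrite RintegralD// lerD//; first exact: apriori.
rewrite (@fubini_on _ _ _ _ R mu mu D D F _ _ (@mD R) (@mD R) mF Ia Ihw F_le).
apply: (@le_trans _ _ (\int[mu]_(t in D) (8 / N * (Psi (N * `|h t|) + 3 * (w t)^-1)))).
  have J1 : intble mu D (fun t => 8 / N * (Psi (N * `|h t|) + 3 * (w t)^-1)).
    by apply: intbleZ => //; apply: intbleD => //; exact: intbleZ.
  have mFj : measurable_fun D (fun t => \int[mu]_(x in D) F (x, t)).
    have mF' : measurable_fun setT (fun z : R * R => F (z.2, z.1)).
      by apply: (measurableT_comp mF); exact: measurable_swap.
    by apply: measurable_funTS; exact: (@measurable_inner _ _ _ _ R mu D _ (@mD R) mF').
  have le1 t : D t -> 0 <= \int[mu]_(x in D) F (x, t) <= 8 / N * (Psi (N * `|h t|) + 3 * (w t)^-1).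
    move=> /inD t1; have wt := weight_gt0 t1.
    have wt1 : 0 < w t <= 1 by rewrite wt weight_le1.
    have [Ik kle] := int_weight_kernel wt1.
    rewrite Rintegral_ge0 /=; last first.
      move=> x _; rewrite /F/= mulr_ge0// divr_ge0// mulr_ge0 ?addr_ge0 ?weight_ge0//.
    rewrite /F/= RintegralZl//.
    apply: (le_trans (ler_wpM2l _ kle)) => //.
    rewrite mulrCA -mulrA ler_wpM2l// ler_pdivlMl// mulrA.
    (* The exponent is ln(3 / w(t)), so the exponential term is 3 / w(t), of integral 3 pi. *)
    rewrite (le_trans (young_expR _ _))//; first by rewrite mulr_ge0// ltW.
    by rewrite lnK ?posrE ?divr_gt0.
  apply: le_Rintegral => //.
    apply: intble_le J1 => // t Dt; have /andP[l1 l2] := le1 t Dt; by rewrite ger0_norm.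
  by move=> t Dt; have /andP[] := le1 t Dt.
rewrite RintegralZl//; last by apply: intbleD => //; exact: intbleZ.
rewrite RintegralD//; last exact: intbleZ.
by rewrite RintegralZl// (int_inv_weight R).2.
Qed.
End Apriori.

(** * Boundary values at Lebesgue points *)

Section LebesguePoints.
Context (R : realType).
Notation mu := (@lebesgue_measure R).
Notation D := (`]-1, 1[%classic : set R).
Implicit Types (f g : R -> R) (x y t s h : R).

Definition lebesgue_pt f x := forall eta : R, 0 < eta -> exists2 d : R, 0 < d &
  forall r : R, 0 < r <= d -> \int[mu]_(s in `]x - r, x + r[) `|f s - f x| <= eta * r.

(** The ratio of the two kernels is (u^2 + 4 h^2) / (2 (u^2 + h^2)); it decreases in u^2 and equals
    13/20 at |u| = 3 h. *)
Lemma kq_double (h u : R) : 0 < h -> 3 * h <= `|u| -> kq h u <= 13 / 20 * kq (2 * h) u.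
Proof.
move=> h0 hu; have hh0 : 0 < 2 * h by rewrite mulr_gt0.
rewrite /kq mulrA ler_pdivrMr ?sqD_gt0// mulrAC ler_pdivlMr ?sqD_gt0//.
have : (3 * h) ^+ 2 <= u ^+ 2.
  by rewrite -(real_normK (num_real u)) ler_sqr// nnegrE// mulr_ge0// ltW.
nra.
Qed.

Lemma subset_sym_itv x (r d : R) : r <= d -> `]x - r, x + r[ `<=` `]x - d, x + d[.
Proof.
by move=> rd s /=; rewrite !in_itv/= => /andP[h1 h2]; apply/andP; split; lra.
Qed.

(** Induction on the scale, from 2 h to h. Outside the interval of radius 3 h the kernel contracts
    by 13/20; inside, kq <= 1/h contributes at most 3 eta. The bound reproduces itself since 9 *
    13/20 + 3 <= 9. For h >= d/3 it follows directly from kq <= 1/h. *)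
Lemma near_kq_le g x (d eta : R) : 0 < d -> 0 < eta -> (forall s, 0 <= g s) ->
  intble mu `]x - d, x + d[ g ->
  (forall r : R, 0 < r <= d -> \int[mu]_(s in `]x - r, x + r[) g s <= eta * r) ->
  forall h, 0 < h <= d -> \int[mu]_(s in `]x - d, x + d[) (g s * kq h (s - x)) <= 9 * eta.
Proof.
move=> d0 e0 g0 Ig gle.
set B := fun r : R => `]x - r, x + r[%classic.
have mB r : measurable (B r) by exact: measurable_itv.
have Igk h : 0 < h -> intble mu (B d) (fun s => g s * kq h (s - x)).
  move=> h0; apply: (@intbleM _ _ _ mu (B d) _ _ h^-1) => //; first exact: mB.
    by apply: measurable_funTS; apply: continuous_measurable_fun; apply: shift_cont; exact: kq_cont.
  by move=> s _; rewrite ger0_norm ?kq_ge0// kq_le.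
have ZB (k : R) (f : R -> R) : intble mu (B d) f ->
    \int[mu]_(s in B d) (k * f s) = k * \int[mu]_(s in B d) f s.
  by move=> If; apply: RintegralZl; [exact: mB|exact: If].
have base h : d / 3 <= h -> \int[mu]_(s in B d) (g s * kq h (s - x)) <= 9 * eta.
  move=> hd; have h0 : 0 < h by apply: lt_le_trans hd; rewrite divr_gt0.
  apply: (@le_trans _ _ (\int[mu]_(s in B d) (h^-1 * g s))).
    apply: (@le_Rintegral _ _ _ mu (B d) _ _ (mB d)); [exact: Igk|by apply: intbleZ; [exact: mB|exact: Ig]|].
    by move=> s _; rewrite mulrC ler_wpM2r// kq_le.
  rewrite ZB// ler_pdivrMl//.
  have dd : 0 < d <= d by rewrite d0/=.
  apply: (le_trans (gle d dd)); nra.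
have step n : forall h, 0 < h <= d -> d / 3 <= h * 2 ^+ n ->
    \int[mu]_(s in B d) (g s * kq h (s - x)) <= 9 * eta.
  elim: n => [|n IH] h /andP[h0 hd] hn; first by apply: base; rewrite expr0 mulr1 in hn.
  have [dh|hd3] := leP (d / 3) h; first exact: base.
  have h2 : 0 < 2 * h by rewrite mulr_gt0.
  have h2d : 0 < 2 * h <= d by rewrite h2/=; lra.
  have IH2 : \int[mu]_(s in B d) (g s * kq (2 * h) (s - x)) <= 9 * eta.
    by apply: IH => //; rewrite exprS mulrA (mulrC h) in hn.
  have I3 : intble mu (B d) (g \_ (B (3 * h))).
    apply: (@intble_le _ _ _ mu (B d) _ g) => //; first exact: mB.
    - apply: measurable_funTS; apply/(measurable_restrictT _ _).1; first exact: mB.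
      have sB : B (3 * h) `<=` B d by apply: subset_sym_itv; lra.
      have IgS : intble mu (B (3 * h)) g by apply: intbleS Ig; [exact: mB|exact: mB|exact: sB].
      by apply: intble_measurable IgS.
    - by move=> s _; rewrite /patch; case: ifP => _; rewrite ?normr0// ger0_norm.
  apply: (@le_trans _ _ (\int[mu]_(s in B d) (13 / 20 * (g s * kq (2 * h) (s - x)) + h^-1 * (g \_ (B (3 * h))) s))).
    apply: (@le_Rintegral _ _ _ mu (B d) _ _ (mB d)); first exact: Igk.
      by apply: intbleD; [exact: mB|apply: intbleZ; [exact: mB|exact: Igk]|apply: intbleZ; [exact: mB|]].
    move=> s _; rewrite /patch; case: ifPn => sB.
      have : kq h (s - x) <= h^-1 by exact: kq_le.
      have : 0 <= kq (2 * h) (s - x) by exact: kq_ge0.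
      have := g0 s; move: (g s) (kq (2 * h) _) (kq h _) => a b c a0 b0 c1.
      rewrite mulrC (mulrC h^-1); apply: (@le_trans _ _ (a * h^-1)); first by rewrite mulrC ler_wpM2l.
      by rewrite lerDr mulr_ge0// mulr_ge0.
    rewrite mulr0 addr0 [13 / 20 * _]mulrCA; apply: ler_wpM2l => //; apply: kq_double => //.
    move: sB; apply: contraNT; rewrite -ltNge ltr_norml => /andP[u1 u2].
    by apply/mem_set; rewrite /B/= in_itv/=; apply/andP; split; [rewrite ltrBlDl -ltrBlDr -opprB ltrNl|rewrite -ltrBlDl].
  rewrite (@RintegralD _ _ _ mu (B d)); [|exact: mB|by apply: intbleZ; [exact: mB|exact: Igk]|by apply: intbleZ; [exact: mB|]].
  rewrite ZB; last exact: Igk.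
  rewrite ZB// -Rintegral_mkcondr.
  have -> : B d `&` B (3 * h) = B (3 * h).
    by apply: setIidr; apply: subset_sym_itv; lra.
  have h3 : 0 < 3 * h <= d by apply/andP; split; lra.
  have : h^-1 * \int[mu]_(s in B (3 * h)) g s <= 3 * eta.
    by rewrite ler_pdivrMl//; apply: (le_trans (gle _ h3)); nra.
  have hI := IH2.
  lra.
move=> h /andP[h0 hd].
pose n := Num.bound (d / 3 / h).
apply: (step n); first by rewrite h0.
rewrite -ler_pdivrMl// [h^-1 * _]mulrC.
have n1 : d / 3 / h < n%:R.
  by apply: le_lt_trans (archi_boundP _); [exact: lexx|rewrite !divr_ge0// ltW].
apply: (le_trans (ltW n1)); rewrite -natrX ler_nat; apply: ltnW; exact: ltn_expl.
Qed.

Lemma lebesgue_poisson f x : -1 < x < 1 -> intble mu D f -> lebesgue_pt f x ->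
  \int[mu]_(t in D) (`|f t - f x| * kq h (t - x)) @[h --> 0^'+] --> (0 : R).
Proof.
move=> x1 If fx; have /andP[x2 x3] := x1.
pose g t := `|f t - f x|.
have g0 t : 0 <= g t by exact: normr_ge0.
have Ig : intble mu D g.
  by apply: DI_norm; apply: DI_B => //; exact: DI_C.
apply/cvgrPdist_le => e e0.
(* The part near [x] takes nine tenths of [e], by the factor 9 of [near_kq_le], and the far part the
   last tenth. *)
have e10 : 0 < e / 10 by rewrite divr_gt0.
have [d' d'0 hd'] := fx _ e10.
pose d := Num.min d' (Num.min (1 - x) (1 + x)).
have dd' : d <= d' by rewrite ge_min lexx.
have d1 : d <= 1 - x by rewrite !ge_min lexx orbT.
have d2 : d <= 1 + x by rewrite !ge_min lexx !orbT.
have d0 : 0 < d by rewrite !lt_min d'0/=; apply/andP; split; lra.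
have sD : `]x - d, x + d[ `<=` D.
  by move=> s /=; rewrite !in_itv/= => /andP[? ?]; apply/andP; split; lra.
have IgB : intble mu `]x - d, x + d[ g by apply: intbleS Ig.
have hd (r : R) : 0 < r <= d -> \int[mu]_(s in `]x - r, x + r[) g s <= e / 10 * r.
  by move=> /andP[r0 rd]; apply: hd'; rewrite r0/= (le_trans rd).
have near_le : forall h, 0 < h <= d -> \int[mu]_(s in `]x - d, x + d[) (g s * kq h (s - x)) <= 9 * (e / 10) := near_kq_le d0 e10 g0 IgB hd.
set G := \int[mu]_(t in D) g t.
have G0 : 0 <= G by apply: Rintegral_ge0.
have b0 : 0 < e / 10 / (G / d ^+ 2 + 1).
  by rewrite divr_gt0// ltr_wpDl// divr_ge0// sqr_ge0.
near=> h.
have h0 : 0 < h by near: h; exact: nbhs_right_gt.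
have hd1 : h <= d by near: h; exact: nbhs_right_le.
have hG : h * (G / d ^+ 2) <= e / 10.
  have : h <= e / 10 / (G / d ^+ 2 + 1) by near: h; exact: nbhs_right_le.
  have Gd : 0 <= G / d ^+ 2 by rewrite divr_ge0// sqr_ge0.
  rewrite ler_pdivlMr; last by rewrite ltr_wpDl.
  by apply: le_trans; rewrite ler_wpM2l ?(ltW h0)// lerDl.
have I1 : intble mu D (fun t => g t * kq h (t - x)).
  by apply: Skq_intble.
have mgk : measurable_fun setT (fun t => kq h (t - x)).
  by apply: continuous_measurable_fun; apply: shift_cont; exact: kq_cont.
have I2 : intble mu D ((fun t => g t * kq h (t - x)) \_ `]x - d, x + d[).
  apply: (@DI_le _ _ (fun t => g t * kq h (t - x))) => //.
  - apply: measurable_funTS; apply/(measurable_restrictT _ _).1; first exact: measurable_itv.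
    apply: measurable_funM; last exact: measurable_funTS.
    by apply: intble_measurable IgB.
  - move=> t _; rewrite /patch; case: ifP => _; last by rewrite normr0 mulr_ge0 ?kq_ge0.
    by rewrite ger0_norm// mulr_ge0 ?kq_ge0.
rewrite sub0r normrN ger0_norm; last first.
  by apply: Rintegral_ge0 => t _; rewrite mulr_ge0// kq_ge0.
apply: (@le_trans _ _ (\int[mu]_(t in D) ((fun t => g t * kq h (t - x)) \_ `]x - d, x + d[ t + h / d ^+ 2 * g t))).
  apply: Dle => //; first by apply: DI_D => //; exact: DI_Z.
  move=> t _; rewrite /patch; case: ifPn => tB.
    by rewrite lerDl mulr_ge0// divr_ge0 ?sqr_ge0// ltW.
  rewrite add0r -/(g t) mulrC ler_wpM2r//.
  have du : d <= `|t - x|.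
    move: tB; apply: contraNT; rewrite -ltNge ltr_norml => /andP[u1 u2].
    by rewrite inE/= in_itv/=; apply/andP; split; lra.
  have u0 : t - x != 0 by rewrite -normr_gt0 (lt_le_trans d0).
  apply: (le_trans (kq_leV2 h0 u0)); rewrite ler_wpM2l ?(ltW h0)//.
  rewrite -(real_normK (num_real (t - x))) lef_pV2 ?posrE ?exprn_gt0 ?normr_gt0//.
  by rewrite ler_sqr ?nnegrE// ltW.
rewrite DD//; last exact: DI_Z.
rewrite DZl// -/G -Rintegral_mkcondr (setIidr sD).
have h0d : 0 < h <= d by rewrite h0.
have := near_le h h0d; rewrite (mulrAC h) mulrA in hG *; lra.
Unshelve. all: by end_near. Qed.

Lemma Skq1E (h x : R) : 0 < h ->
  Sk kq (fun=> 1) h x = atan ((1 - x) / h) - atan ((-1 - x) / h).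
Proof.
move=> h0; have ck : continuous (fun t => kq h (t - x)).
  by apply: shift_cont; exact: kq_cont.
have I1 : intble mu `[-1, 1] (fun t => kq h (t - x)) by apply: continuous_intble => t _; exact: ck.
rewrite -int_kq//.
rewrite /Sk; under eq_Rintegral do rewrite mul1r.
rewrite -Rintegral_itv_obnd_cbnd; last by apply: intbleS I1 => //; exact: subset_itv_oc_cc.
rewrite -Rintegral_itv_bndo_bndc//; apply: intbleS I1 => //; exact: subset_itv_oo_cc.
Qed.

Lemma div_cvg_pinfty (u : R) : 0 < u -> u / h @[h --> 0^'+] --> +oo.
Proof.
move=> u0; apply/cvgryPge => A; near=> h.
have h0 : 0 < h by near: h; exact: nbhs_right_gt.
rewrite ler_pdivlMr//.
have A0 : 0 < `|A| + 1 by rewrite ltr_wpDl.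
have hA : h <= u / (`|A| + 1) by near: h; apply: nbhs_right_le; rewrite divr_gt0.
move: hA; rewrite ler_pdivlMr// mulrC; apply: le_trans.
by rewrite ler_wpM2r ?(ltW h0)// (le_trans (ler_norm A))// lerDl.
Unshelve. all: by end_near. Qed.

Lemma atan_div_cvg (u : R) : 0 < u -> atan (u / h) @[h --> 0^'+] --> pi / 2.
Proof. by move=> u0; apply: cvg_comp; [exact: div_cvg_pinfty u0|exact: cvgy_atan]. Qed.

Lemma poisson_cvg f x : -1 < x < 1 -> intble mu D f -> lebesgue_pt f x ->
  Sk kq f h x @[h --> 0^'+] --> pi * f x.
Proof.
move=> x1 If fx; have /andP[x2 x3] := x1.
have h1 := lebesgue_poisson x1 If fx.
have h2 : \int[mu]_(t in D) ((f t - f x) * kq h (t - x)) @[h --> 0^'+] --> (0 : R).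
  apply/cvgrPdist_le => e e0; move/cvgrPdist_le : h1 => /(_ _ e0); apply: filter_app.
  near=> h.
  have h0 : 0 < h by near: h; exact: nbhs_right_gt.
  have Ig : intble mu D (fun t => f t - f x) by apply: DI_B => //; exact: DI_C.
  rewrite !sub0r !normrN; apply: le_trans.
  rewrite [leRHS]ger0_norm; last by apply: Rintegral_ge0 => t _; rewrite mulr_ge0// kq_ge0.
  apply: Dle_norm; first by apply: DI_mf; exact: Skq_intble.
    by apply: Skq_intble => //; exact: DI_norm.
  by move=> t _; rewrite normrM (ger0_norm (kq_ge0 _ h0)).
have h3 : f x * Sk kq (fun=> 1) h x @[h --> 0^'+] --> f x * pi.
  apply: cvgM; first exact: cvg_cst.
  have h4 : atan ((1 - x) / h) - atan ((-1 - x) / h) @[h --> 0^'+] --> pi.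
    rewrite (_ : pi = pi / 2 - - (pi / 2) :> R); last by field.
    apply: cvgB; first by apply: atan_div_cvg; lra.
    rewrite (_ : (fun h => atan ((-1 - x) / h)) = (fun h => - atan ((1 + x) / h))).
      by apply: cvgN; apply: atan_div_cvg; lra.
    by apply/funext => h; rewrite -atanN -mulNr opprD.
  apply: cvg_trans h4; apply: near_eq_cvg; near=> h.
  by rewrite Skq1E//; near: h; exact: nbhs_right_gt.
have h4 : \int[mu]_(t in D) ((f t - f x) * kq h (t - x)) + f x * Sk kq (fun=> 1) h x @[h --> 0^'+] --> pi * f x.
  by rewrite -[pi * _]add0r (mulrC pi); exact: cvgD h2 h3.
apply: cvg_trans h4; apply: near_eq_cvg; near=> h.
have h0 : 0 < h by near: h; exact: nbhs_right_gt.
have Ig : intble mu D (fun t => f t - f x) by apply: DI_B => //; exact: DI_C.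
rewrite /= /Sk -DZl; last by apply: Skq_intble => //; exact: DI_C.
rewrite -DD; [|exact: Skq_intble|by apply: DI_Z; apply: Skq_intble => //; exact: DI_C].
by apply: Deq => t _; ring.
Unshelve. all: by end_near. Qed.
End LebesguePoints.

(** * Truncated integrals against conjugate Poisson integrals *)

Section Truncations.
Context (R : realType).
Notation mu := (@lebesgue_measure R).
Notation D := (`]-1, 1[%classic : set R).
Implicit Types (f g : R -> R) (x y t s h : R).

Definition kt h u : R := if h < `|u| then u^-1 else 0.

(** For |u| > h the difference is h^2 / (u (u^2 + h^2)); for |u| <= h it is - kp, where |u| <= h.
    Hence truncations and conjugate Poisson integrals differ by a Poisson integral, which is
    controlled at Lebesgue points. *)
Lemma ktp_le h u : 0 < h -> `|kt h u - kp h u| <= kq h u.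
Proof.
move=> h0; have d0 := sqD_gt0 u h0; have d1 := sqD_neq0 u h0.
rewrite /kt; case: ifPn => hu.
  have u0 : u != 0 by rewrite -normr_gt0 (lt_trans h0).
  rewrite (_ : u^-1 - kp h u = h * (h / u) / (u ^+ 2 + h ^+ 2)); last by rewrite /kp; field; rewrite ?d1 ?u0.
  rewrite !normrM !normfV (gtr0_norm h0) (gtr0_norm d0) /kq ler_wpM2r ?invr_ge0 ?(ltW d0)//.
  by rewrite ler_piMr ?(ltW h0)// ler_pdivrMr ?mul1r ?(ltW hu)// normr_gt0.
rewrite sub0r normrN /kp normrM normfV (gtr0_norm d0) /kq ler_wpM2r ?invr_ge0 ?(ltW d0)//.
by rewrite leNgt.
Qed.

Lemma kt_le h u : 0 < h -> `|kt h u| <= h^-1.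
Proof.
move=> h0; rewrite /kt; case: ifPn => hu; last by rewrite normr0 invr_ge0 ltW.
by rewrite normfV lef_pV2 ?posrE ?(ltW hu)// (lt_trans h0).
Qed.

Lemma kt_measurable h : measurable_fun setT (kt h).
Proof.
apply: measurable_fun_ifT => //; last exact: measurable_inv.
by apply: measurable_fun_ltr => //; exact: measurableT_comp.
Qed.

Lemma shift_measurable1 (k : R -> R) x : measurable_fun setT k ->
  measurable_fun setT (fun t => k (t - x)).
Proof. by move=> mk; apply: (measurableT_comp mk); exact: measurable_funB. Qed.

Lemma Skt_intble f h x : 0 < h -> intble mu D f -> intble mu D (fun t => f t * kt h (t - x)).
Proof.
move=> h0 If; apply: (DI_M If (M := h^-1)); last by move=> t _; exact: kt_le.
by apply: measurable_funTS; exact: shift_measurable1 (kt_measurable h).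
Qed.

(** Puts both one-sided integrals on the fixed interval, with a bounded kernel. The open cut
    intervals match the strict inequality in [kt]; one of them may be empty when [h] is large. *)
Lemma trunc_intE f x h : -1 < x < 1 -> 0 < h -> intble mu D f ->
  trunc_int f x h = Sk kt f h x.
Proof.
move=> /andP[x1 x2] h0 If; rewrite /trunc_int.
have If1 : measurable_fun D (fun s => f s / (s - x)).
  apply: measurable_funM; first exact: DI_mf.
  by apply: measurable_funTS; exact: (shift_measurable1 x (@measurable_inv R)).
have sA : `]-1, (x - h)[%classic `<=` D.
  by move=> s /=; rewrite !in_itv/= => /andP[? ?]; apply/andP; split; lra.
have sB : `](x + h), 1[%classic `<=` D.
  by move=> s /=; rewrite !in_itv/= => /andP[? ?]; apply/andP; split; lra.
have I (A : set R) : measurable A -> A `<=` D -> (forall s, A s -> h < `|s - x|) ->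
    intble mu D ((fun s => f s / (s - x)) \_ A).
  move=> mA AD hA; apply: (@DI_le _ _ (fun s => h^-1 * `|f s|)); last by apply: DI_Z; exact: DI_norm.
    apply: measurable_funTS; apply/(measurable_restrictT _ _).1 => //.
    exact: measurable_funS If1.
  move=> s _; rewrite /patch; case: ifPn => [/set_mem/hA hs|_]; last first.
    by rewrite normr0 mulr_ge0// invr_ge0 ltW.
  rewrite normrM mulrC ler_wpM2r// normfV lef_pV2 ?posrE ?(ltW hs)//; exact: lt_trans hs.
rewrite -{1}(setIidr sA) -{1}(setIidr sB) Rintegral_mkcondr [X in _ + X]Rintegral_mkcondr.
rewrite -DD.
- rewrite /Sk; apply: Deq => s /andP[s1 s2].
  rewrite /patch /kt !mem_setE !in_itv/= s1 s2 /= andbT.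
  have [sx|sx] := ltP s (x - h).
    rewrite [X in if X then _ else _](_ : _ = false); last by apply/negbTE; rewrite -leNgt; lra.
    rewrite ifT ?addr0// ltr0_norm; lra.
  have [sx'|sx'] := ltP (x + h) s.
    by rewrite ifT ?add0r// gtr0_norm; lra.
  rewrite ifF ?addr0 ?mulr0//; apply/negbTE; rewrite -leNgt ler_norml; apply/andP; split; lra.
- apply: I => // s /=; rewrite in_itv/= => /andP[? ?]; rewrite ltr0_norm; lra.
- apply: I => // s /=; rewrite in_itv/= => /andP[? ?]; rewrite gtr0_norm; lra.
Qed.

Lemma Rint_oo_cc f (a b : R) : intble mu `[a, b] f ->
  \int[mu]_(t in `]a, b[) f t = \int[mu]_(t in `[a, b]) f t.
Proof.
move=> I1; rewrite -Rintegral_itv_obnd_cbnd; last by apply: intbleS I1 => //; exact: subset_itv_oc_cc.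
by rewrite -Rintegral_itv_bndo_bndc//; apply: intbleS I1 => //; exact: subset_itv_oo_cc.
Qed.

Lemma ftc_oo_cc f F a b : a < b ->
  (forall x, a <= x <= b -> is_derive x 1 F (f x)) ->
  (forall x, a <= x <= b -> {for x, continuous f}) ->
  \int[mu]_(x in `]a, b[) f x = F b - F a.
Proof.
by move=> ab dF cf; rewrite Rint_oo_cc ?(ftc_cc ab dF)//; exact: continuous_intble.
Qed.

Lemma trunc_int1 x h : -1 < x < 1 -> 0 < h -> h < 1 - x -> h < 1 + x ->
  trunc_int (fun=> 1) x h = ln (1 - x) - ln (1 + x).
Proof.
move=> /andP[x1 x2] h0 h1 h2; rewrite /trunc_int.
have cV s : s - x != 0 -> {for s, continuous (fun s => 1 / (s - x))}.
  by move=> s0; apply: ctM; [exact: ctC|apply: ctV => //; apply: ctB; [exact: ctI|exact: ctC]].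
have -> : \int[mu]_(s in `]-1, (x - h)[) (1 / (s - x)) = ln (x - (x - h)) - ln (x - -1).
  apply: (@ftc_oo_cc _ (fun s => ln (x - s))); first lra.
    move=> s /andP[s1 s2]; have xs : 0 < x - s by lra.
    apply: der_eq (der_comp (g := fun s => x - s) (is_derive1_ln xs) (derB (derC x s) (derI s))) _.
    by field; apply/andP; split; lra.
  by move=> s /andP[s1 s2]; apply: cV; lra.
have -> : \int[mu]_(s in `](x + h), 1[) (1 / (s - x)) = ln (1 - x) - ln (x + h - x).
  apply: (@ftc_oo_cc _ (fun s => ln (s - x))); first lra.
    move=> s /andP[s1 s2]; have xs : 0 < s - x by lra.
    apply: der_eq (der_comp (g := fun s => s - x) (is_derive1_ln xs) (derB (derI s) (derC x s))) _.
    by field; lra.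
  by move=> s /andP[s1 s2]; apply: cV; lra.
rewrite (_ : x - (x - h) = h); last ring.
rewrite (_ : x - -1 = 1 + x); last ring.
rewrite (_ : x + h - x = h); last ring.
by ring.
Qed.

Lemma Skp1E x h : 0 < h ->
  Sk kp (fun=> 1) h x = 2^-1 * (ln ((1 - x) ^+ 2 + h ^+ 2) - ln ((-1 - x) ^+ 2 + h ^+ 2)).
Proof.
move=> h0; rewrite /Sk; under eq_Rintegral do rewrite mul1r.
rewrite mulrBr; apply: (@ftc_oo_cc _ (fun t => 2^-1 * ln ((t - x) ^+ 2 + h ^+ 2))); first lra.
- move=> t _; have n0 := sqD_neq0 (t - x) h0.
  apply: der_eq (derZ 2^-1 (der_comp (f := @ln R) (g := fun t => (t - x) ^+ 2 + h ^+ 2)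
    (is_derive1_ln (sqD_gt0 _ h0)) (derD (derX2 (derB (derI t) (derC x t))) (derC _ _)))) _.
  by rewrite /kp; field.
- by move=> t _; apply: shift_cont; exact: kp_cont.
Qed.

Lemma Skp1_cvg x : -1 < x < 1 ->
  Sk kp (fun=> 1) h x @[h --> 0^'+] --> ln (1 - x) - ln (1 + x).
Proof.
move=> /andP[x1 x2].
have c1 (a : R) : 0 < a -> {for 0, continuous (fun h => ln (a ^+ 2 + h ^+ 2))}.
  move=> a0; apply: (@ct_comp _ (@ln R) (fun h => a ^+ 2 + h ^+ 2)).
    by rewrite expr0n addr0; apply: continuous_ln; rewrite exprn_gt0.
  exact: der_cont (derD (derC _ _) (derX2 (derI _))).
have H : {for 0, continuous (fun h => 2^-1 * (ln ((1 - x) ^+ 2 + h ^+ 2) - ln ((1 + x) ^+ 2 + h ^+ 2)))}.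
  by apply: ctM; [exact: ctC|apply: ctB; apply: c1; lra].
have H' := cvg_at_right_filter H.
rewrite /= expr0n !addr0 !lnXn in H'; [|lra|lra].
rewrite (_ : 2^-1 * _ = ln (1 - x) - ln (1 + x)) in H'; last by rewrite -mulrnBl -mulr_natl; field.
apply: cvg_trans H'; apply: near_eq_cvg; near=> h.
have h0 : 0 < h by near: h; exact: nbhs_right_gt.
by rewrite Skp1E//= (_ : (-1 - x) ^+ 2 = (1 + x) ^+ 2)//; ring.
Unshelve. all: by end_near. Qed.

(** With [f - f x] in place of [f] this is [ktp_le] and [lebesgue_poisson]. For the constant [f x]
    both terms are explicit logarithms with the same limit. *)
Lemma trunc_Skp_cvg0 f x : -1 < x < 1 -> intble mu D f -> lebesgue_pt f x ->
  trunc_int f x h - Sk kp f h x @[h --> 0^'+] --> (0 : R).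
Proof.
move=> x1 If fx; have /andP[x2 x3] := x1.
have h1 := lebesgue_poisson x1 If fx.
have h2 : \int[mu]_(t in D) ((f t - f x) * (kt h (t - x) - kp h (t - x))) @[h --> 0^'+] --> (0 : R).
  apply/cvgrPdist_le => e e0; move/cvgrPdist_le : h1 => /(_ _ e0); apply: filter_app.
  near=> h.
  have h0 : 0 < h by near: h; exact: nbhs_right_gt.
  have Ig : intble mu D (fun t => f t - f x) by apply: DI_B => //; exact: DI_C.
  rewrite !sub0r !normrN; apply: le_trans.
  rewrite [leRHS]ger0_norm; last by apply: Rintegral_ge0 => t _; rewrite mulr_ge0// kq_ge0.
  apply: Dle_norm.
    apply: (@DI_mf _ (fun t => (f t - f x) * (kt h (t - x) - kp h (t - x)))).
    apply: (@DI_eq _ (fun t => (f t - f x) * kt h (t - x) - (f t - f x) * kp h (t - x))).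
      by move=> t _; rewrite mulrBr.
    by apply: DI_B; [exact: Skt_intble|exact: Skp_intble].
  - by apply: Skq_intble => //; exact: DI_norm.
  - by move=> t _; rewrite normrM ler_wpM2l// ktp_le.
have h3 : trunc_int (fun=> 1) x h - Sk kp (fun=> 1) h x @[h --> 0^'+] --> (0 : R).
  rewrite -[X in _ --> X](subrr (ln (1 - x) - ln (1 + x))).
  apply: cvgB; last exact: Skp1_cvg.
  apply: cvg_trans (@cvg_cst _ (ln (1 - x) - ln (1 + x)) _ (0^'+) _).
  apply: near_eq_cvg; near=> h; rewrite trunc_int1//.
  - near: h; apply: nbhs_right_lt; lra.
  - near: h; apply: nbhs_right_lt; lra.
have h4 : \int[mu]_(t in D) ((f t - f x) * (kt h (t - x) - kp h (t - x))) +
    f x * (trunc_int (fun=> 1) x h - Sk kp (fun=> 1) h x) @[h --> 0^'+] --> (0 : R).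
  rewrite -[X in _ --> X]addr0; apply: cvgD h2 _; rewrite -[X in _ --> X](mulr0 (f x)).
  by apply: cvgM h3; exact: cvg_cst.
apply: cvg_trans h4; apply: near_eq_cvg; near=> h.
have h0 : 0 < h by near: h; exact: nbhs_right_gt.
have Ig : intble mu D (fun t => f t - f x) by apply: DI_B => //; exact: DI_C.
have I1 := DI_C (1 : R).
rewrite !trunc_intE// /Sk mulrBr -DZl; last exact: (@Skt_intble (fun=> 1)).
rewrite -DZl; last exact: (@Skp_intble _ (fun=> 1)).
have I2 : intble mu D (fun t => f x * (1 * kt h (t - x))).
  by apply: DI_Z; apply: (@Skt_intble (fun=> 1)).
have I3 : intble mu D (fun t => f x * (1 * kp h (t - x))).
  by apply: DI_Z; apply: (@Skp_intble _ (fun=> 1)).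
rewrite -DB; [|exact: Skt_intble|exact: Skp_intble].
rewrite -DB//.
rewrite -DD.
- by apply: Deq => t _; ring.
- apply: (@DI_eq _ (fun t => (f t - f x) * kt h (t - x) - (f t - f x) * kp h (t - x))).
    by move=> t _; rewrite mulrBr.
  by apply: DI_B; [exact: Skt_intble|exact: Skp_intble].
- exact: DI_B.
Unshelve. all: by end_near. Qed.

Lemma lebesgue_pt_continuous f x : -1 < x < 1 -> intble mu D f -> {for x, continuous f} -> lebesgue_pt f x.
Proof.
move=> /andP[x1 x2] If cf e e0.
have e2 : 0 < e / 2 by rewrite divr_gt0.
have /cvgrPdist_le/(_ _ e2) := cf; rewrite -nbhs_nearE => -[r0 /= r00 hr].
have d0 : 0 < Num.min (r0 / 2) (Num.min (1 - x) (1 + x)).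
  by rewrite !lt_min divr_gt0//=; apply/andP; split; lra.
exists (Num.min (r0 / 2) (Num.min (1 - x) (1 + x))) => // r /andP[rp].
rewrite !le_min => /and3P[r1 r2 r3].
have sD : `]x - r, x + r[%classic `<=` D.
  by move=> s /=; rewrite !in_itv/= => /andP[? ?]; apply/andP; split; lra.
have mB : measurable (`]x - r, x + r[%classic : set R) by exact: measurable_itv.
have muB : mu `]x - r, x + r[ = (2 * r)%:E.
  by rewrite lebesgue_measure_itv/= lte_fin ifT ?EFinN; [congr EFin; ring|lra].
apply: (@le_trans _ _ (\int[mu]_(s in `]x - r, x + r[) (e / 2))).
  apply: le_Rintegral => //.
  - have I : intble mu D (fun s => `|f s - f x|) by apply: DI_norm; apply: DI_B => //; exact: DI_C.
    by apply: (@intbleS _ _ _ mu D _ _ _ _ sD I).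
  - by apply: intble_cst => //; apply: (@eq_ind_r _ _ (fun z => (z < +oo)%E) _ _ muB); rewrite ltry.
  - move=> s /=; rewrite in_itv/= => /andP[s1 s2]; rewrite distrC; apply: hr.
    by rewrite /ball_/= ltr_norml; apply/andP; split; lra.
rewrite Rintegral_cst//= [X in fine X]muB/=; lra.
Qed.

Lemma ae_imp (P Q : R -> Prop) : (forall x, P x -> Q x) ->
  {ae mu, forall x, P x} -> {ae mu, forall x, Q x}.
Proof. by move=> PQ; apply: negligibleS => x /= nQ Px; apply: nQ; exact: PQ. Qed.

Lemma lebesgue_pt_ae f : intble mu D f ->
  {ae mu, forall x, D x -> lebesgue_pt f x}.
Proof.
move=> If.
have loc : locally_integrable setT (f \_ D) by exact: integrable_locally_restrict If.
apply: ae_imp (lebesgue_differentiation loc) => x hx Dx e e0.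
have /andP[x1 x2] : -1 < x < 1 by rewrite /= in_itv in Dx.
have e2 : (0 < (e / 2)%:E)%E by rewrite lte_fin divr_gt0.
(* The averages in the differentiation theorem divide by the measure 2 r of the ball, whence e /
   2. *)
move/fine_cvgP : hx => [_]; move/cvgrPdist_le => /(_ (e / 2)).
rewrite divr_gt0// => /(_ isT) -[d /= d0 hd].
have dd0 : 0 < Num.min (d / 2) (Num.min (1 - x) (1 + x)).
  by rewrite !lt_min divr_gt0//=; apply/andP; split; lra.
exists (Num.min (d / 2) (Num.min (1 - x) (1 + x))) => // r /andP[rp].
rewrite !le_min => /and3P[r1 r2 r3].
have sD : `]x - r, x + r[%classic `<=` D.
  by move=> s /=; rewrite !in_itv/= => /andP[? ?]; apply/andP; split; lra.
have mB : measurable (`]x - r, x + r[%classic : set R) by exact: measurable_itv.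
have I : intble mu `]x - r, x + r[ (fun s => `|f s - f x|).
  have I : intble mu D (fun s => `|f s - f x|) by apply: DI_norm; apply: DI_B => //; exact: DI_C.
  by apply: (@intbleS _ _ _ mu D _ _ _ _ sD I).
have := hd r; rewrite /ball_/= !sub0r !normrN gtr0_norm// => /(_ _ rp).
have rd : r < d by lra.
move=> /(_ rd); rewrite /davg /iavg lebesgue_measure_ball ?(ltW rp)// ball_itv/=.
have -> : (\int[mu]_(y in `](x - r)%R, (x + r)%R[) `|(f \_ D) y - (f \_ D) x|%:E)%E =
    (\int[mu]_(s in `]x - r, x + r[) `|f s - f x|)%:E.
  rewrite -RintE//; apply: eq_integral => s /set_mem sB; congr EFin.
  by rewrite /patch !mem_set//; exact: sD.
have I0 : 0 <= \int[mu]_(s in `]x - r, x + r[) `|f s - f x| by apply: Rintegral_ge0.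
have r20 : r *+ 2 != 0 by rewrite mulrn_eq0/= gt_eqF.
rewrite inver (negbTE r20) -EFinM /= ger0_norm; last by rewrite mulr_ge0// invr_ge0 mulrn_wge0// ltW.
by rewrite ler_pdivrMl ?pmulrn_lgt0// => /le_trans; apply; rewrite -mulr_natl; lra.
Qed.
End Truncations.

(** * Inversion formulas *)

Section Density.
Context (R : realType).
Notation mu := (@lebesgue_measure R).
Notation D := (`]-1, 1[%classic : set R).
Implicit Types (f g h : R -> R) (x y t s a b N : R).
Local Notation w := (@weight R).

(** From a + b <= 2 max(a, b). It replaces the triangle inequality, at the price of doubling the
    scale. *)
Lemma Psi_add a b : 0 <= a -> 0 <= b -> Psi (a + b) <= Psi (2 * a) + Psi (2 * b).
Proof.
move=> a0 b0.
have a20 : 0 <= 2 * a by rewrite mulr_ge0.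
have b20 : 0 <= 2 * b by rewrite mulr_ge0.
have ab0 : 0 <= a + b by rewrite addr_ge0.
have [ab|/ltW ba] := leP a b.
  apply: (@le_trans _ _ (Psi (2 * b))); last by rewrite lerDr Psi_ge0.
  by apply: Psi_le => //; lra.
apply: (@le_trans _ _ (Psi (2 * a))); last by rewrite lerDl Psi_ge0.
by apply: Psi_le => //; lra.
Qed.

(** Since 1 + N a <= (1 + N)(1 + a). Integrability of [Psi |f|] thus implies that of [Psi (N |f|)]
    for every [N]. *)
Lemma Psi_scale N a : 0 <= N -> 0 <= a -> Psi (N * a) <= N * ln (1 + N) * a + N * Psi a.
Proof.
move=> N0 a0; rewrite /Psi.
have h1 : ln (1 + N * a) <= ln (1 + N) + ln (1 + a).
  rewrite -lnM ?posrE ?ltr_pwDl// ler_ln ?posrE ?mulr_gt0 ?ltr_pwDl ?mulr_ge0//.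
  by rewrite -subr_ge0 (_ : _ - _ = N + a); [exact: addr_ge0|ring].
apply: (le_trans (ler_wpM2l _ h1)); first exact: mulr_ge0.
by rewrite le_eqVlt; apply/orP; left; apply/eqP; ring.
Qed.

Lemma le_Psi a : 0 <= a -> a <= expR 1 + Psi a.
Proof.
move=> a0; have [ae|ea] := leP a (expR 1); first by rewrite (le_trans ae)// lerDl Psi_ge0.
apply: (@le_trans _ _ (Psi a)); last by rewrite lerDr expR_ge0.
rewrite /Psi ler_peMr//; rewrite -[leLHS](expRK 1) ler_ln ?posrE ?expR_gt0 ?ltr_pwDl//.
by rewrite (le_trans (ltW ea))// lerDr.
Qed.

Lemma Psi_intble f : measurable_fun D f -> intble mu D (fun t => Psi `|f t|) -> intble mu D f.
Proof.
move=> mf IP; apply: (@DI_le _ _ (fun t => expR 1 + Psi `|f t|)) => //.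
  by move=> t _; exact: le_Psi.
by apply: DI_D => //; exact: DI_C.
Qed.

Lemma Psi_measurable f N : measurable_fun D f -> measurable_fun D (fun t => Psi (N * `|f t|)).
Proof.
move=> mf; apply: (measurableT_comp (@measurable_Psi R)).
by apply: measurable_funM => //; exact: measurableT_comp.
Qed.

Lemma Psi_intble_scale f N : 0 <= N -> measurable_fun D f -> intble mu D (fun t => Psi `|f t|) ->
  intble mu D (fun t => Psi (N * `|f t|)).
Proof.
move=> N0 mf IP; apply: (@DI_le _ _ (fun t => N * ln (1 + N) * `|f t| + N * Psi `|f t|)).
- exact: Psi_measurable.
- by move=> t _; rewrite ger0_norm ?Psi_scale// Psi_ge0// mulr_ge0.
- by apply: DI_D; apply: DI_Z => //; apply: DI_norm; exact: Psi_intble.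
Qed.

Lemma Psi_bounded f N (M : R) : 0 <= N -> measurable_fun D f -> (forall t, -1 < t < 1 -> `|f t| <= M) ->
  intble mu D (fun t => Psi (N * `|f t|)).
Proof.
move=> N0 mf fM; apply: (@DI_bd _ _ (Psi (N * M))); first exact: Psi_measurable.
move=> t t1; rewrite ger0_norm; last by rewrite Psi_ge0// mulr_ge0.
by apply: Psi_le; rewrite ?mulr_ge0// ler_wpM2l// fM.
Qed.

(** Bounded and Lipschitz on the whole line, so that continuity up to the end points of the interval
    is available; one constant serves both conditions. *)
Definition lipb g := exists L : R, (forall x, `|g x| <= L) /\ (forall t x, `|g t - g x| <= L * `|t - x|).

Lemma lipbB f g : lipb f -> lipb g -> lipb (fun t => f t - g t).
Proof.
move=> [L1 [f1 f2]] [L2 [g1 g2]]; exists (L1 + L2); split=> [x|t x].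
  by rewrite (le_trans (ler_normB _ _))// lerD.
rewrite (_ : _ - _ = (f t - f x) - (g t - g x)); last ring.
by rewrite (le_trans (ler_normB _ _))// mulrDl lerD.
Qed.

Lemma lipb_cont g : lipb g -> continuous g.
Proof.
move=> [L [_ gL]] x; apply/cvgrPdist_le => e e0.
have L0 : 0 <= L.
  by have := gL 1 0; rewrite subr0 normr1 mulr1; apply: le_trans.
have d0 : 0 < e / (L + 1) by rewrite divr_gt0// ltr_wpDl.
near=> t; apply: (le_trans (gL _ _)).
have h : `|x - t| <= e / (L + 1).
  by near: t; apply: cvgr_dist_le => //; exact: cvg_id.
move: h; rewrite ler_pdivlMr ?ltr_wpDl// mulrC; apply: le_trans.
by rewrite ler_wpM2r// lerDl.
Unshelve. all: by end_near. Qed.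

Lemma lipb_measurable g : lipb g -> measurable_fun setT g.
Proof. by move=> gl; apply: continuous_measurable_fun; exact: lipb_cont. Qed.

Lemma lipb_intble g : lipb g -> intble mu D g.
Proof. by move=> gl; apply: DI_cont => x _; exact: lipb_cont. Qed.

(** At a fixed height the x-derivative [Sk kb] is bounded by [y ^- 2] times the L^1 norm, so the
    mean value theorem gives the Lipschitz constant. *)
Lemma poisson_lipb f y (M : R) : 0 < y -> measurable_fun D f -> (forall t, -1 < t < 1 -> `|f t| <= M) ->
  lipb (fun x => pi^-1 * Sk kq f y x).
Proof.
move=> y0 mf fM; have If : intble mu D f by exact: DI_bd fM.
have p0 : 0 < pi^-1 :> R by rewrite invr_gt0 pi_gt0.
set K := y ^- 2 * \int[mu]_(t in D) `|f t|.
have K0 : 0 <= K.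
  by apply: mulr_ge0; [rewrite invr_ge0 exprn_ge0// ltW|apply: Rintegral_ge0].
have M0 : 0 <= M by apply: (le_trans _ (fM 0 _)) => //; apply/andP; split; lra.
have b1 x : `|pi^-1 * Sk kq f y x| <= M.
  rewrite normrM (gtr0_norm p0) ler_pdivrMl ?pi_gt0// mulrC; apply: Skq_bound => // t /inD; exact: fM.
have b2 x : `|Sk kb f y x| <= K.
  by apply: Sk_le => //; [exact: kb_cont|move=> t _; exact: kb_le].
have b3 a b : a <= b -> `|Sk kq f y b - Sk kq f y a| <= K * `|b - a|.
  move=> ab; have [||c _ ->] := @MVT_segment _ (Sk kq f y) (Sk kb f y) _ _ ab.
  - by move=> x _; exact: der_Skq_x.
  - by apply: continuous_subspaceT; exact: Skq_cont.
  - by rewrite normrM ler_wpM2r.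
exists (M + pi^-1 * K); split=> [x|t x].
  by rewrite (le_trans (b1 x))// lerDl mulr_ge0// ltW.
rewrite -mulrBr normrM (gtr0_norm p0) mulrDl -mulrA ler_wpDl ?mulr_ge0//.
rewrite ler_wpM2l ?(ltW p0)//.
by have [|/ltW] := leP x t => /b3//; rewrite distrC (distrC x).
Qed.

(** Starts at 1/2, because the a priori bounds ask for heights strictly below 1. *)
Definition ys (n : nat) : R := n.+2%:R^-1.

Lemma ys01 n : 0 < ys n < 1.
Proof. by rewrite invr_gt0 ltr0n/= invf_lt1 ?ltr0n// ltr1n. Qed.

Lemma ys_cvg0 : ys n @[n --> \oo] --> (0 : R).
Proof.
have := @cvg_harmonic R; rewrite -(cvg_shiftn 1); apply: cvg_trans.
by apply: near_eq_cvg; apply: nearW => n; rewrite /= addn1.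
Qed.

Lemma at_right_ys (f : R -> R) (l : R) : f y @[y --> 0^'+] --> l -> f (ys n) @[n --> \oo] --> l.
Proof.
move=> /cvg_at_rightP; apply; split; last exact: ys_cvg0.
by move=> n; have /andP[] := ys01 n.
Qed.

Lemma Psi_cvg0 (u : nat -> R) : (forall n, 0 <= u n) -> u n @[n --> \oo] --> (0:R) ->
  Psi (u n) @[n --> \oo] --> (0:R).
Proof.
move=> u0 cu; have c : {for 0, continuous (@Psi R)}.
  apply: ctM; first exact: ctI.
  apply: (@ct_comp _ (@ln R) (fun a => 1 + a)); first by apply: continuous_ln; rewrite addr0.
  by apply: ctD; [exact: ctC|exact: ctI].
have P0 : Psi (0 : R) = 0 by rewrite /Psi mul0r.
have H : Psi (u n) @[n --> \oo] --> Psi (0 : R) by apply: cvg_comp cu c.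
by rewrite P0 in H.
Qed.

(* The approximation is the Poisson integral of a truncation of f. *)
Lemma density f N (e : R) : 0 < N -> 0 < e -> measurable_fun setT f ->
  intble mu D (fun t => Psi `|f t|) ->
  exists2 g, lipb g & \int[mu]_(t in D) Psi (N * `|f t - g t|) <= e.
Proof.
move=> N0 e0 mf IP; have mfD : measurable_fun D f by exact: measurable_funTS.
pose fn (n : nat) t := if `|f t| <= n%:R then f t else 0.
have mfn n : measurable_fun setT (fn n).
  apply: measurable_fun_ifT => //.
  by apply: measurable_fun_ler => //; exact: measurableT_comp.
have mfnD n : measurable_fun D (fn n) by exact: measurable_funTS.
have N2 : 0 <= 2 * N by rewrite mulr_ge0// ltW.
have fnle n t : `|fn n t| <= n%:R by rewrite /fn; case: ifP => //; rewrite normr0.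
have e2 : 0 < e / 2 by rewrite divr_gt0.
have [n hn] : exists n, \int[mu]_(t in D) Psi (2 * N * `|f t - fn n t|) <= e / 2.
  have H : \int[mu]_(t in D) Psi (2 * N * `|f t - fn n t|) @[n --> \oo] --> \int[mu]_(t in D) (0 : R).
    apply: (@Rint_cvg _ _ _ mu D _ _ (fun t => Psi (2 * N * `|f t|)) _ _ _ _ _).2.
    - exact: mD.
    - by move=> n; apply: Psi_measurable; exact: measurable_funB.
    - move=> t _; apply: Psi_cvg0; first by move=> n; rewrite mulr_ge0.
      rewrite -(mulr0 (2 * N)); apply: cvgM; first exact: cvg_cst.
      rewrite -(@normr0 _ R) -(subrr (f t)); apply: cvg_norm; apply: cvgB; first exact: cvg_cst.
      apply: cvg_trans (@cvg_cst _ (f t) _ \oo _); apply: near_eq_cvg; near=> n.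
      rewrite /fn ifT//; near: n; exact: nbhs_infty_ger.
    - exact: Psi_intble_scale.
    - move=> n t _; rewrite ger0_norm; last by rewrite Psi_ge0// mulr_ge0.
      apply: Psi_le; first by rewrite mulr_ge0.
      by rewrite ler_wpM2l// /fn; case: ifP => _; rewrite ?subr0// subrr normr0.
  move: H; rewrite Rintegral_cst ?mul0r; last exact: mD.
  move/cvgrPdist_le => /(_ _ e2) -[n _ /(_ n (leqnn _))] /=; rewrite sub0r normrN => hn.
  by exists n; exact: le_trans (ler_norm _) hn.
pose gk k x := pi^-1 * Sk kq (fn n) (ys k) x.
have yk k : 0 < ys k by have /andP[] := ys01 k.
have gl k : lipb (gk k) by apply: (@poisson_lipb _ _ n%:R).
have gb k x : `|gk k x| <= n%:R.
  rewrite normrM ger0_norm ?invr_ge0 ?pi_ge0// ler_pdivrMl ?pi_gt0// mulrC.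
  by apply: Skq_bound => // t /inD; exact: fnle.
have mg k : measurable_fun D (gk k) by apply: measurable_funTS; exact: lipb_measurable.
have [k hk] : exists k, \int[mu]_(t in D) Psi (2 * N * `|fn n t - gk k t|) <= e / 2.
  have H : \int[mu]_(t in D) Psi (2 * N * `|fn n t - gk k t|) @[k --> \oo] --> \int[mu]_(t in D) (0 : R).
    have In : intble mu D (fn n) by apply: (@DI_bd _ _ n%:R).
    apply: (@Rint_cvg_ae _ _ _ mu D _ _ (fun=> Psi (2 * N * (n%:R + n%:R)))).
    - exact: mD.
    - by move=> k; apply: Psi_measurable; exact: measurable_funB.
    - exact: measurable_cst.
    - apply: ae_imp (lebesgue_pt_ae In) => x lx Dx; apply: Psi_cvg0; first by move=> k; rewrite mulr_ge0.
      rewrite -(mulr0 (2 * N)); apply: cvgM; first exact: cvg_cst.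
      rewrite -(@normr0 _ R) -(subrr (fn n x)); apply: cvg_norm; apply: cvgB; first exact: cvg_cst.
      have -> : fn n x = pi^-1 * (pi * fn n x) by rewrite mulrA mulVf ?mul1r// gt_eqF// pi_gt0.
      apply: cvgM; first exact: cvg_cst.
      by apply: (@at_right_ys (fun y => Sk kq (fn n) y x)); apply: poisson_cvg => //; exact: lx.
    - exact: DI_C.
    - move=> k t _; rewrite ger0_norm; last by rewrite Psi_ge0// mulr_ge0.
      apply: Psi_le; first by rewrite mulr_ge0.
      by rewrite ler_wpM2l// (le_trans (ler_normB _ _))// lerD.
  move: H; rewrite Rintegral_cst ?mul0r; last exact: mD.
  move/cvgrPdist_le => /(_ _ e2) -[k _ /(_ k (leqnn _))] /=; rewrite sub0r normrN => hk.
  by exists k; exact: le_trans (ler_norm _) hk.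
exists (gk k) => //.
have I1 : intble mu D (fun t => Psi (2 * N * `|f t - fn n t|)).
  apply: (@DI_le _ _ (fun t => Psi (2 * N * `|f t|))).
  - by apply: Psi_measurable; exact: measurable_funB.
  - move=> t _; rewrite ger0_norm; last by rewrite Psi_ge0// mulr_ge0.
    apply: Psi_le; first by rewrite mulr_ge0.
    by rewrite ler_wpM2l// /fn; case: ifP => _; rewrite ?subr0// subrr normr0.
  - exact: Psi_intble_scale.
have I2 : intble mu D (fun t => Psi (2 * N * `|fn n t - gk k t|)).
  apply: (@Psi_bounded _ _ (n%:R + n%:R)) => //; first exact: measurable_funB.
  by move=> t _; rewrite (le_trans (ler_normB _ _))// lerD.
have le1 t : Psi (N * `|f t - gk k t|) <= Psi (2 * N * `|f t - fn n t|) + Psi (2 * N * `|fn n t - gk k t|).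
  apply: (@le_trans _ _ (Psi (N * `|f t - fn n t| + N * `|fn n t - gk k t|))).
    apply: Psi_le; first by rewrite mulr_ge0// ltW.
    rewrite -mulrDr ler_wpM2l ?(ltW N0)//.
    by rewrite (_ : f t - gk k t = (f t - fn n t) + (fn n t - gk k t)) ?ler_normD//; ring.
  by rewrite -!(mulrA 2); apply: Psi_add; rewrite mulr_ge0// ltW.
apply: (@le_trans _ _ (e / 2 + e / 2)); last by rewrite -splitr.
apply: (@le_trans _ _ (\int[mu]_(t in D) (Psi (2 * N * `|f t - fn n t|) + Psi (2 * N * `|fn n t - gk k t|)))).
  apply: Dle => //; last exact: DI_D.
  apply: DI_le (DI_D I1 I2); first by apply: Psi_measurable; exact: measurable_funB.
  by move=> t _; rewrite ger0_norm// Psi_ge0// mulr_ge0// ltW.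
by rewrite DD// lerD.
Unshelve. all: by end_near. Qed.

(* Holds for bounded Lipschitz functions and for their products with w. *)
Definition nice h (C : R) := forall t x, -1 < t < 1 -> -1 < x < 1 -> `|h t - h x| <= C * `|t - x| / w t.

Lemma nice_ge0 h C : nice h C -> 0 <= C.
Proof.
move=> hC; have l1 : -1 < (1 / 2 : R) < 1 by apply/andP; split; lra.
have l0 : -1 < (0 : R) < 1 by apply/andP; split; lra.
have := le_trans (normr_ge0 _) (hC _ _ l1 l0).
by rewrite pmulr_lge0 ?invr_gt0 ?weight_gt0// pmulr_lge0// normr_gt0; lra.
Qed.

Lemma weight_diff t x : -1 < t < 1 -> -1 < x < 1 -> `|w t - w x| <= 2 * `|t - x| / w t.
Proof.
move=> t1 x1; have wt := weight_gt0 t1; have wx := weight_gt0 x1.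
rewrite ler_pdivlMr//.
apply: (@le_trans _ _ (`|w t - w x| * (w t + w x))).
  by rewrite ler_wpM2l// lerDl ltW.
have /andP[t2 t3] := t1; have /andP[x2 x3] := x1.
rewrite -[X in _ * X](@gtr0_norm _ (w t + w x)) ?addr_gt0// -normrM -subr_sqr.
rewrite !weight_sqr ?(ltW t2) ?(ltW t3) ?(ltW x2) ?(ltW x3)//.
rewrite (_ : _ - _ = - (t + x) * (t - x)); last ring.
rewrite normrM ler_wpM2r// normrN ler_norml; apply/andP; split; lra.
Qed.

Lemma nice_lip g : lipb g -> exists C, nice g C.
Proof.
move=> [L [_ gL]]; exists L => t x t1 x1; apply: (le_trans (gL _ _)).
have L0 : 0 <= L by have := gL 1 0; rewrite subr0 normr1 mulr1; apply: le_trans.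
rewrite ler_peMr ?mulr_ge0// invf_ge1 ?weight_le1//; exact: weight_gt0.
Qed.

Lemma nice_wlip g : lipb g -> exists C, nice (fun t => w t * g t) C.
Proof.
move=> [L [g1 gL]]; exists (3 * L) => t x t1 x1.
have L0 : 0 <= L by apply: le_trans (g1 0).
have wt := weight_gt0 t1.
rewrite (_ : _ - _ = g x * (w t - w x) + w t * (g t - g x)); last ring.
apply: (le_trans (ler_normD _ _)); rewrite !normrM (gtr0_norm wt).
have h1 : `|g x| * `|w t - w x| <= L * (2 * `|t - x| / w t) by rewrite ler_pM// weight_diff.
have h2 : w t * `|g t - g x| <= L * `|t - x| / w t.
  apply: (@le_trans _ _ (L * `|t - x|)).
    by rewrite -[leRHS]mul1r ler_pM// ?(ltW wt)// weight_le1.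
  by rewrite ler_peMr ?mulr_ge0// invf_ge1 ?weight_le1.
by apply: (le_trans (lerD h1 h2)); rewrite le_eqVlt; apply/orP; left; apply/eqP; ring.
Qed.

Lemma ln_le_sub1 (v : R) : 0 < v -> ln v <= v - 1.
Proof.
move=> v0; have h : -1 < v - 1 by lra.
by have := @le_ln1Dx R (v - 1) h; rewrite addrCA subrr addr0.
Qed.

(** Meant for u = 1 - x or 1 + x and a = w(x), whose square (1 - x)(1 + x) is at most 2 u: the
    logarithmic singularity at an end point is dominated by 1/w. *)
Lemma half_ln_le (u y a : R) : 0 < u -> u <= 2 -> 0 < y < 1 -> 0 < a <= 1 -> a ^+ 2 <= 2 * u ->
  `|2^-1 * ln (u ^+ 2 + y ^+ 2)| <= 4 / a.
Proof.
move=> u0 u2 /andP[y0 y1] /andP[a0 a1] au.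
have s0 : 0 < u ^+ 2 + y ^+ 2 by rewrite addr_gt0// exprn_gt0.
have a4 : 4 <= 4 / a by rewrite ler_pdivlMr// ler_piMr.
rewrite ler_norml; apply/andP; split.
  have h1 : ln (u ^+ 2) <= ln (u ^+ 2 + y ^+ 2).
    by rewrite ler_ln ?posrE ?exprn_gt0// lerDl exprn_ge0// ltW.
  have h2 : - ln u <= 4 / a.
    rewrite -lnV ?posrE//; apply: (@le_trans _ _ (ln ((2 / a) ^+ 2))).
      rewrite ler_ln ?posrE ?invr_gt0 ?exprn_gt0 ?divr_gt0//.
      rewrite exprMn exprVn -[leLHS]mul1r ler_pdivrMr// mulrAC ler_pdivlMr ?exprn_gt0// mul1r.
      nra.
    rewrite lnXn ?divr_gt0// mulr2n.
    have h3 : ln (2 / a) <= 2 / a.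
      have a2 : 0 < 2 / a by rewrite divr_gt0.
      by have := ln_le_sub1 a2; lra.
    by rewrite (_ : 4 / a = 2 / a + 2 / a) ?lerD//; field; rewrite gt_eqF.
  rewrite lnXn// mulr2n in h1; lra.
have h1 : ln (u ^+ 2 + y ^+ 2) <= 4.
  have u4 : u ^+ 2 <= 4 by nra.
  have y4 : y ^+ 2 <= 1 by nra.
  by have := ln_le_sub1 s0; lra.
lra.
Qed.

Lemma Skp1_le y x : -1 < x < 1 -> 0 < y < 1 -> `|Sk kp (fun=> 1) y x| <= 8 / w x.
Proof.
move=> x1 y01; have /andP[y0 _] := y01; have /andP[x2 x3] := x1; have wx := weight_gt0 x1.
have w2 : w x ^+ 2 = 1 - x ^+ 2 by apply: weight_sqr; rewrite !ltW.
have wx1 : 0 < w x <= 1 by rewrite wx weight_le1.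
rewrite Skp1E// mulrBr (le_trans (ler_normB _ _))//.
rewrite (_ : 8 / w x = 4 / w x + 4 / w x); last by field; rewrite gt_eqF.
rewrite (_ : (-1 - x) ^+ 2 = (1 + x) ^+ 2); last ring.
by apply: lerD; apply: half_ln_le => //; rewrite ?w2; nra.
Qed.

Lemma nice_intble h C y x : -1 < x < 1 -> nice h C -> intble mu D h -> 0 < y ->
  intble mu D (fun t => (h t - h x) * kp y (t - x)).
Proof. by move=> x1 hC Ih y0; apply: Skp_intble => //; apply: DI_B => //; exact: DI_C. Qed.

Lemma Skp_split h y x : intble mu D h -> 0 < y ->
  Sk kp h y x = \int[mu]_(t in D) ((h t - h x) * kp y (t - x)) + h x * Sk kp (fun=> 1) y x.
Proof.
move=> Ih y0; rewrite /Sk.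
have I1 : intble mu D (fun t => 1 * kp y (t - x)) by apply: (@Skp_intble _ (fun=> 1)) => //; exact: DI_C.
rewrite -DZl// -DD; [|by apply: Skp_intble => //; apply: DI_B => //; exact: DI_C|exact: DI_Z].
by apply: Deq => t _; ring.
Qed.

(** The factor |t - x| in the definition of [nice] meets [kp_mul_le]. The majorant depends on [t]
    alone, so dominated convergence applies as y tends to 0. *)
Lemma nice_kernel_le h C y x t : -1 < x < 1 -> -1 < t < 1 -> nice h C -> 0 < y ->
  `|(h t - h x) * kp y (t - x)| <= C * (w t)^-1.
Proof.
move=> x1 t1 hC y0; have wt := weight_gt0 t1; have C0 := nice_ge0 hC.
rewrite normrM; apply: (le_trans (ler_wpM2r (normr_ge0 _) (hC t x t1 x1))).
have := kp_mul_le (t - x) y0; rewrite normrM => k1.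
rewrite (_ : C * `|t - x| / w t * _ = C * (w t)^-1 * (`|t - x| * `|kp y (t - x)|)); last ring.
by rewrite ler_piMr// mulr_ge0// invr_ge0 ltW.
Qed.

Lemma Skp_nice_le h C y x : -1 < x < 1 -> nice h C -> intble mu D h -> 0 < y < 1 ->
  `|Sk kp h y x| <= C * pi + `|h x| * (8 / w x).
Proof.
move=> x1 hC Ih y01; have /andP[y0 _] := y01.
rewrite Skp_split//; apply: (le_trans (ler_normD _ _)); apply: lerD; last first.
  by rewrite normrM ler_wpM2l// Skp1_le.
have [Iw <-] := int_inv_weight R; rewrite -DZl//; apply: Dle_norm.
- by apply: DI_mf; exact: (nice_intble x1 hC).
- exact: DI_Z.
- by move=> t t1; exact: nice_kernel_le.
Qed.

(* The principal value integral of h at x; that of the constant 1 is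
   ln (1 - x) - ln (1 + x). *)
Definition TL h x := \int[mu]_(t in D) ((h t - h x) * (t - x)^-1) + h x * (ln (1 - x) - ln (1 + x)).

Lemma Skp_nice_cvg h C x : -1 < x < 1 -> nice h C -> intble mu D h ->
  Sk kp h (ys n) x @[n --> \oo] --> TL h x.
Proof.
move=> x1 hC Ih; have yn n : 0 < ys n by have /andP[] := ys01 n.
under eq_fun do rewrite Skp_split//.
apply: cvgD; last first.
  apply: cvgM; first exact: cvg_cst.
  by apply: (@at_right_ys (fun y => Sk kp (fun=> 1) y x)); exact: Skp1_cvg.
have [Iw _] := int_inv_weight R.
apply: (@Rint_cvg _ _ _ mu D _ _ (fun t => C * (w t)^-1) _ _ _ _ _).2.
- exact: mD.
- by move=> n; apply: DI_mf; exact: (nice_intble x1 hC).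
- move=> t _; apply: cvgM; first exact: cvg_cst.
  by apply: (@at_right_ys (fun y => kp y (t - x))); exact: kp_cvg.
- exact: DI_Z.
- by move=> n t /inD t1; exact: nice_kernel_le.
Qed.
End Density.

(** * Partial fractions and duality for Lipschitz functions *)

Section Identities.
Context (R : realType).
Notation mu := (@lebesgue_measure R).
Notation D := (`]-1, 1[%classic : set R).
Implicit Types (f g h r k : R -> R) (x y t s a b c : R).
Local Notation w := (@weight R).
Local Notation ys := (@ys R).

(** The difference of the inverse weights is (w(t) - w(s)) / (w(s) w(t)), and [weight_diff] costs
    one more factor w(t). The bound 1/w^2 is not integrable by itself; in [duality_U] it comes
    multiplied by w. *)
Lemma inv_w_Skp_le y t : -1 < t < 1 -> 0 < y < 1 ->
  `|Sk kp (fun s => (w s)^-1) y t| <= (2 * pi + 8) / w t ^+ 2.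
Proof.
move=> t1 y01; have /andP[y0 _] := y01; have wt := weight_gt0 t1.
have [Iw piE] := int_inv_weight R.
rewrite Skp_split// mulrDl; apply: (le_trans (ler_normD _ _)); apply: lerD; last first.
  rewrite normrM gtr0_norm ?invr_gt0// expr2 invfM mulrA mulrC ler_wpM2r ?invr_ge0 ?(ltW wt)//.
  exact: Skp1_le.
rewrite -piE (_ : _ / _ = 2 / w t ^+ 2 * \int[mu]_(s in D) (w s)^-1); last ring.
rewrite -DZl//; apply: Dle_norm.
- by apply: DI_mf; apply: Skp_intble => //; apply: DI_B => //; exact: DI_C.
- exact: DI_Z.
- move=> s s1; have ws := weight_gt0 s1; rewrite normrM.
  rewrite (_ : (w s)^-1 - (w t)^-1 = (w t - w s) * ((w s)^-1 * (w t)^-1)); last first.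
    by field; rewrite !gt_eqF.
  rewrite normrM (@ger0_norm _ ((w s)^-1 * _)) ?mulr_ge0 ?invr_ge0 ?(ltW ws) ?(ltW wt)//.
  have := weight_diff t1 s1; rewrite ler_pdivlMr// => h1.
  have := kp_mul_le (s - t) y0; rewrite normrM distrC => h2.
  rewrite (_ : `|w t - w s| * ((w s)^-1 * (w t)^-1) * `|kp y (s - t)| =
      `|w t - w s| * w t * `|kp y (s - t)| * ((w t ^+ 2)^-1 * (w s)^-1)); last first.
    by field; rewrite !gt_eqF.
  rewrite (_ : 2 / _ * _ = 2 * ((w t ^+ 2)^-1 * (w s)^-1)); last ring.
  apply: ler_wpM2r; first by rewrite mulr_ge0// ?invr_ge0 ?exprn_ge0 ?ltW.
  apply: (le_trans (ler_wpM2r (normr_ge0 _) h1)); rewrite -mulrA.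
  by rewrite ler_piMr.
Qed.

Lemma Skp_inv_w_cvg t : -1 < t < 1 -> Sk kp (fun s => (w s)^-1) (ys n) t @[n --> \oo] --> (0 : R).
Proof.
move=> t1; have [Iw _] := int_inv_weight R.
have h1 := trunc_Skp_cvg0 t1 Iw (lebesgue_pt_continuous t1 Iw (inv_weight_cont t1)).
have h2 : trunc_int (fun s => (w s)^-1) t h - (trunc_int (fun s => (w s)^-1) t h -
    Sk kp (fun s => (w s)^-1) h t) @[h --> 0^'+] --> (0 : R).
  by rewrite -[X in _ --> X](subrr 0); apply: cvgB h1; exact: pv_inv_weight.
apply: (@at_right_ys _ (fun y => Sk kp (fun s => (w s)^-1) y t)).
by apply: cvg_trans h2; apply: near_eq_cvg; apply: nearW => h /=; ring.
Qed.

Lemma DI_bdw r (M : R) : measurable_fun D r -> (forall s, -1 < s < 1 -> `|r s| <= M) ->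
  intble mu D (fun s => (w s)^-1 * r s).
Proof. by move=> mr rM; have [Iw _] := int_inv_weight R; apply: DI_M rM. Qed.

Section QuotientLimit.
Variables (h r : R -> R) (t c M : R).
Hypotheses (t1 : -1 < t < 1) (mr : measurable_fun D r).
Hypothesis rM : forall s, -1 < s < 1 -> `|r s| <= M.
Hypothesis hE : forall s, -1 < s < 1 -> h s = (w s)^-1 * (c + (s - t) * r s).

Lemma mSkpQ y : 0 < y -> measurable_fun D (fun s => (s - t) * kp y (s - t) * r s).
Proof.
move=> y0; apply: measurable_funM => //; apply: measurable_funM.
  by apply: measurable_funTS; exact: measurable_funB.
by apply: measurable_funTS; apply: shift_measurable1; exact: kp_measurable.
Qed.

Lemma bSkpQ y s : 0 < y -> -1 < s < 1 -> `|(s - t) * kp y (s - t) * r s| <= M.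
Proof. by move=> y0 s1; rewrite normrM (le_trans _ (rM s1))// ler_piMl// kp_mul_le. Qed.

Lemma SkpQ y : 0 < y -> Sk kp h y t = c * Sk kp (fun s => (w s)^-1) y t +
  \int[mu]_(s in D) ((w s)^-1 * ((s - t) * kp y (s - t) * r s)).
Proof.
move=> y0; have [Iw _] := int_inv_weight R.
have I1 := Skp_intble t y0 Iw.
rewrite /Sk -DZl// -DD; [|exact: DI_Z|].
  by apply: Deq => s s1; rewrite hE//; ring.
by apply: (@DI_bdw _ M); [exact: mSkpQ|move=> s; exact: bSkpQ].
Qed.

Lemma SkpQ_le y : 0 < y < 1 -> `|Sk kp h y t| <= `|c| * ((2 * pi + 8) / w t ^+ 2) + M * pi.
Proof.
move=> y01; have /andP[y0 _] := y01; have [Iw <-] := int_inv_weight R.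
rewrite SkpQ//; apply: (le_trans (ler_normD _ _)); apply: lerD.
  by rewrite normrM ler_wpM2l//; have [_ ->] := int_inv_weight R; exact: inv_w_Skp_le.
rewrite -DZl//; apply: Dle_norm; last 1 first.
- move=> s s1; rewrite normrM mulrC (@gtr0_norm _ (w s)^-1) ?invr_gt0 ?weight_gt0//.
  by rewrite ler_wpM2r ?invr_ge0 ?weight_ge0// bSkpQ.
- by apply: DI_mf; apply: (@DI_bdw _ M); [exact: mSkpQ|move=> s; exact: bSkpQ].
- exact: DI_Z.
Qed.

(** The part [c / w] has principal value 0 at [t], and in the remainder the factor [s - t] cancels
    the singularity. *)
Lemma SkpQ_cvg : Sk kp h (ys n) t @[n --> \oo] --> \int[mu]_(s in D) ((w s)^-1 * r s).
Proof.
have yn n : 0 < ys n by have /andP[] := ys01 R n.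
have [Iw _] := int_inv_weight R.
rewrite -[\int[mu]_(s in D) _]add0r.
under eq_fun do rewrite SkpQ//.
apply: cvgD.
  by rewrite -(mulr0 c); apply: cvgM; [exact: cvg_cst|exact: Skp_inv_w_cvg].
apply: (@Rint_cvg_ae _ _ _ mu D _ _ (fun s => M * (w s)^-1)).
- exact: mD.
- by move=> n; apply: DI_mf; apply: (@DI_bdw _ M); [exact: mSkpQ|move=> s; exact: bSkpQ].
- by apply: DI_mf; exact: (@DI_bdw _ M).
(* At [s = t] the factor [(s - t) * kp] is 0 for every [n], whereas it tends to 1 elsewhere. *)
- exists [set t]; split; [exact: measurable_set1|exact: lebesgue_measure_set1|].
  move=> s /= ns; apply/eqP/negPn/negP => st; apply: ns => _.
  apply: cvgM; first exact: cvg_cst.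
  rewrite -[X in _ --> X]mul1r; apply: cvgM; last exact: cvg_cst.
  have st0 : s - t != 0 by rewrite subr_eq0.
  rewrite -(mulfV st0); apply: cvgM; first exact: cvg_cst.
  by apply: (@at_right_ys _ (fun y => kp y (s - t))); exact: kp_cvg.
- exact: DI_Z.
- move=> n s /inD s1; rewrite normrM mulrC (@gtr0_norm _ (w s)^-1) ?invr_gt0 ?weight_gt0//.
  by rewrite ler_wpM2r ?invr_ge0 ?weight_ge0// bSkpQ.
Qed.
End QuotientLimit.

Lemma lipb_le g : lipb g -> exists2 M : R, 0 <= M & forall x, `|g x| <= M.
Proof. by move=> [L [gL _]]; exists L => //; exact: le_trans (gL 0). Qed.

Lemma wg_intble g : lipb g -> intble mu D (fun t => w t * g t).
Proof.
move=> gl; apply: DI_cont => x _; apply: ctM; first exact: weight_cont.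
exact: lipb_cont.
Qed.

Lemma wg_measurable g : lipb g -> measurable_fun setT (fun t => w t * g t).
Proof. by move=> gl; apply: measurable_funM; [exact: weight_measurable|exact: lipb_measurable]. Qed.

Lemma Skp_V_bound g : lipb g -> exists2 K : R, 0 <= K &
  forall y x, -1 < x < 1 -> 0 < y < 1 -> `|Sk kp g y x| <= K * (w x)^-1.
Proof.
move=> gl; have [C gC] := nice_lip gl; have [M M0 gM] := lipb_le gl; have C0 := nice_ge0 gC.
exists (C * pi + M * 8); first by rewrite addr_ge0// mulr_ge0// pi_ge0.
move=> y x x1 y01; have wx := weight_gt0 x1.
apply: (le_trans (Skp_nice_le x1 gC (lipb_intble gl) y01)).
rewrite [leRHS]mulrDl; apply: lerD.
  by rewrite ler_peMr ?mulr_ge0 ?pi_ge0// invf_ge1 ?weight_le1.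
by rewrite -mulrA ler_wpM2r ?gM// divr_ge0// ltW.
Qed.

(** The weight in [w * g] cancels the factor 1/w in the logarithmic term of [Skp_nice_le]. Hence a
    constant bound, which remains integrable after division by [w]. *)
Lemma Skp_U_bound g : lipb g -> exists2 K : R, 0 <= K &
  forall y x, -1 < x < 1 -> 0 < y < 1 -> `|Sk kp (fun t => w t * g t) y x| <= K.
Proof.
move=> gl; have [C gC] := nice_wlip gl; have [M M0 gM] := lipb_le gl; have C0 := nice_ge0 gC.
exists (C * pi + M * 8); first by rewrite addr_ge0// mulr_ge0// pi_ge0.
move=> y x x1 y01; have wx := weight_gt0 x1.
apply: (le_trans (Skp_nice_le x1 gC (wg_intble gl) y01)).
rewrite lerD2l normrM gtr0_norm// (_ : _ * _ = `|g x| * 8); last by field; rewrite gt_eqF.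
by rewrite ler_wpM2r.
Qed.

Lemma V_cvg g x : lipb g -> -1 < x < 1 -> Sk kp g (ys n) x @[n --> \oo] --> TL g x.
Proof. by move=> gl x1; have [C gC] := nice_lip gl; apply: Skp_nice_cvg gC (lipb_intble gl). Qed.

Lemma U_cvg g x : lipb g -> -1 < x < 1 ->
  Sk kp (fun t => w t * g t) (ys n) x @[n --> \oo] --> TL (fun t => w t * g t) x.
Proof. by move=> gl x1; have [C gC] := nice_wlip gl; apply: Skp_nice_cvg gC (wg_intble gl). Qed.

Lemma V_limit g k (M : R) : lipb g -> measurable_fun D k -> (forall x, -1 < x < 1 -> `|k x| <= M) ->
  intble mu D (fun x => TL g x * k x) /\
  \int[mu]_(x in D) (Sk kp g (ys n) x * k x) @[n --> \oo] --> \int[mu]_(x in D) (TL g x * k x).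
Proof.
move=> gl mk kM; have [K K0 gK] := Skp_V_bound gl; have [Iw _] := int_inv_weight R.
have yn n : 0 < ys n by have /andP[] := ys01 R n.
apply: (@Rint_cvg _ _ _ mu D _ _ (fun x => K * (w x)^-1 * M)).
- exact: mD.
- move=> n; apply: measurable_funM => //; apply: measurable_funTS; apply: Skp_measurable => //.
  exact: lipb_intble.
- by move=> x /inD x1; apply: cvgM; [exact: V_cvg|exact: cvg_cst].
- by apply: (@DI_eq _ (fun x => M * (K * (w x)^-1))); [move=> x _; rewrite mulrC|apply: DI_Z; exact: DI_Z].
- move=> n x /inD x1; rewrite normrM ler_pM ?kM//; apply: gK => //; exact: ys01.
Qed.

Lemma U_limit g k (M : R) : lipb g -> measurable_fun D k -> (forall x, -1 < x < 1 -> `|k x| <= M) ->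
  intble mu D (fun x => TL (fun t => w t * g t) x * ((w x)^-1 * k x)) /\
  \int[mu]_(x in D) (Sk kp (fun t => w t * g t) (ys n) x * ((w x)^-1 * k x)) @[n --> \oo] -->
  \int[mu]_(x in D) (TL (fun t => w t * g t) x * ((w x)^-1 * k x)).
Proof.
move=> gl mk kM; have [K K0 gK] := Skp_U_bound gl; have [Iw _] := int_inv_weight R.
have yn n : 0 < ys n by have /andP[] := ys01 R n.
apply: (@Rint_cvg _ _ _ mu D _ _ (fun x => K * ((w x)^-1 * M))).
- exact: mD.
- move=> n; apply: measurable_funM.
    by apply: measurable_funTS; apply: Skp_measurable => //; exact: wg_intble.
  by apply: measurable_funM => //; apply: measurable_funTS; exact: inv_weight_measurable.
- by move=> x /inD x1; apply: cvgM; [exact: U_cvg|exact: cvg_cst].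
- apply: DI_Z; apply: (@DI_eq _ (fun x => M * (w x)^-1)); [by move=> x _; rewrite mulrC|exact: DI_Z].
- move=> n x /inD x1; rewrite !normrM ler_pM ?mulr_ge0//; first by apply: gK => //; exact: ys01.
  by rewrite gtr0_norm ?invr_gt0 ?weight_gt0// ler_wpM2l ?kM// invr_ge0 weight_ge0.
Qed.

Section Duality.
Variables (x y : R) (k a b : R -> R).
Hypothesis y0 : 0 < y.
Local Notation p := (fun s => kp y (s - x)).
Local Notation q := (fun s => kq y (s - x)).
Hypothesis kl : lipb k.
Hypotheses (aM : forall t, `|a t| <= y^-1) (bM : forall t, `|b t| <= y^-1).
(* Satisfied by k = p with (a, b) = (- p, q) and by k = q with (a, b) = (- q, - p). *)
Hypothesis kE : forall s t, k s - k t = (s - t) * (p s * a t + q s * b t).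
Variable g : R -> R.
Hypothesis gl : lipb g.

Lemma mp : measurable_fun setT p. Proof. by apply: shift_measurable1; exact: kp_measurable. Qed.
Lemma mq : measurable_fun setT q. Proof. by apply: shift_measurable1; exact: kq_measurable. Qed.

Lemma pqab_le s t : `|p s * a t + q s * b t| <= 2 * y ^- 2.
Proof.
have -> : 2 * y ^- 2 = y^-1 * y^-1 + y^-1 * y^-1 by rewrite -exprVn; ring.
have h1 := kp_le (s - x) y0; have h2 := kq_le (s - x) y0.
have h3 : `|kq y (s - x)| <= y^-1 by rewrite ger0_norm ?kq_ge0.
apply: (le_trans (ler_normD _ _)); apply: lerD.
  by rewrite normrM; apply: ler_pM (normr_ge0 _) (normr_ge0 _) h1 (aM t).
by rewrite normrM; apply: ler_pM (normr_ge0 _) (normr_ge0 _) h3 (bM t).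
Qed.

Lemma m_pqab t : measurable_fun setT (fun s => p s * a t + q s * b t).
Proof. by apply: measurable_funD; apply: measurable_funM => //; [exact: mp|exact: mq]. Qed.

Lemma lim_oppE (u v : nat -> R) (l m : R) : u n @[n --> \oo] --> l -> v n @[n --> \oo] --> m ->
  (forall n, u n = - v n) -> l = - m.
Proof.
move=> ul vm uv; apply: (cvg_unique _ ul) => //.
rewrite (_ : (fun n => u n) = (fun n => - v n)); last by apply/funext.
exact: cvgN.
Qed.

(** Two heights are involved: [y] is fixed and [ys n] tends to 0. At height [ys n], antisymmetry
    moves the Cauchy integral from [w g] onto [k / w]. By [kE] the latter has the form treated in
    [QuotientLimit], with [c = k t] and remainder [p * a t + q * b t], so the limit consists of
    potentials of 1/w at height [y]. *)
Lemma duality_U :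
  \int[mu]_(s in D) (TL (fun t => w t * g t) s * ((w s)^-1 * k s)) =
  - \int[mu]_(t in D) (w t * g t *
     (a t * Sk kp (fun s => (w s)^-1) y x + b t * Sk kq (fun s => (w s)^-1) y x)).
Proof.
have [Iw _] := int_inv_weight R.
have yn n : 0 < ys n by have /andP[] := ys01 R n.
have [M M0 gM] := lipb_le gl; have [Mk Mk0 kM] := lipb_le kl.
have mk := lipb_measurable kl.
have kD s : -1 < s < 1 -> `|k s| <= Mk by [].
have [_ L1] := U_limit gl (measurable_funTS mk) kD.
pose ps s := (w s)^-1 * k s.
have mps : measurable_fun setT ps by apply: measurable_funM => //; exact: inv_weight_measurable.
have Ips : intble mu D ps by apply: (@DI_bdw _ Mk) => //; exact: measurable_funTS.
have psE t s : -1 < s < 1 -> ps s = (w s)^-1 * (k t + (s - t) * (p s * a t + q s * b t)).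
  by move=> _; rewrite -kE addrC subrK.
have rM t s : -1 < s < 1 -> `|p s * a t + q s * b t| <= 2 * y ^- 2 by move=> _; exact: pqab_le.
have mr t : measurable_fun D (fun s => p s * a t + q s * b t) by apply: measurable_funTS; exact: m_pqab.
have JE t : \int[mu]_(s in D) ((w s)^-1 * (p s * a t + q s * b t)) =
    a t * Sk kp (fun s => (w s)^-1) y x + b t * Sk kq (fun s => (w s)^-1) y x.
  have I1 := Skp_intble x y0 Iw; have I2 := Skq_intble x y0 Iw.
  by rewrite /Sk -!DZl// -DD; [apply: Deq => s _; ring|exact: DI_Z|exact: DI_Z].
have cst1 : 0 <= 2 * pi + 8 :> R by rewrite addr_ge0// mulr_ge0// pi_ge0.
have L2 : \int[mu]_(t in D) (w t * g t * Sk kp ps (ys n) t) @[n --> \oo] -->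
    \int[mu]_(t in D) (w t * g t *
     (a t * Sk kp (fun s => (w s)^-1) y x + b t * Sk kq (fun s => (w s)^-1) y x)).
  apply: (@Rint_cvg _ _ _ mu D _ _ (fun t => M * (Mk * (2 * pi + 8) * (w t)^-1 + 2 * y ^- 2 * pi)) _ _ _ _ _).2.
  - exact: mD.
  - move=> n; apply: measurable_funM; first by apply: measurable_funTS; exact: wg_measurable.
    by apply: measurable_funTS; exact: Skp_measurable.
  - move=> t /inD t1; apply: cvgM; first exact: cvg_cst.
    by rewrite -JE; exact: (SkpQ_cvg t1 (mr t) (rM t) (psE t)).
  - by apply: DI_Z; apply: DI_D; [exact: DI_Z|exact: DI_C].
  (* The factor [w t] in front reduces the singularity 1/w^2 of [SkpQ_le] to the integrable 1/w. *)
  - move=> n t /inD t1; have wt := weight_gt0 t1; rewrite !normrM (gtr0_norm wt) (_ : w t * `|g t| * _ = `|g t| * (w t * `|Sk kp ps (ys n) t|)); last ring.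
    apply: ler_pM => //; first by rewrite mulr_ge0// ltW.
    have := SkpQ_le t1 (mr t) (rM t) (psE t) (ys01 R n).
    move=> /(ler_wpM2l (ltW wt)) => /le_trans; apply.
    rewrite mulrDr; apply: lerD; last first.
      apply: ler_piMl (weight_le1 t).
      by apply: mulr_ge0 (pi_ge0 _); rewrite mulr_ge0// invr_ge0 exprn_ge0// ltW.
    rewrite (_ : w t * _ = `|k t| * (2 * pi + 8) * (w t)^-1); last by field; rewrite gt_eqF.
    by rewrite ler_wpM2r ?invr_ge0 ?(ltW wt)// ler_wpM2r.
apply: (lim_oppE L1 L2) => n.
exact: (Skp_antisym (yn n) (wg_measurable gl) mps (wg_intble gl) Ips).
Qed.

(** As in [duality_U], with [w k] written as (1/w)(1 - s^2) k. The splitting 1 - s^2 = (1 - t^2) -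
    (s - t)(s + t) adds - (s + t) k(t) to the remainder; its integral against 1/w is the term with
    factor [pi * t] plus the first moment of 1/w. *)
Lemma duality_V :
  \int[mu]_(s in D) (TL g s * (w s * k s)) =
  - \int[mu]_(t in D) (g t * (a t * Sk kp w y x + b t * Sk kq w y x -
      (\int[mu]_(s in D) ((w s)^-1 * s) + pi * t) * k t)).
Proof.
have [Iw piE] := int_inv_weight R.
have yn n : 0 < ys n by have /andP[] := ys01 R n.
have [M M0 gM] := lipb_le gl; have [Mk Mk0 kM] := lipb_le kl.
have mk := lipb_measurable kl.
have mw := @weight_measurable R.
have mwk : measurable_fun setT (fun s => w s * k s) by exact: measurable_funM.
have wkM s : -1 < s < 1 -> `|w s * k s| <= Mk.
  by move=> _; rewrite normrM -[leRHS]mul1r ler_pM// ger0_norm ?weight_ge0// weight_le1.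
have [_ L1] := V_limit gl (measurable_funTS mwk) wkM.
have [C wkC] := nice_wlip kl; have Iwk := wg_intble kl.
have Iwp : intble mu D w by apply: DI_cont => s _; exact: weight_cont.
have sM s : -1 < s < 1 -> `|s| <= 1 by move=> /andP[? ?]; rewrite ler_norml; apply/andP; split; lra.
have Isw : intble mu D (fun s => (w s)^-1 * s) by apply: (@DI_bdw _ 1).
have TLE t : -1 < t < 1 -> TL (fun s => w s * k s) t =
    a t * Sk kp w y x + b t * Sk kq w y x - (\int[mu]_(s in D) ((w s)^-1 * s) + pi * t) * k t.
  move=> t1; pose r s := (1 - s ^+ 2) * (p s * a t + q s * b t) - (s + t) * k t.
  have mr : measurable_fun D r.
    apply: measurable_funTS; apply: measurable_funB.
      apply: measurable_funM; last exact: m_pqab.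
      by apply: measurable_funB => //; exact: measurable_funX.
    by apply: measurable_funM => //; exact: measurable_funD.
  have rM s : -1 < s < 1 -> `|r s| <= 2 * y ^- 2 + 2 * Mk.
    move=> s1; rewrite (le_trans (ler_normB _ _))// lerD//.
      rewrite normrM -[leRHS]mul1r ler_pM ?pqab_le//.
      by have /andP[s2 s3] := s1; rewrite ler_norml; apply/andP; split; nra.
    rewrite normrM ler_pM// (le_trans (ler_normD _ _))//.
    by have := sM _ s1; have := sM _ t1; lra.
  have rE s : -1 < s < 1 -> w s * k s = (w s)^-1 * ((1 - t ^+ 2) * k t + (s - t) * r s).
    move=> s1; have ws := weight_gt0 s1; have /andP[s2 s3] := s1.
    have -> : (1 - t ^+ 2) * k t + (s - t) * r s = (1 - s ^+ 2) * k s.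
      rewrite /r mulrBr mulrCA -kE; ring.
    by rewrite -weight_sqr ?(ltW s2) ?(ltW s3)//; field; rewrite gt_eqF.
  have -> : TL (fun s => w s * k s) t = \int[mu]_(s in D) ((w s)^-1 * r s).
    exact: (cvg_unique _ (Skp_nice_cvg t1 wkC Iwk) (SkpQ_cvg t1 mr rM rE)).
  have I1 := Skp_intble x y0 Iwp; have I2 := Skq_intble x y0 Iwp.
  have I3 : intble mu D (fun s => (w s)^-1 * s + t * (w s)^-1) by apply: DI_D => //; exact: DI_Z.
  have -> : \int[mu]_(s in D) ((w s)^-1 * s) + pi * t = \int[mu]_(s in D) ((w s)^-1 * s + t * (w s)^-1).
    by rewrite DD//; [rewrite DZl// piE mulrC|exact: DI_Z].
  rewrite -DZr// /Sk -!DZl// -DD; [|exact: DI_Z|exact: DI_Z].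
  rewrite -DB; [|by apply: DI_D; exact: DI_Z|].
    apply: Deq => s s1; have ws := weight_gt0 s1; have /andP[s2 s3] := s1.
    have w2 : w s ^+ 2 = 1 - s ^+ 2 by rewrite weight_sqr// ?(ltW s2) ?(ltW s3).
    by rewrite /r -w2; field; rewrite gt_eqF.
  by apply: (@DI_eq _ (fun s => k t * ((w s)^-1 * s + t * (w s)^-1))); [move=> s _; ring|exact: DI_Z].
have L2 : \int[mu]_(t in D) (g t * Sk kp (fun s => w s * k s) (ys n) t) @[n --> \oo] -->
    \int[mu]_(t in D) (g t * (a t * Sk kp w y x + b t * Sk kq w y x -
      (\int[mu]_(s in D) ((w s)^-1 * s) + pi * t) * k t)).
  have [K K0 KM] := Skp_U_bound kl.
  apply: (@Rint_cvg _ _ _ mu D _ _ (fun t => M * K) _ _ _ _ _).2.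
  - exact: mD.
  - move=> n; apply: measurable_funM; first by apply: measurable_funTS; exact: lipb_measurable.
    by apply: measurable_funTS; exact: Skp_measurable.
  - move=> t /inD t1; apply: cvgM; first exact: cvg_cst.
    by rewrite -TLE//; exact: U_cvg.
  - exact: DI_C.
  - by move=> n t /inD t1; rewrite normrM ler_pM// KM// ys01.
apply: (lim_oppE L1 L2) => n.
exact: (Skp_antisym (yn n) (lipb_measurable gl) mwk (lipb_intble gl) Iwk).
Qed.
End Duality.
End Identities.

(** * Completeness of L^1 for geometrically convergent sequences *)

Section FastLimits.
Context (R : realType).
Notation mu := (@lebesgue_measure R).
Notation D := (`]-1, 1[%classic : set R).
Implicit Types (f g h r k : R -> R) (x y t s a b c : R).

(** The argument of Riesz and Fischer: by monotone convergence the sum [G] of the absolute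
    increments is integrable, hence finite almost everywhere, and there it dominates the
    convergence. *)
Lemma L1_fast_limit (F : nat -> R -> R) (C : R) :
  (forall n, intble mu D (F n)) ->
  (forall n, \int[mu]_(x in D) `|F n.+1 x - F n x| <= C / 2 ^+ n) ->
  exists V : R -> R, intble mu D V /\
  \int[mu]_(x in D) `|F n x - V x| @[n --> \oo] --> (0 : R).
Proof.
move=> IF FC.
pose S n x := \sum_(0 <= k < n) `|F k.+1 x - F k x|.
have IFd n : intble mu D (fun x => `|F n.+1 x - F n x|) by apply: DI_norm; exact: DI_B.
have S_int n : intble mu D (S n) /\ \int[mu]_(x in D) S n x <= C * 2 - C * 2 / 2 ^+ n.
  elim: n => [|n [IH1 IH2]].
    have S0 : S 0 = fun=> 0 by apply/funext => x; rewrite /S big_nil.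
    rewrite S0; split; first exact: DI_C.
    by rewrite Rintegral_cst ?mul0r ?expr0 ?divr1 ?subrr//; exact: mD.
  have SS : S n.+1 = fun x => S n x + `|F n.+1 x - F n x|.
    by apply/funext => x; rewrite /S big_nat_recr.
  rewrite SS; split; first exact: (DI_D IH1 (IFd n)).
  rewrite (DD IH1 (IFd n)).
  apply: (le_trans (lerD IH2 (FC n))); rewrite le_eqVlt; apply/orP; left; apply/eqP.
  by rewrite exprS; field; rewrite expf_neq0.
have C0 : 0 <= C.
  by have := FC 0; rewrite expr0 divr1; apply: le_trans; apply: Rintegral_ge0.
have S_ge0 n x : 0 <= S n x by exact: sumr_ge0.
have S_nd x : nondecreasing_seq (fun n => S n x).
  by apply/nondecreasing_seqP => n; rewrite /S big_nat_recr//= lerDl; exact: normr_ge0.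
have SE_nd x : nondecreasing_seq (fun n => (S n x)%:E).
  by move=> n m nm; rewrite lee_fin; exact: S_nd.
pose G (x : R) : \bar R := limn (fun n => (S n x)%:E).
have G_cvg x : (S n x)%:E @[n --> \oo] --> G x by exact: ereal_nondecreasing_is_cvgn.
have S_le_G n x : ((S n x)%:E <= G x)%E.
  rewrite /G (cvg_lim _ (ereal_nondecreasing_cvgn (SE_nd x)))//.
  by apply: ereal_sup_ubound; exists n.
have mSE n : measurable_fun D (fun x => (S n x)%:E).
  by apply/measurable_EFinP; have [/DI_mf] := S_int n.
have mG : measurable_fun D G.
  by apply: (@emeasurable_fun_cvg _ _ _ D (fun n x => (S n x)%:E)) => // x _; exact: G_cvg.
have G_ge0 x : (0 <= G x)%E by apply: (le_trans _ (S_le_G 0 x)); rewrite lee_fin.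
have int_G : (\int[mu]_(x in D) G x <= (C * 2)%:E)%E.
  rewrite (@monotone_convergence _ _ _ mu D (@mD R) (fun n x => (S n x)%:E))//; last by move=> n x _; rewrite lee_fin.
  apply: lime_le.
    apply: ereal_nondecreasing_is_cvgn => n m nm; apply: ge0_le_integral;
      first [exact: mD|exact: mSE|by move=> x _; rewrite lee_fin|by move=> x _; exact: SE_nd].
  apply: nearW => n; have [IS SC] := S_int n.
  by rewrite RintE// lee_fin (le_trans SC)// gerBl divr_ge0// ?mulr_ge0// exprn_ge0.
have IG : mu.-integrable D G.
  apply/integrableP; split; first exact: mG.
  apply: (@le_lt_trans _ _ (C * 2)%:E); last by rewrite ltry.
  apply: le_trans int_G; rewrite le_eqVlt; apply/orP; left; apply/eqP.
  by apply: eq_integral => x _; rewrite gee0_abs.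
pose E := D `&` [set x | G x \is a fin_num].
have mE : measurable E by apply: emeasurable_fin_num => //; exact: mD.
pose g x := fine ((G \_ E) x).
have Ig : intble mu D g.
  apply: (@le_integrable _ _ _ mu D (@mD R) (EFin \o g) G _ _ IG) => //.
    rewrite (_ : EFin \o g = G \_ E); last first.
      by apply/funext => x; rewrite /g /patch /=; case: ifPn => [/set_mem[_ Gx]|//]; rewrite fineK.
    have mGE : measurable_fun E G by apply: measurable_funS mG => // x [].
    by apply: measurable_funTS; exact: (measurable_restrictT _ mE).1 mGE.
  move=> x _; rewrite /comp /g /patch; case: ifPn => [/set_mem[_ Gx]|_]; first by rewrite fineK.
  by rewrite fine0 abse0.
have ae_E : {ae mu, forall x, D x -> E x}.
  have H := @integrable_ae _ _ _ mu D (@mD R) G IG.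
  by apply: negligibleS H => x /= nE h; apply: nE => Dx; split => //; exact: h.
(* Set to 0 where [G] is infinite, the sequence converges at every point, so its limit is measurable
   without further argument. *)
pose Fp n := (F n) \_ E.
have mFp n : measurable_fun D (Fp n).
  have mFD := DI_mf (IF n).
  have mFE : measurable_fun E (F n) by apply: measurable_funS mFD => // x [].
  by apply: measurable_funTS; exact: (measurable_restrictT _ mE).1 mFE.
have Fp_diff n m x : (n <= m)%N -> `|Fp m x - Fp n x| <= g x.
  move=> nm; rewrite /Fp /g /patch; case: ifPn => [/set_mem[_ Gx]|_]; last by rewrite subrr normr0.
  have Sg j : S j x <= fine (G x) by rewrite -lee_fin fineK.
  apply: (le_trans _ (Sg m)).
  rewrite -(telescope_sumr (F ^~ x) nm); apply: (le_trans (ler_norm_sum _ _ _)).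
  by rewrite /S [leRHS](@big_cat_nat _ _ _ n)//= lerDr; exact: sumr_ge0.
have Fp_cvg x : cvgn (Fp ^~ x).
  have [xE|xE] := boolP (x \in E); last first.
    rewrite (_ : Fp ^~ x = fun=> 0); first exact: is_cvg_cst.
    by apply/funext => n; rewrite /Fp /patch (negbTE xE).
  have [_ Gx] := set_mem xE.
  rewrite (_ : Fp ^~ x = fun n => F n x); last by apply/funext => n; rewrite /Fp /patch xE.
  have h : cvgn [normed series (telescope (F ^~ x))].
    apply: nondecreasing_is_cvgn; first exact: S_nd.
    by exists (fine (G x)) => _ [n _ <-]; rewrite -lee_fin fineK//; exact: S_le_G.
  have := normed_cvg h; rewrite telescopeK => h2.
  rewrite (_ : (fun n => F n x) = (fun n => F n x - F 0 x + F 0 x)); last first.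
    by apply/funext => n; rewrite subrK.
  by apply: is_cvgD => //; exact: is_cvg_cst.
pose V x := limn (Fp ^~ x).
have IFp n : intble mu D (Fp n).
  apply: (@DI_le _ _ (fun x => `|F n x|)) => //; last exact: DI_norm.
  by move=> x _; rewrite /Fp /patch; case: ifP; rewrite ?normr0.
have [IV _] : intble mu D V /\ \int[mu]_(x in D) Fp n x @[n --> \oo] --> \int[mu]_(x in D) V x.
  apply: (@Rint_cvg _ _ _ mu D _ _ (fun x => `|Fp 0 x| + g x)) => //.
  - by apply: DI_D => //; apply: DI_norm; exact: IFp.
  - move=> n x _; rewrite -{1}(subrK (Fp 0 x) (Fp n x)) addrC (le_trans (ler_normD _ _))//.
    by rewrite lerD2l Fp_diff.
have mV := DI_mf IV.
exists V; split=> //.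
have H : \int[mu]_(x in D) `|Fp n x - V x| @[n --> \oo] --> \int[mu]_(x in D) (0 : R).
  apply: (@Rint_cvg _ _ _ mu D _ _ g _ _ _ _ _).2 => //.
  - by move=> n; apply: DI_mf; apply: DI_norm; exact: DI_B.
  - move=> x _; rewrite -(@normr0 _ R) -(subrr (V x)); apply: cvg_norm; apply: cvgB; last exact: cvg_cst.
    exact: Fp_cvg.
  - move=> n x _; rewrite normr_id distrC.
    apply: (cvgr_to_le (f := fun m => `|Fp m x - Fp n x|) (F := \oo)).
      by apply: cvg_norm; apply: cvgB; [exact: Fp_cvg|exact: cvg_cst].
    by exists n => // m /= nm; exact: Fp_diff.
rewrite Rintegral_cst ?mul0r in H; last exact: mD.
rewrite (_ : (fun n => \int[mu]_(x in D) `|F n x - V x|) = (fun n => \int[mu]_(x in D) `|Fp n x - V x|))//.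
apply/funext => n; rewrite /Rintegral; congr fine; apply: ae_eq_integral => //.
- by apply/measurable_EFinP; apply: DI_mf; apply: DI_norm; exact: DI_B.
- by apply/measurable_EFinP; apply: DI_mf; apply: DI_norm; exact: DI_B.
- by apply: ae_imp ae_E => x xE Dx; rewrite /Fp /patch mem_set//; exact: xE.
Qed.
End FastLimits.

(** * The Cauchy integral identities and their passage to the limit *)

Section LimitIdentities.
Context (R : realType).
Notation mu := (@lebesgue_measure R).
Notation D := (`]-1, 1[%classic : set R).
Implicit Types (f g h r k U V : R -> R) (x y t s a b c : R).
Local Notation w := (@weight R).
Local Notation iw := (fun s => (w s)^-1).
Local Notation B0 := (\int[mu]_(s in D) ((w s)^-1 * s)).

(* C(w V)(z) = (C w(z) + pi z + B0) * C f(z) + pi * int f. *)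
Definition V_identities f V := forall x y, 0 < y ->
  Sk kq (fun s => w s * V s) y x =
    (Sk kp w y x + pi * x + B0) * Sk kq f y x + (Sk kq w y x + pi * y) * Sk kp f y x /\
  Sk kp (fun s => w s * V s) y x =
    - (Sk kq w y x * Sk kq f y x) + (Sk kp w y x + pi * x + B0) * Sk kp f y x +
    pi * \int[mu]_(t in D) f t - pi * y * Sk kq f y x.

(* C U(z) = C(1/w)(z) * C(w f)(z). *)
Definition U_identities f U := forall x y, 0 < y ->
  Sk kp U y x = Sk kp iw y x * Sk kp (fun t => w t * f t) y x -
                Sk kq iw y x * Sk kq (fun t => w t * f t) y x /\
  Sk kq U y x = Sk kp iw y x * Sk kq (fun t => w t * f t) y x +
                Sk kq iw y x * Sk kp (fun t => w t * f t) y x.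

Lemma lipb_der (f df : R -> R) (M K : R) : (forall u : R, is_derive u 1 f (df u)) ->
  (forall u, `|f u| <= M) -> (forall u, `|df u| <= K) -> lipb f.
Proof.
move=> der fM dK.
have M0 : 0 <= M by apply: le_trans (fM 0).
have K0 : 0 <= K by apply: le_trans (dK 0).
have b3 a b : a <= b -> `|f b - f a| <= K * `|b - a|.
  move=> ab; have [|c _ ->] := @MVT_segment _ f df _ _ ab.
  - by apply: continuous_subspaceT => x; exact: der_cont (der x).
  - by rewrite normrM ler_wpM2r.
exists (M + K); split=> [x|t x]; first by rewrite (le_trans (fM x))// lerDl.
rewrite mulrDl ler_wpDl ?mulr_ge0//.
by have [|/ltW] := leP x t => /b3//; rewrite distrC (distrC x).
Qed.

Lemma lipb_shift f x : lipb f -> lipb (fun t => f (t - x)).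
Proof.
move=> [L [fM fL]]; exists L; split=> // t s; apply: (le_trans (fL _ _)).
by rewrite (_ : t - x - (s - x) = t - s)//; ring.
Qed.

Lemma lipb_kp y x : 0 < y -> lipb (fun t => kp y (t - x)).
Proof.
move=> y0; apply: (@lipb_shift (kp y)); apply: (@lipb_der _ (fun u => - ka y u) y^-1 (y ^- 2)).
- by move=> u; exact: der_kp_u.
- by move=> u; exact: kp_le.
- by move=> u; rewrite normrN; exact: ka_le.
Qed.

Lemma lipb_kq y x : 0 < y -> lipb (fun t => kq y (t - x)).
Proof.
move=> y0; apply: (@lipb_shift (kq y)); apply: (@lipb_der _ (fun u => - kb y u) y^-1 (y ^- 2)).
- by move=> u; exact: der_kq_u.
- by move=> u; rewrite ger0_norm ?kq_ge0// kq_le.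
- by move=> u; rewrite normrN; exact: kb_le.
Qed.

(** Real part of 1/z - 1/z' = - (z - z') / (z z') for z = u + iy and z' = v + iy; [kq_diff] is the
    imaginary part. These are the two instances of [kE]. *)
Lemma kp_diff y (u v : R) : 0 < y ->
  kp y u - kp y v = (u - v) * (kp y u * - kp y v + kq y u * kq y v).
Proof.
by move=> y0; have := sqD_neq0 u y0; have := sqD_neq0 v y0; rewrite /kp /kq => v0 u0; field; rewrite v0.
Qed.

Lemma kq_diff y (u v : R) : 0 < y ->
  kq y u - kq y v = (u - v) * (kp y u * - kq y v + kq y u * - kp y v).
Proof.
by move=> y0; have := sqD_neq0 u y0; have := sqD_neq0 v y0; rewrite /kp /kq => v0 u0; field; rewrite v0.
Qed.

Lemma kq_nle y (u : R) : 0 < y -> `|kq y u| <= y^-1.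
Proof. by move=> y0; rewrite ger0_norm ?kq_ge0// kq_le. Qed.

(** Real part of t / (t - z) = 1 + z / (t - z) with z = x + iy; [mul_kq] is the imaginary part. The
    1 is the origin of the term with the integral of f in [V_identities]. *)
Lemma mul_kp y x t : 0 < y -> t * kp y (t - x) = 1 - y * kq y (t - x) + x * kp y (t - x).
Proof. by move=> y0; have := sqD_neq0 (t - x) y0; rewrite /kp /kq => v0; field. Qed.

Lemma mul_kq y x t : 0 < y -> t * kq y (t - x) = y * kp y (t - x) + x * kq y (t - x).
Proof. by move=> y0; have := sqD_neq0 (t - x) y0; rewrite /kp /kq => v0; field. Qed.

Lemma Rint_lin4 (f1 f2 f3 f4 : R -> R) (c1 c2 c3 c4 : R) :
  intble mu D f1 -> intble mu D f2 -> intble mu D f3 -> intble mu D f4 ->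
  \int[mu]_(t in D) (c1 * f1 t + c2 * f2 t + c3 * f3 t + c4 * f4 t) =
  c1 * \int[mu]_(t in D) f1 t + c2 * \int[mu]_(t in D) f2 t +
  c3 * \int[mu]_(t in D) f3 t + c4 * \int[mu]_(t in D) f4 t.
Proof.
move=> I1 I2 I3 I4.
have J1 := DI_Z c1 I1; have J2 := DI_Z c2 I2; have J3 := DI_Z c3 I3; have J4 := DI_Z c4 I4.
rewrite DD//; last by apply: DI_D => //; exact: DI_D.
by rewrite DD//; [rewrite DD// !DZl|exact: DI_D].
Qed.

Lemma V_identities_lipb g : lipb g -> V_identities g (TL g).
Proof.
move=> gl x y y0; have Ig := lipb_intble gl.
have Ip := Skp_intble x y0 Ig; have Iq := Skq_intble x y0 Ig.
set Ap := Sk kp w y x; set Aq := Sk kq w y x.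
split.
  have E := @duality_V _ x y (fun t => kq y (t - x)) (fun t => - kq y (t - x)) (fun t => - kp y (t - x)) y0 (lipb_kq x y0).
  transitivity (\int[mu]_(s in D) (TL g s * (w s * kq y (s - x)))).
    by apply: Deq => s _; ring.
  rewrite E//; first last.
  - by move=> s t; rewrite kq_diff//; congr (_ * _); ring.
  - by move=> t; rewrite normrN; exact: kp_le.
  - by move=> t; rewrite normrN; exact: kq_nle.
  rewrite -/Ap -/Aq -[LHS]mulN1r -[LHS]DZl.
    rewrite (@Deq _ _ (fun t => (Ap + pi * x + B0) * (g t * kq y (t - x)) + (Aq + pi * y) * (g t * kp y (t - x)) + 0 * 0 + 0 * 0)).
      rewrite (@Rint_lin4 _ _ (fun=> 0) (fun=> 0))//; [by rewrite /Sk; ring|exact: DI_C|exact: DI_C].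
    move=> t _; rewrite (_ : (B0 + pi * t) * kq y (t - x) = B0 * kq y (t - x) + pi * (t * kq y (t - x))); last ring.
    by rewrite mul_kq//; ring.
  apply: (@DI_eq _ (fun t => - ((Ap + pi * x + B0) * (g t * kq y (t - x)) + (Aq + pi * y) * (g t * kp y (t - x))))).
    move=> t _; rewrite (_ : (B0 + pi * t) * kq y (t - x) = B0 * kq y (t - x) + pi * (t * kq y (t - x))); last ring.
    by rewrite mul_kq//; ring.
  by apply: DI_N; apply: DI_D; exact: DI_Z.
have E := @duality_V _ x y (fun t => kp y (t - x)) (fun t => - kp y (t - x)) (fun t => kq y (t - x)) y0 (lipb_kp x y0).
transitivity (\int[mu]_(s in D) (TL g s * (w s * kp y (s - x)))).
  by apply: Deq => s _; ring.
rewrite E//; first last.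
- by move=> s t; rewrite kp_diff//; congr (_ * _); ring.
- by move=> t; exact: kq_nle.
- by move=> t; rewrite normrN; exact: kp_le.
rewrite -/Ap -/Aq -[LHS]mulN1r -[LHS]DZl.
  rewrite (@Deq _ _ (fun t => (Ap + pi * x + B0) * (g t * kp y (t - x)) + (- Aq) * (g t * kq y (t - x)) + pi * g t + (- (pi * y)) * (g t * kq y (t - x)))).
    by rewrite Rint_lin4// /Sk; ring.
  move=> t _; rewrite (_ : (B0 + pi * t) * kp y (t - x) = B0 * kp y (t - x) + pi * (t * kp y (t - x))); last ring.
  by rewrite mul_kp//; ring.
apply: (@DI_eq _ (fun t => - ((Ap + pi * x + B0) * (g t * kp y (t - x)) + (- Aq) * (g t * kq y (t - x)) + pi * g t + (- (pi * y)) * (g t * kq y (t - x))))).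
  move=> t _; rewrite (_ : (B0 + pi * t) * kp y (t - x) = B0 * kp y (t - x) + pi * (t * kp y (t - x))); last ring.
  by rewrite mul_kp//; ring.
by apply: DI_N; apply: DI_D; [apply: DI_D; [apply: DI_D|]|]; exact: DI_Z.
Qed.

Lemma U_identities_lipb g : lipb g -> U_identities g (fun s => TL (fun t => w t * g t) s / w s).
Proof.
move=> gl x y y0; have Ig := wg_intble gl.
have Ip := Skp_intble x y0 Ig; have Iq := Skq_intble x y0 Ig.
set Ap := Sk kp iw y x; set Aq := Sk kq iw y x.
split.
  have E := @duality_U _ x y (fun t => kp y (t - x)) (fun t => - kp y (t - x)) (fun t => kq y (t - x)) y0 (lipb_kp x y0).
  transitivity (\int[mu]_(s in D) (TL (fun t => w t * g t) s * ((w s)^-1 * kp y (s - x)))).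
    by apply: Deq => s _; ring.
  rewrite E//; first last.
  - by move=> s t; rewrite kp_diff//; congr (_ * _); ring.
  - by move=> t; exact: kq_nle.
  - by move=> t; rewrite normrN; exact: kp_le.
  rewrite -/Ap -/Aq.
  rewrite (@Deq _ _ (fun t => (- Ap) * (w t * g t * kp y (t - x)) + Aq * (w t * g t * kq y (t - x)) + 0 * 0 + 0 * 0)); last by move=> t _; ring.
  rewrite (@Rint_lin4 _ _ (fun=> 0) (fun=> 0))//; [by rewrite /Sk; ring|exact: DI_C|exact: DI_C].
have E := @duality_U _ x y (fun t => kq y (t - x)) (fun t => - kq y (t - x)) (fun t => - kp y (t - x)) y0 (lipb_kq x y0).
transitivity (\int[mu]_(s in D) (TL (fun t => w t * g t) s * ((w s)^-1 * kq y (s - x)))).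
  by apply: Deq => s _; ring.
rewrite E//; first last.
- by move=> s t; rewrite kq_diff//; congr (_ * _); ring.
- by move=> t; rewrite normrN; exact: kp_le.
- by move=> t; rewrite normrN; exact: kq_nle.
rewrite -/Ap -/Aq.
rewrite (@Deq _ _ (fun t => (- Ap) * (w t * g t * kq y (t - x)) + (- Aq) * (w t * g t * kp y (t - x)) + 0 * 0 + 0 * 0)); last by move=> t _; ring.
by rewrite (@Rint_lin4 _ _ (fun=> 0) (fun=> 0))//; [rewrite /Sk; ring|exact: DI_C|exact: DI_C].
Qed.

Definition L1cvg (F : nat -> R -> R) V := [/\ forall n, intble mu D (F n), intble mu D V &
  \int[mu]_(x in D) `|F n x - V x| @[n --> \oo] --> (0 : R)].

Lemma L1cvg_pair F V (k : R -> R) (M : R) : L1cvg F V -> measurable_fun D k ->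
  (forall x, -1 < x < 1 -> `|k x| <= M) ->
  \int[mu]_(x in D) (F n x * k x) @[n --> \oo] --> \int[mu]_(x in D) (V x * k x).
Proof.
move=> [IF IV FV] mk kM.
have H : M * \int[mu]_(x in D) `|F n x - V x| @[n --> \oo] --> (0 : R).
  by rewrite -(mulr0 M); apply: cvgM FV; exact: cvg_cst.
apply/cvgrPdist_le => e e0; move/cvgrPdist_le : H => /(_ _ e0); apply: filterS => n.
rewrite sub0r normrN distrC => /(le_trans (ler_norm _)); apply: le_trans.
have I1 := DI_M (IF n) mk kM; have I2 := DI_M IV mk kM.
have I3 : intble mu D (fun x => `|F n x - V x|) by apply: DI_norm; exact: DI_B.
rewrite -DB// -DZl//; apply: Dle_norm; [by apply: DI_mf; exact: DI_B|exact: DI_Z|].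
by move=> x x1; rewrite -mulrBl normrM mulrC ler_wpM2r// kM.
Qed.

Lemma L1cvg_M F V (k : R -> R) (M : R) : L1cvg F V -> measurable_fun D k ->
  (forall x, -1 < x < 1 -> `|k x| <= M) -> L1cvg (fun n x => k x * F n x) (fun x => k x * V x).
Proof.
move=> FV mk kM; have [IF IV cFV] := FV.
have I f : intble mu D f -> intble mu D (fun x => k x * f x).
  by move=> If; apply: DI_eq (DI_M If mk kM) => x _; rewrite mulrC.
split; [by move=> n; exact: I|exact: I|].
have mk' : measurable_fun D (fun x => `|k x|) by exact: measurableT_comp.
have N : L1cvg (fun n x => `|F n x - V x|) (fun=> 0).
  split; [by move=> n; apply: DI_norm; exact: DI_B|exact: DI_C|].
  rewrite (_ : (fun n => _) = fun n => \int[mu]_(x in D) `|F n x - V x|)//.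
  by apply/funext => n; apply: Deq => x _; rewrite subr0 normr_id.
have kM' x : -1 < x < 1 -> `| `|k x| | <= M by rewrite normr_id; exact: kM.
have H := L1cvg_pair N mk' kM'.
have E2 : \int[mu]_(x in D) (0 * `|k x|) = 0.
  rewrite (@Deq _ _ (fun=> 0)) => [|x _]; last by rewrite mul0r.
  by rewrite Rintegral_cst ?mul0r//; exact: mD.
rewrite E2 in H.
rewrite (_ : (fun n => _) = fun n => \int[mu]_(x in D) (`|F n x - V x| * `|k x|))//.
by apply/funext => n; apply: Deq => x _; rewrite -mulrBr normrM mulrC.
Qed.

Lemma L1cvg_Skp F V y x : 0 < y -> L1cvg F V -> Sk kp (F n) y x @[n --> \oo] --> Sk kp V y x.
Proof.
move=> y0 FV; apply: (L1cvg_pair (M := y^-1) FV).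
  by apply: measurable_funTS; apply: shift_measurable1; exact: kp_measurable.
by move=> t _; exact: kp_le.
Qed.

Lemma L1cvg_Skq F V y x : 0 < y -> L1cvg F V -> Sk kq (F n) y x @[n --> \oo] --> Sk kq V y x.
Proof.
move=> y0 FV; apply: (L1cvg_pair (M := y^-1) FV).
  by apply: measurable_funTS; apply: shift_measurable1; exact: kq_measurable.
by move=> t _; exact: kq_nle.
Qed.

Lemma L1cvg_int F V : L1cvg F V -> \int[mu]_(t in D) F n t @[n --> \oo] --> \int[mu]_(t in D) V t.
Proof.
move=> FV; have mk : measurable_fun D (fun=> 1 : R) by exact: measurable_cst.
have kM x : -1 < x < 1 -> `|1 : R| <= 1 by rewrite normr1.
have H := L1cvg_pair FV mk kM.
have E f : \int[mu]_(x in D) (f x * 1) = \int[mu]_(x in D) f x by apply: Deq => x _; rewrite mulr1.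
by rewrite E (_ : (fun n => _) = fun n => \int[mu]_(x in D) F n x) in H => //; apply/funext => n; exact: E.
Qed.

Lemma weight_norm_le1 x : `|w x| <= 1.
Proof. by rewrite ger0_norm ?weight_ge0// weight_le1. Qed.

Lemma lim_eqE (u v : nat -> R) (l m : R) : u n @[n --> \oo] --> l -> v n @[n --> \oo] --> m ->
  (forall n, u n = v n) -> l = m.
Proof. by move=> ul vm uv; apply: (cvg_unique _ ul) => //; rewrite (funext uv). Qed.

(** At fixed height the kernels are bounded by [y^-1], so every term is continuous for convergence
    in L^1. *)
Lemma V_identities_limit F f G V : L1cvg F f -> L1cvg G V ->
  (forall n, V_identities (F n) (G n)) -> V_identities f V.
Proof.
move=> Ff GV H x y y0.
have mw : measurable_fun D w by apply: measurable_funTS; exact: weight_measurable.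
have wGV := L1cvg_M GV mw (fun x _ => weight_norm_le1 x).
have fp := L1cvg_Skp (x := x) y0 Ff; have fq := L1cvg_Skq (x := x) y0 Ff; have fi := L1cvg_int Ff.
split.
  apply: (lim_eqE (L1cvg_Skq (x := x) y0 wGV) _ (fun n => (H n x y y0).1)).
  by apply: cvgD; apply: cvgM => //; exact: cvg_cst.
apply: (lim_eqE (L1cvg_Skp (x := x) y0 wGV) _ (fun n => (H n x y y0).2)).
apply: cvgB; last by apply: cvgM => //; exact: cvg_cst.
apply: cvgD; last by apply: cvgM => //; exact: cvg_cst.
apply: cvgD; last by apply: cvgM => //; exact: cvg_cst.
by apply: cvgN; apply: cvgM => //; exact: cvg_cst.
Qed.

Lemma U_identities_limit F f G U : L1cvg F f -> L1cvg G U ->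
  (forall n, U_identities (F n) (G n)) -> U_identities f U.
Proof.
move=> Ff GU H x y y0.
have mw : measurable_fun D w by apply: measurable_funTS; exact: weight_measurable.
have wF := L1cvg_M Ff mw (fun x _ => weight_norm_le1 x).
have fp := L1cvg_Skp (x := x) y0 wF; have fq := L1cvg_Skq (x := x) y0 wF.
split.
  apply: (lim_eqE (L1cvg_Skp (x := x) y0 GU) _ (fun n => (H n x y y0).1)).
  by apply: cvgB; apply: cvgM => //; exact: cvg_cst.
apply: (lim_eqE (L1cvg_Skq (x := x) y0 GU) _ (fun n => (H n x y y0).2)).
by apply: cvgD; apply: cvgM => //; exact: cvg_cst.
Qed.
End LimitIdentities.

(** * Inversion formulas for real functions *)

Section RealHilbert.
Context (R : realType).
Notation mu := (@lebesgue_measure R).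
Notation D := (`]-1, 1[%classic : set R).
Implicit Types (f g h U V : R -> R) (x y t s N : R).
Local Notation w := (@weight R).
Local Notation ys := (@ys R).
Local Notation iw := (fun s => (w s)^-1).
Local Notation B0 := (\int[mu]_(s in D) ((w s)^-1 * s)).

Lemma SkpB f g y x : 0 < y -> intble mu D f -> intble mu D g ->
  Sk kp (fun t => f t - g t) y x = Sk kp f y x - Sk kp g y x.
Proof.
by move=> y0 If Ig; rewrite /Sk -DB; [apply: Deq => t _; ring|exact: Skp_intble|exact: Skp_intble].
Qed.

Lemma TL_B f g x : lipb f -> lipb g -> -1 < x < 1 -> TL (fun t => f t - g t) x = TL f x - TL g x.
Proof.
move=> fl gl x1; have yn n : 0 < ys n by have /andP[] := ys01 R n.
apply: (lim_eqE (V_cvg (lipbB fl gl) x1) (cvgB (V_cvg fl x1) (V_cvg gl x1))) => n.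
by rewrite SkpB//; exact: lipb_intble.
Qed.

Lemma TL_wB f g x : lipb f -> lipb g -> -1 < x < 1 ->
  TL (fun t => w t * (f t - g t)) x = TL (fun t => w t * f t) x - TL (fun t => w t * g t) x.
Proof.
move=> fl gl x1; have yn n : 0 < ys n by have /andP[] := ys01 R n.
apply: (lim_eqE (U_cvg (lipbB fl gl) x1) (cvgB (U_cvg fl x1) (U_cvg gl x1))) => n.
rewrite /= -SkpB//; [|exact: wg_intble|exact: wg_intble].
by congr Sk; apply/funext => t; ring.
Qed.

Lemma lipb_Psi_intble g N : 0 <= N -> lipb g -> intble mu D (fun t => Psi (N * `|g t|)).
Proof.
move=> N0 gl; have [M M0 gM] := lipb_le gl; apply: (Psi_bounded (M := M)) => //.
by apply: measurable_funTS; exact: lipb_measurable.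
Qed.

Lemma TL_intble g : lipb g -> intble mu D (TL g).
Proof.
move=> gl; have h1 x : -1 < x < 1 -> `|1 : R| <= 1 by rewrite normr1.
have [I _] := V_limit gl (@measurable_cst _ _ _ _ D (1 : R)) h1.
by apply: DI_eq I => x _; rewrite mulr1.
Qed.

Lemma TLw_intble g : lipb g -> intble mu D (fun s => TL (fun t => w t * g t) s / w s).
Proof.
move=> gl; have h1 x : -1 < x < 1 -> `|1 : R| <= 1 by rewrite normr1.
have [I _] := U_limit gl (@measurable_cst _ _ _ _ D (1 : R)) h1.
by apply: DI_eq I => x _; rewrite mulr1.
Qed.

Lemma TL_apriori g N : 0 < N -> lipb g ->
  \int[mu]_(x in D) `|TL g x| <= pi / N * (\int[mu]_(t in D) Psi (N * `|g t|) + K0 R).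
Proof.
move=> N0 gl; have [K K_ge0 gK] := Skp_V_bound gl; have [Iw _] := int_inv_weight R.
have yn n : 0 < ys n by have /andP[] := ys01 R n.
have [_ H] : intble mu D (fun x => `|TL g x|) /\
    \int[mu]_(x in D) `|Sk kp g (ys n) x| @[n --> \oo] --> \int[mu]_(x in D) `|TL g x|.
  apply: (@Rint_cvg _ _ _ mu D _ _ (fun x => K * (w x)^-1)).
  - exact: mD.
  - move=> n; apply: measurableT_comp => //; apply: measurable_funTS; apply: Skp_measurable => //.
    exact: lipb_intble.
  - by move=> x /inD x1; apply: cvg_norm; exact: V_cvg.
  - exact: DI_Z.
  - by move=> n x /inD x1; rewrite normr_id; apply: gK => //; exact: ys01.
apply: (cvgr_to_le H); apply: nearW => n; apply: apriori => //.
- exact: ys01.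
- exact: lipb_measurable.
- exact: lipb_intble.
- exact: lipb_Psi_intble (ltW N0) gl.
Qed.

Lemma TLw_apriori g N : 0 < N -> lipb g ->
  \int[mu]_(x in D) `|TL (fun t => w t * g t) x / w x| <=
  pi / N * (\int[mu]_(t in D) Psi (N * `|g t|) + K0 R) +
  8 / N * (\int[mu]_(t in D) Psi (N * `|g t|) + 3 * pi).
Proof.
move=> N0 gl; have [K K_ge0 gK] := Skp_U_bound gl; have [Iw _] := int_inv_weight R.
have [M M0 gM] := lipb_le gl.
have yn n : 0 < ys n by have /andP[] := ys01 R n.
have [_ H] : intble mu D (fun x => `|TL (fun t => w t * g t) x / w x|) /\
    \int[mu]_(x in D) (`|Sk kp (fun t => w t * g t) (ys n) x| / w x) @[n --> \oo] -->
    \int[mu]_(x in D) `|TL (fun t => w t * g t) x / w x|.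
  apply: (@Rint_cvg _ _ _ mu D _ _ (fun x => K * (w x)^-1)).
  - exact: mD.
  - move=> n; apply: measurable_funM; last by apply: measurable_funTS; exact: inv_weight_measurable.
    apply: measurableT_comp => //; apply: measurable_funTS; apply: Skp_measurable => //.
    exact: wg_intble.
  - move=> x /inD x1; rewrite normrM (@gtr0_norm _ (w x)^-1) ?invr_gt0 ?weight_gt0//.
    by apply: cvgM; [apply: cvg_norm; exact: U_cvg|exact: cvg_cst].
  - exact: DI_Z.
  - move=> n x /inD x1; rewrite normrM normr_id (@gtr0_norm _ (w x)^-1) ?invr_gt0 ?weight_gt0//.
    by rewrite ler_wpM2r ?invr_ge0 ?weight_ge0//; apply: gK => //; exact: ys01.
apply: (cvgr_to_le H); apply: nearW => n; apply: apriori_weighted => //.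
- exact: ys01.
- exact: lipb_measurable.
- exact: lipb_intble.
- apply: (@DI_le _ _ (fun x => M * (w x)^-1)); last exact: DI_Z.
    apply: measurable_funM; last by apply: measurable_funTS; exact: inv_weight_measurable.
    by apply: measurableT_comp => //; apply: measurable_funTS; exact: lipb_measurable.
  move=> x x1; rewrite normrM normr_id (@gtr0_norm _ (w x)^-1) ?invr_gt0 ?weight_gt0//.
  by rewrite ler_wpM2r ?invr_ge0 ?weight_ge0.
- exact: lipb_Psi_intble (ltW N0) gl.
Qed.

(** The approximant [g n] is close to [f] at scale 2^(n+1). As [Psi_add] halves the scale, the
    increments have bounded modular at scale 2^n, and the a priori bounds with N = 2^n make both
    sequences of transforms geometrically convergent in L^1. *)
Lemma exists_VU f : measurable_fun setT f -> intble mu D (fun t => Psi `|f t|) ->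
  exists V U, [/\ intble mu D V, intble mu D U, V_identities f V & U_identities f U].
Proof.
move=> mf IP; have mfD : measurable_fun D f by exact: measurable_funTS.
have If := Psi_intble mfD IP.
have two n : 0 < 2 ^+ n :> R by rewrite exprn_gt0.
have ex n : exists g, lipb g /\ \int[mu]_(t in D) Psi (2 ^+ n.+1 * `|f t - g t|) <= 1.
  by have [g gl gi] := density (two n.+1) ltr01 mf IP; exists g.
have [g gP] := choice ex.
have gl n : lipb (g n) by have [] := gP n.
have gi n : \int[mu]_(t in D) Psi (2 ^+ n.+1 * `|f t - g n t|) <= 1 by have [] := gP n.
have mfg n : measurable_fun D (fun t => f t - g n t).
  by apply: measurable_funB => //; apply: measurable_funTS; exact: lipb_measurable.
have Ifg n N : 0 <= N -> intble mu D (fun t => Psi (N * `|f t - g n t|)).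
  move=> N0; have N2 : 0 <= 2 * N by rewrite mulr_ge0.
  apply: (@DI_le _ _ (fun t => Psi (2 * N * `|f t|) + Psi (2 * N * `|g n t|))).
  - exact: Psi_measurable.
  - move=> t _; rewrite ger0_norm; last by rewrite Psi_ge0// mulr_ge0.
    apply: (@le_trans _ _ (Psi (N * `|f t| + N * `|g n t|))).
      by apply: Psi_le; [rewrite mulr_ge0|rewrite -mulrDr ler_wpM2l// ler_normB].
    by rewrite -!(mulrA 2); apply: Psi_add; rewrite mulr_ge0.
  - by apply: DI_D; [exact: Psi_intble_scale|exact: lipb_Psi_intble].
have hi n : \int[mu]_(t in D) Psi (2 ^+ n * `|g n.+1 t - g n t|) <= 2.
  have n0 : 0 <= 2 ^+ n :> R by rewrite ltW.
  apply: (@le_trans _ _ (\int[mu]_(t in D) (Psi (2 ^+ n.+2 * `|f t - g n.+1 t|) + Psi (2 ^+ n.+1 * `|f t - g n t|)))).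
    apply: Dle.
    - by apply: lipb_Psi_intble => //; exact: lipbB.
    - by apply: DI_D; apply: Ifg; rewrite ltW.
    - move=> t _; set a := `|f t - g n.+1 t|; set b := `|f t - g n t|.
      apply: (@le_trans _ _ (Psi (2 ^+ n * a + 2 ^+ n * b))).
        apply: Psi_le; first by rewrite mulr_ge0.
        rewrite -mulrDr ler_wpM2l// (_ : _ - _ = (f t - g n t) - (f t - g n.+1 t)); last ring.
        by rewrite [leRHS]addrC; exact: ler_normB.
      apply: (le_trans (Psi_add _ _)); rewrite ?mulr_ge0 ?normr_ge0//.
      rewrite !mulrA -exprS lerD2r; apply: Psi_le; first by apply: mulr_ge0; [exact: ltW (two _)|exact: normr_ge0].
      apply: ler_wpM2r; first exact: normr_ge0.
      by have := two n.+1; rewrite (exprS _ n.+1); lra.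
  rewrite DD; [|by apply: Ifg; rewrite ltW|by apply: Ifg; rewrite ltW].
  by have h1 := gi n; have h2 := gi n.+1; lra.
have VI n : intble mu D (TL (g n)) by exact: TL_intble.
have UI n : intble mu D (fun s => TL (fun t => w t * g n t) s / w s) by exact: TLw_intble.
have hl n : lipb (fun t => g n.+1 t - g n t) by exact: lipbB.
have Vd n : \int[mu]_(x in D) `|TL (g n.+1) x - TL (g n) x| <= (pi * (2 + K0 R)) / 2 ^+ n.
  rewrite (@Deq _ _ (fun x => `|TL (fun t => g n.+1 t - g n t) x|)); last by move=> x x1; rewrite TL_B.
  apply: (le_trans (TL_apriori (two n) (hl n))); rewrite mulrAC ler_wpM2r ?invr_ge0 ?(ltW (two n))//.
  by rewrite ler_wpM2l ?pi_ge0// lerD2r.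
have Ud n : \int[mu]_(x in D) `|TL (fun t => w t * g n.+1 t) x / w x - TL (fun t => w t * g n t) x / w x| <=
    (pi * (2 + K0 R) + 8 * (2 + 3 * pi)) / 2 ^+ n.
  rewrite (@Deq _ _ (fun x => `|TL (fun t => w t * (g n.+1 t - g n t)) x / w x|)); last first.
    by move=> x x1; rewrite TL_wB// mulrBl.
  apply: (le_trans (TLw_apriori (two n) (hl n))); rewrite [leRHS]mulrDl.
  apply: lerD; rewrite mulrAC ler_wpM2r ?invr_ge0 ?(ltW (two n))//.
    by rewrite ler_wpM2l ?pi_ge0// lerD2r.
  by rewrite ler_wpM2l// lerD2r.
have [V [IV VV]] := L1_fast_limit VI Vd.
have [U [IU UU]] := L1_fast_limit UI Ud.
have gf : L1cvg g f.
  split=> //; first by move=> n; exact: lipb_intble.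
  (* By [le_Psi], 2^n |f - g n| is at most e + Psi(2^(n+1) |f - g n|); the interval has length 2 and
     the modular is at most 1. *)
  have H : (expR 1 * 2 + 1) / 2 ^+ n @[n --> \oo] --> (0 : R).
    rewrite -(mulr0 (expR 1 * 2 + 1)); apply: cvgM; first exact: cvg_cst.
    have := @cvg_expr R 2^-1; rewrite ger0_norm ?invr_ge0// invf_lt1// ltr1n => /(_ isT).
    by apply: cvg_trans; apply: near_eq_cvg; apply: nearW => n /=; rewrite exprVn.
  apply/cvgrPdist_le => e e0; move/cvgrPdist_le : H => /(_ _ e0); apply: filterS => n.
  rewrite !sub0r !normrN => /(le_trans (ler_norm _)) => h.
  rewrite ger0_norm; last by apply: Rintegral_ge0.
  apply: le_trans h; rewrite ler_pdivlMr//.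
  have I1 : intble mu D (fun t => `|g n t - f t|) by apply: DI_norm; apply: DI_B => //; exact: lipb_intble.
  rewrite -DZr//.
  apply: (@le_trans _ _ (\int[mu]_(t in D) (expR 1 + Psi (2 ^+ n.+1 * `|f t - g n t|)))).
    apply: Dle => //.
    - by apply: DI_eq (DI_Z (2 ^+ n) I1) => t _; rewrite mulrC.
    - by apply: DI_D; [exact: DI_C|apply: Ifg; rewrite ltW].
    - move=> t _; rewrite distrC mulrC; apply: (@le_trans _ _ (2 ^+ n.+1 * `|f t - g n t|)).
        apply: ler_wpM2r; first exact: normr_ge0.
        by have := two n; rewrite (exprS _ n); lra.
      by apply: le_Psi; rewrite mulr_ge0// ltW.
  rewrite DD; [|exact: DI_C|by apply: Ifg; rewrite ltW].
  by apply: lerD => //; rewrite Rintegral_cst//= [X in fine X]muD.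
exists V, U; split=> //.
  by apply: (V_identities_limit gf (G := fun n => TL (g n))) => // n; exact: V_identities_lipb.
by apply: (U_identities_limit gf (G := fun n s => TL (fun t => w t * g n t) s / w s)) => // n; exact: U_identities_lipb.
Qed.

(** The boundary arguments below need limits for [y] tending to 0 from the right, and not only along
    [ys]. *)
Lemma Skp_nice_cvg_right h C x : -1 < x < 1 -> nice h C -> intble mu D h ->
  Sk kp h y x @[y --> 0^'+] --> TL h x.
Proof.
move=> x1 hC Ih.
have H : \int[mu]_(t in D) ((h t - h x) * kp y (t - x)) + h x * Sk kp (fun=> 1) y x
    @[y --> 0^'+] --> TL h x.
  apply: cvgD; last by apply: cvgM; [exact: cvg_cst|exact: Skp1_cvg].
  have [Iw _] := int_inv_weight R.
  apply: (@Rint_cvg_at_right _ _ _ mu D _ _ (fun t => C * (w t)^-1) 1).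
  - exact: mD.
  - exact: ltr01.
  - by move=> y /andP[y0 _]; apply: DI_mf; exact: (nice_intble x1 hC).
  - by move=> t _; apply: cvgM; [exact: cvg_cst|exact: kp_cvg].
  - exact: DI_Z.
  - by move=> y t /andP[y0 _] /inD t1; exact: nice_kernel_le.
apply: cvg_trans H; apply: near_eq_cvg; near=> y.
by rewrite -Skp_split//; near: y; exact: nbhs_right_gt.
Unshelve. all: by end_near. Qed.

(** Makes the factor of [Sk kq f] in [V_identities] tend to 0; the moment [B0] cancels there and is
    never evaluated. *)
Lemma Skp_weight_cvg x : -1 < x < 1 -> Sk kp w y x @[y --> 0^'+] --> - (B0 + pi * x).
Proof.
move=> x1; have Iwp : intble mu D w by apply: DI_cont => s _; exact: weight_cont.
have [Iw piE] := int_inv_weight R.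
have wN : nice w 2 by move=> t s; exact: weight_diff.
have sM s : -1 < s < 1 -> `|s| <= 1 by move=> /andP[? ?]; rewrite ler_norml; apply/andP; split; lra.
have Isw : intble mu D (fun s => (w s)^-1 * s) by apply: (@DI_bdw _ _ 1).
suff <- : TL w x = - (B0 + pi * x) by exact: (Skp_nice_cvg_right x1 wN).
pose r s := - (s + x).
have mr : measurable_fun D r.
  by apply: measurable_funTS; apply: measurableT_comp => //; exact: measurable_funD.
have rM s : -1 < s < 1 -> `|r s| <= 1 + 1.
  by move=> s1; rewrite normrN (le_trans (ler_normD _ _))// lerD// sM.
have rE s : -1 < s < 1 -> w s = (w s)^-1 * ((1 - x ^+ 2) + (s - x) * r s).
  move=> s1; have ws := weight_gt0 s1; have /andP[s2 s3] := s1.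
  rewrite (_ : _ + _ = 1 - s ^+ 2); last by rewrite /r; ring.
  by rewrite -weight_sqr ?(ltW s2) ?(ltW s3)//; field; rewrite gt_eqF.
rewrite (cvg_unique _ (Skp_nice_cvg x1 wN Iwp) (SkpQ_cvg x1 mr rM rE))//.
rewrite -piE (mulrC _ x) -DZl// -DD//; last exact: DI_Z.
rewrite -[RHS]mulN1r -DZl; last by apply: DI_D => //; exact: DI_Z.
by apply: Deq => s _; rewrite /r; ring.
Qed.

Lemma Skp_iw_cvg t : -1 < t < 1 -> Sk kp iw y t @[y --> 0^'+] --> (0 : R).
Proof.
move=> t1; have [Iw _] := int_inv_weight R.
have h1 := trunc_Skp_cvg0 t1 Iw (lebesgue_pt_continuous t1 Iw (inv_weight_cont t1)).
have h2 : trunc_int iw t h - (trunc_int iw t h - Sk kp iw h t) @[h --> 0^'+] --> (0 : R).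
  by rewrite -[X in _ --> X](subrr 0); apply: cvgB h1; exact: pv_inv_weight.
by apply: cvg_trans h2; apply: near_eq_cvg; apply: nearW => h /=; ring.
Qed.

Lemma Skq_weight_cvg x : -1 < x < 1 -> Sk kq w y x @[y --> 0^'+] --> pi * w x.
Proof.
move=> x1; have Iwp : intble mu D w by apply: DI_cont => s _; exact: weight_cont.
by apply: poisson_cvg => //; apply: lebesgue_pt_continuous => //; exact: weight_cont.
Qed.

Lemma Skq_iw_cvg x : -1 < x < 1 -> Sk kq iw y x @[y --> 0^'+] --> pi * (w x)^-1.
Proof.
move=> x1; have [Iw _] := int_inv_weight R.
by apply: (@poisson_cvg _ iw) => //; apply: lebesgue_pt_continuous => //; exact: inv_weight_cont.
Qed.

Lemma id_cvg0 : (y : R) @[y --> 0^'+] --> (0 : R).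
Proof. by apply: cvg_at_right_filter; exact: cvg_id. Qed.

Lemma trunc_of_Skp f x (l : R) : -1 < x < 1 -> intble mu D f -> lebesgue_pt f x ->
  Sk kp f y x @[y --> 0^'+] --> l -> trunc_int f x y @[y --> 0^'+] --> l.
Proof.
move=> x1 If fx H; have h := trunc_Skp_cvg0 x1 If fx.
have h2 : (trunc_int f x y - Sk kp f y x) + Sk kp f y x @[y --> 0^'+] --> l.
  by rewrite -[l]add0r; exact: cvgD.
by apply: cvg_trans h2; apply: near_eq_cvg; apply: nearW => y /=; rewrite subrK.
Qed.

(** The first identity is solved for [Sk kp f]: its coefficient tends to pi w(x), which is not 0,
    and the other terms converge because [x] is a Lebesgue point. The second identity then converges
    too, since its factor of [Sk kp f] tends to 0. *)
Lemma V_boundary f V x : -1 < x < 1 -> intble mu D f -> V_identities f V ->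
  lebesgue_pt f x -> lebesgue_pt (fun t => w t * V t) x -> intble mu D (fun t => w t * V t) ->
  Sk kp f y x @[y --> 0^'+] --> V x /\
  Sk kp (fun t => w t * V t) y x @[y --> 0^'+] -->
    - (pi ^+ 2 * (w x * f x)) + pi * \int[mu]_(t in D) f t.
Proof.
move=> x1 If VI fx wVx IwV; have wx := weight_gt0 x1.
have pn : pi != 0 :> R by rewrite gt_eqF ?pi_gt0.
have wn : w x != 0 by rewrite gt_eqF.
have cA : Sk kp w y x + pi * x + B0 @[y --> 0^'+] --> (0 : R).
  have E0 : - (B0 + pi * x) + pi * x + B0 = 0 by ring.
  rewrite -[X in _ --> X]E0.
  by apply: cvgD; [apply: cvgD; [exact: Skp_weight_cvg|exact: cvg_cst]|exact: cvg_cst].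
have cq := poisson_cvg x1 If fx.
have cwV := poisson_cvg x1 IwV wVx.
have cw := Skq_weight_cvg x1.
have cwy : Sk kq w y x + pi * y @[y --> 0^'+] --> pi * w x.
  rewrite [X in _ --> X](_ : _ = pi * w x + pi * 0); last by rewrite mulr0 addr0.
  apply: cvgD => //.
  by apply: cvgM; [exact: cvg_cst|exact: id_cvg0].
have n0 : pi * w x != 0 by rewrite mulf_neq0.
have V1 : Sk kp f y x @[y --> 0^'+] --> V x.
  have H : (Sk kq (fun t => w t * V t) y x - (Sk kp w y x + pi * x + B0) * Sk kq f y x) /
      (Sk kq w y x + pi * y) @[y --> 0^'+] --> V x.
    rewrite (_ : V x = (pi * (w x * V x) - 0 * (pi * f x)) / (pi * w x)); last first.
      by rewrite mul0r subr0 mulrA mulrAC mulfV// mul1r.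
    by apply: cvgM; [apply: cvgB => //; exact: cvgM|exact: cvgV].
  apply: cvg_trans H; apply: near_eq_cvg; near=> y.
  have y0 : 0 < y by near: y; exact: nbhs_right_gt.
  have d0 : Sk kq w y x + pi * y != 0.
    near: y; apply: (@cvgr_neq0 _ _ _ _ _ (fun y => Sk kq w y x + pi * y) _ cwy) => //.
  by rewrite (VI x y y0).1 addrC addKr mulrC mulrA mulVf// mul1r.
split=> //.
have H : - (Sk kq w y x * Sk kq f y x) + (Sk kp w y x + pi * x + B0) * Sk kp f y x +
    pi * \int[mu]_(t in D) f t - pi * y * Sk kq f y x @[y --> 0^'+] -->
    - (pi ^+ 2 * (w x * f x)) + pi * \int[mu]_(t in D) f t.
  rewrite (_ : - (pi ^+ 2 * (w x * f x)) + _ = - ((pi * w x) * (pi * f x)) + 0 * V x +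
    pi * \int[mu]_(t in D) f t - (pi * 0) * (pi * f x)); last ring.
  apply: cvgB; last by apply: cvgM => //; apply: cvgM; [exact: cvg_cst|exact: id_cvg0].
  apply: cvgD; last exact: cvg_cst.
  by apply: cvgD; [apply: cvgN; exact: cvgM|exact: cvgM].
apply: cvg_trans H; apply: near_eq_cvg; near=> y.
have y0 : 0 < y by near: y; exact: nbhs_right_gt.
by rewrite (VI x y y0).2.
Unshelve. all: by end_near. Qed.

(** Here the second identity is solved for the potential of [w f], whose coefficient tends to pi /
    w(x); the first then gives the boundary value of the potential of [U]. *)
Lemma U_boundary f U x : -1 < x < 1 -> intble mu D U -> U_identities f U ->
  lebesgue_pt U x -> lebesgue_pt (fun t => w t * f t) x -> intble mu D (fun t => w t * f t) ->
  Sk kp (fun t => w t * f t) y x @[y --> 0^'+] --> w x * U x /\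
  Sk kp U y x @[y --> 0^'+] --> - (pi ^+ 2 * f x).
Proof.
move=> x1 IU UI Ux wfx Iwf; have wx := weight_gt0 x1.
have pn : pi != 0 :> R by rewrite gt_eqF ?pi_gt0.
have wn : w x != 0 by rewrite gt_eqF.
have cJp := Skp_iw_cvg x1; have cJq := Skq_iw_cvg x1.
have cU := poisson_cvg x1 IU Ux; have cwf := poisson_cvg x1 Iwf wfx.
have n0 : pi * (w x)^-1 != 0 by rewrite mulf_neq0// invr_neq0.
have U1 : Sk kp (fun t => w t * f t) y x @[y --> 0^'+] --> w x * U x.
  have H : (Sk kq U y x - Sk kp iw y x * Sk kq (fun t => w t * f t) y x) / Sk kq iw y x
      @[y --> 0^'+] --> w x * U x.
    rewrite [X in _ --> X](_ : _ = (pi * U x - 0 * (pi * (w x * f x))) / (pi * (w x)^-1)); last first.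
      by rewrite mul0r subr0 invfM invrK mulrACA mulfV// mul1r mulrC.
    by apply: cvgM; [apply: cvgB => //; exact: cvgM|exact: cvgV].
  apply: cvg_trans H; apply: near_eq_cvg; near=> y.
  have y0 : 0 < y by near: y; exact: nbhs_right_gt.
  have d0 : Sk kq iw y x != 0.
    near: y; apply: (@cvgr_neq0 _ _ _ _ _ (fun y => Sk kq iw y x) _ cJq) => //.
  by rewrite (UI x y y0).2 addrC addKr mulrC mulrA mulVf// mul1r.
split=> //.
have H : Sk kp iw y x * Sk kp (fun t => w t * f t) y x - Sk kq iw y x * Sk kq (fun t => w t * f t) y x
    @[y --> 0^'+] --> - (pi ^+ 2 * f x).
  rewrite (_ : - _ = 0 * (w x * U x) - (pi * (w x)^-1) * (pi * (w x * f x))); last by field; rewrite ?pn ?wn.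
  by apply: cvgB; exact: cvgM.
apply: cvg_trans H; apply: near_eq_cvg; near=> y.
have y0 : 0 < y by near: y; exact: nbhs_right_gt.
by rewrite (UI x y y0).1.
Unshelve. all: by end_near. Qed.

Lemma Sk_norm_le (k : R -> R -> R) f y x : (forall u, `|k y u| <= y^-1) -> continuous (k y) ->
  intble mu D f -> `|Sk k f y x| <= y^-1 * \int[mu]_(t in D) `|f t|.
Proof. by move=> kM ck If; apply: Sk_le => // t _; exact: kM. Qed.

Lemma kq_scaled (Y t : R) : 0 < Y -> Y * kq Y t = (1 + t ^+ 2 * (Y^-1 * Y^-1))^-1.
Proof.
move=> Y0; have Yn : Y != 0 by rewrite gt_eqF.
have -> : 1 + t ^+ 2 * (Y^-1 * Y^-1) = (t ^+ 2 + Y ^+ 2) * (Y^-1 * Y^-1) by field.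
by rewrite !invfM !invrK /kq; ring.
Qed.

(** On the imaginary axis, Y Im C U(iY) tends to the integral of U because Y kq tends to 1
    boundedly. But C U is a product of two Cauchy integrals, each of order 1/Y, so the same quantity
    is of order 1/Y. *)
Lemma int_U0 f U : intble mu D f -> intble mu D U -> U_identities f U -> \int[mu]_(t in D) U t = 0.
Proof.
move=> If IU UI; have [Iw _] := int_inv_weight R.
have mw : measurable_fun D w by apply: measurable_funTS; exact: weight_measurable.
have Iwf : intble mu D (fun t => w t * f t).
  by apply: DI_eq (DI_M If mw (fun t _ => weight_norm_le1 t)) => t _; rewrite mulrC.
have Y0 n : 0 < n.+1%:R :> R by rewrite ltr0n.
have L1 : \int[mu]_(t in D) (U t * (n.+1%:R * kq n.+1%:R t)) @[n --> \oo] --> \int[mu]_(t in D) U t.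
  apply: (@Rint_cvg _ _ _ mu D _ _ (fun t => `|U t|) _ _ _ _ _).2.
  - exact: mD.
  - move=> n; apply: measurable_funM; first exact: DI_mf.
    by apply: measurable_funTS; apply: measurable_funM => //; exact: kq_measurable.
  - move=> t _; rewrite -[X in _ --> X]mulr1; apply: cvgM; first exact: cvg_cst.
    have E n : n.+1%:R * kq n.+1%:R t = (1 + t ^+ 2 * (n.+1%:R^-1 * n.+1%:R^-1))^-1 :> R.
      exact: kq_scaled.
    rewrite [X in _ --> X](_ : _ = (1 + t ^+ 2 * (0 * 0))^-1); last by rewrite !mulr0 addr0 invr1.
    under eq_fun do rewrite E.
    have h := @cvg_harmonic R.
    apply: cvgV; first by rewrite !mulr0 addr0 oner_neq0.
    by apply: cvgD; [exact: cvg_cst|apply: cvgM; [exact: cvg_cst|exact: cvgM]].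
  - exact: DI_norm.
  - move=> n t _; rewrite normrM ler_piMr// ger0_norm; last by rewrite mulr_ge0 ?kq_ge0 ?ltW.
    by rewrite mulrC -ler_pdivlMr// div1r; exact: kq_le.
have L2 : n.+1%:R * Sk kq U n.+1%:R 0 @[n --> \oo] --> (0 : R).
  pose c := (\int[mu]_(t in D) `|(w t)^-1|) * (\int[mu]_(t in D) `|w t * f t|).
  have H : 2 * c * n.+1%:R^-1 @[n --> \oo] --> (0 : R).
    by rewrite -(mulr0 (2 * c)); apply: cvgM; [exact: cvg_cst|exact: cvg_harmonic].
  apply/cvgrPdist_le => e e0; move/cvgrPdist_le : H => /(_ _ e0); apply: filterS => n.
  rewrite !sub0r !normrN => /(le_trans (ler_norm _)); apply: le_trans.
  rewrite (UI 0 _ (Y0 n)).2 normrM (gtr0_norm (Y0 n)).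
  have yp (u : R) : `|kp n.+1%:R u| <= n.+1%:R^-1 by exact: kp_le.
  have yq (u : R) : `|kq n.+1%:R u| <= n.+1%:R^-1 by exact: kq_nle.
  have b1 := @Sk_norm_le kp _ _ 0 yp (kp_cont (Y0 n)) Iw.
  have b2 := @Sk_norm_le kq _ _ 0 yq (kq_cont (Y0 n)) Iw.
  have b3 := @Sk_norm_le kp _ _ 0 yp (kp_cont (Y0 n)) Iwf.
  have b4 := @Sk_norm_le kq _ _ 0 yq (kq_cont (Y0 n)) Iwf.
  rewrite (_ : 2 * c / _ = n.+1%:R * ((n.+1%:R^-1 * \int[mu]_(t in D) `|(w t)^-1|) * (n.+1%:R^-1 * \int[mu]_(t in D) `|w t * f t|) +
    (n.+1%:R^-1 * \int[mu]_(t in D) `|(w t)^-1|) * (n.+1%:R^-1 * \int[mu]_(t in D) `|w t * f t|))); last first.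
    by rewrite /c; field; rewrite gt_eqF.
  rewrite ler_wpM2l ?(ltW (Y0 n))// (le_trans (ler_normD _ _))// !normrM.
  by apply: lerD; apply: ler_pM.
apply: (lim_eqE L1 L2) => n.
rewrite /Sk -DZl; last by apply: Skq_intble.
by apply: Deq => t _; rewrite subr0; ring.
Qed.

Lemma real_hilbert f : measurable_fun setT f -> intble mu D (fun t => Psi `|f t|) ->
  exists V U, [/\ intble mu D V, intble mu D U, \int[mu]_(t in D) U t = 0 &
  {ae mu, forall x, D x ->
    [/\ trunc_int f x y @[y --> 0^'+] --> V x,
        trunc_int (fun t => w t * V t) x y @[y --> 0^'+] -->
          - (pi ^+ 2 * (w x * f x)) + pi * \int[mu]_(t in D) f t,
        trunc_int (fun t => w t * f t) x y @[y --> 0^'+] --> w x * U x &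
        trunc_int U x y @[y --> 0^'+] --> - (pi ^+ 2 * f x)]}].
Proof.
move=> mf IP; have mfD : measurable_fun D f by exact: measurable_funTS.
have If := Psi_intble mfD IP.
have [V [U [IV IU VI UI]]] := exists_VU mf IP.
exists V, U; split=> //; first exact: int_U0 If IU UI.
have mw : measurable_fun D w by apply: measurable_funTS; exact: weight_measurable.
have Iwf : intble mu D (fun t => w t * f t).
  by apply: DI_eq (DI_M If mw (fun t _ => weight_norm_le1 t)) => t _; rewrite mulrC.
have IwV : intble mu D (fun t => w t * V t).
  by apply: DI_eq (DI_M IV mw (fun t _ => weight_norm_le1 t)) => t _; rewrite mulrC.
have := negligibleU (lebesgue_pt_ae If) (negligibleU (lebesgue_pt_ae IwV) (negligibleU (lebesgue_pt_ae Iwf) (lebesgue_pt_ae IU))).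
apply: negligibleS => x /= nx; apply: contrapT => /not_orP[/contrapT h1] /not_orP[/contrapT h2] /not_orP[/contrapT h3] /contrapT h4.
apply: nx => Dx; have x1 : -1 < x < 1 by exact/inD.
have [l1 l2] := V_boundary x1 If VI (h1 Dx) (h2 Dx) IwV.
have [l3 l4] := U_boundary x1 IU UI (h4 Dx) (h3 Dx) Iwf.
by split; apply: trunc_of_Skp => //; [exact: h1|exact: h2|exact: h3|exact: h4].
Qed.
End RealHilbert.

(** * The Zygmund norm *)

Section EqDistribution.
Context d1 d2 (T1 : measurableType d1) (T2 : measurableType d2) (R : realType).
Variables (m1 : {measure set T1 -> \bar R}) (m2 : {measure set T2 -> \bar R}).

Lemma integral_pushforward_restr d (T : measurableType d) (m : {measure set T -> \bar R})
    (A : set T) (F : T -> R) (Phi : R -> \bar R) (mA : measurable A) :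
  measurable_fun setT F -> measurable_fun setT Phi -> (forall u, (0 <= Phi u)%E) ->
  (\int[m]_(x in A) Phi (F x) = \int[pushforward (mrestr m mA) F]_u Phi u)%E.
Proof.
move=> mF mPhi Phi0.
have mPF : measurable_fun setT (Phi \o F) by exact: measurableT_comp.
rewrite (@ge0_integral_pushforward _ _ _ _ _ F mF (mrestr m mA) setT Phi)//.
have mC : measurable (~` A) by exact: measurableC.
have C0 : mrestr m mA (~` A) = 0%E by rewrite /mrestr setICl measure0.
rewrite preimage_setT (@ge0_negligible_integral _ _ _ (mrestr m mA) setT (~` A) (Phi \o F))//; last first.
  by move=> x _; exact: Phi0.
rewrite setDE setCK setTI; apply: eq_measure_integral => B mB BA /=.
by rewrite /mrestr setIidl.
Qed.

(** The images of the two restricted measures agree on the open upper half-lines, a generating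
    family stable under intersection, and are finite there; so they agree on Borel sets. *)
Lemma eq_distribution (A : set T1) (B : set T2) (F : T1 -> R) (G : T2 -> R) (Phi : R -> \bar R) :
  measurable A -> measurable B -> measurable_fun setT F -> measurable_fun setT G ->
  (m1 A < +oo)%E ->
  (forall l, m1 (A `&` [set x | l < F x]) = m2 (B `&` [set x | l < G x])) ->
  measurable_fun setT Phi -> (forall u, (0 <= Phi u)%E) ->
  (\int[m1]_(x in A) Phi (F x) = \int[m2]_(x in B) Phi (G x))%E.
Proof.
move=> mA mB mF mG Aoo AB mPhi Phi0.
rewrite (integral_pushforward_restr m1 mA mF)// (integral_pushforward_restr m2 mB mG)//.
apply: eq_measure_integral => E mE _.
pose g (k : nat) := `]- k%:R, +oo[%classic : set R.
have mFg k : measurable (F @^-1` (g k)).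
  by rewrite -[X in measurable X]setTI; apply: mF => //; exact: measurable_itv.
have pre d (T : measurableType d) (C : set T) (H : T -> R) (x : R) :
    H @^-1` `]x, +oo[ `&` C = C `&` [set t | x < H t].
  by apply/seteqP; split=> t [h1 h2]; split=> //; move: h1 h2; rewrite /= in_itv/= andbT.
pose p1 := measure_function_pushforward__canonical__measure_function_Measure
  (measure_function_mrestr__canonical__measure_function_Measure m1 mA) mF.
pose p2 := measure_function_pushforward__canonical__measure_function_Measure
  (measure_function_mrestr__canonical__measure_function_Measure m2 mB) mG.
apply: (@measure_unique _ R _ (@RGenOInfty.G R) g _ _ _ _ p1 p2 _ _ E mE) => //.
- exact: RGenOInfty.measurableE.
- move=> _ _ [x ->] [y ->]; exists (Num.max x y).
  apply/seteqP; split=> z /=; rewrite !in_itv/= !andbT gt_max.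
    by move=> [-> ->].
  by move=> /andP.
- by move=> k; exists (- k%:R).
- apply/seteqP; split=> // x _; exists (Num.bound `|x|) => //=.
  rewrite /g /= in_itv/= andbT ltrNl (le_lt_trans (ler_norm _))// normrN.
  exact: archi_boundP.
- by move=> _ [x ->]; rewrite /= /pushforward /mrestr !pre.
- move=> k; rewrite /= /pushforward /mrestr; apply: le_lt_trans Aoo.
  apply: le_measure; rewrite ?inE//; apply: measurableI => //.
Qed.
End EqDistribution.

Section Rearrangement.
Context (R : realType).
Notation mu := (@lebesgue_measure R).
Notation D := (`]-1, 1[%classic : set R).
Notation D2 := (`]0, 2[%classic : set R).
Implicit Types (F G H : R -> R) (x y t s l : R).

Definition distrib F l : \bar R := mu (D `&` [set x | l < F x]).

Definition rearr F t : \bar R := ereal_inf [set l%:E | l in [set l : R | 0 <= l /\ (distrib F l <= t%:E)%E]].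

(** For t <= 0 [rearr] may be infinite; the value 0 outside (0, 2) gives a real function that is
    nonnegative and measurable on the whole line. *)
Definition frearr F t : R := if 0 < t < 2 then fine (rearr F t) else 0.

Lemma mlev F l (A : set R) : measurable A -> measurable_fun setT F -> measurable (A `&` [set x | l < F x]).
Proof.
move=> mA mF; apply: measurableI => //.
rewrite (_ : [set x | l < F x] = setT `&` F @^-1` `]l, +oo[); first exact: mF.
by apply/seteqP; split=> x /=; rewrite in_itv/= andbT; [move=> ?; split|case].
Qed.

Lemma distrib_le F l (m : R) : measurable_fun setT F -> l <= m -> (distrib F m <= distrib F l)%E.
Proof.
move=> mF lm; apply: le_measure; rewrite ?inE; [exact: mlev|exact: mlev|].
by move=> x [Dx] /= mx; split=> //=; exact: le_lt_trans lm mx.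
Qed.

Lemma distrib_le2 F l : measurable_fun setT F -> (distrib F l <= 2%:E)%E.
Proof.
move=> mF; rewrite -(@muD R); apply: le_measure; rewrite ?inE//; exact: mlev.
Qed.

Lemma distrib_fin F l : measurable_fun setT F -> distrib F l \is a fin_num.
Proof.
move=> mF; rewrite ge0_fin_numE ?measure_ge0//; apply: (le_lt_trans (distrib_le2 _ mF)).
exact: ltry.
Qed.

(** Right continuity of the distribution function: the set above level [l] is the increasing union
    of the sets above l + 1/(n+1). *)
Lemma distrib_right F l t : measurable_fun setT F -> (t%:E < distrib F l)%E ->
  exists2 e : R, 0 < e & (t%:E < distrib F (l + e))%E.
Proof.
move=> mF tl.
pose E (n : nat) := D `&` [set x | l + n.+1%:R^-1 < F x].
have mE n : measurable (E n) by apply: mlev => //; exact: mD.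
have EU : \bigcup_n E n = D `&` [set x | l < F x].
  apply/seteqP; split=> [x [n _ [Dx /= h]]|x [Dx /= h]].
    by split=> //=; apply: lt_trans h; rewrite ltrDl invr_gt0.
  by have [n hn] := ltr_add_invr h; exists n => //; split.
have nd : nondecreasing_seq E.
  move=> n m nm; apply/subsetPset => x [Dx /= h]; split=> //=.
  by apply: le_lt_trans h; rewrite lerD2l lef_pV2 ?posrE// ler_nat.
have mU : measurable (\bigcup_n E n) by exact: bigcupT_measurable.
have cv := @nondecreasing_cvg_mu _ _ _ mu E mE mU nd.
apply: contrapT => no; move: tl; rewrite ltNge => /negP; apply; rewrite /distrib -EU.
apply: (cvge_le _ cv); apply: nearW => n; rewrite leNgt; apply/negP => h.
by apply: no; exists n.+1%:R^-1.
Qed.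

Lemma distrib_inf F t : measurable_fun setT F -> 0 < t -> exists n : nat, (distrib F n%:R < t%:E)%E.
Proof.
move=> mF t0.
pose E (n : nat) := D `&` [set x | n%:R < F x].
have mE n : measurable (E n) by apply: mlev => //; exact: mD.
have EU : \bigcap_n E n = set0.
  apply/seteqP; split=> // x h.
  have [n hn] : exists n : nat, F x <= n%:R.
    exists (Num.bound `|F x|); apply: (le_trans (ler_norm _)); apply: ltW.
    by apply: le_lt_trans (archi_boundP _); rewrite ?lexx.
  by have [_ /=] := h n Logic.I; rewrite ltNge hn.
have nd : nonincreasing_seq E.
  move=> n m nm; apply/subsetPset => x [Dx /= h]; split=> //=.
  by apply: le_lt_trans h; rewrite ler_nat.
have mU : measurable (\bigcap_n E n) by exact: bigcapT_measurable.
have E0 : (mu (E 0%N) < +oo)%E by rewrite -ge0_fin_numE ?measure_ge0//; exact: distrib_fin.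
have cv := @nonincreasing_cvg_mu _ _ _ mu E E0 mE mU nd.
apply: contrapT => no; have : (t%:E <= 0)%E.
  rewrite EU measure0 in cv; apply: (cvge_ge _ cv); apply: nearW => n.
  by rewrite leNgt; apply/negP => h; apply: no; exists n.
by rewrite lee_fin leNgt t0.
Qed.

(** The equivalence from which monotonicity, measurability and equimeasurability are read off. That
    the inequality for the infimum is strict comes from [distrib_right]. *)
Lemma rearr_gt F t l : measurable_fun setT F -> 0 <= l -> (l%:E < rearr F t)%E = (t%:E < distrib F l)%E.
Proof.
move=> mF l0; apply/idP/idP => [h|/(distrib_right mF)[e e0 te]].
  rewrite ltNge; apply/negP => dl; move: h; rewrite ltNge => /negP; apply.
  by apply: ereal_inf_lbound; exists l.
apply: (@lt_le_trans _ _ (l + e)%:E); first by rewrite lte_fin ltrDl.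
apply: le_ereal_inf_tmp => _ [m [m0 dm] <-]; rewrite lee_fin leNgt; apply/negP => ml.
by move: te; rewrite ltNge => /negP; apply; apply: le_trans dm; apply: distrib_le (ltW ml).
Qed.

Lemma rearr_ge0 F t : (0 <= rearr F t)%E.
Proof. by apply: le_ereal_inf_tmp => _ [m [m0 _] <-]; rewrite lee_fin. Qed.

Lemma rearr_fin F t : measurable_fun setT F -> 0 < t -> rearr F t \is a fin_num.
Proof.
move=> mF t0; rewrite ge0_fin_numE ?rearr_ge0//.
have [n hn] := distrib_inf mF t0; apply: (@le_lt_trans _ _ n%:R%:E); last exact: ltry.
by apply: ereal_inf_lbound; exists n%:R => //; split => //; exact: ltW.
Qed.

Lemma frearrE F t : measurable_fun setT F -> 0 < t < 2 -> (frearr F t)%:E = rearr F t.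
Proof. by move=> mF t02; rewrite /frearr t02 fineK// rearr_fin//; case/andP: t02. Qed.

Lemma frearr_ge0 F t : 0 <= frearr F t.
Proof. by rewrite /frearr; case: ifP => // _; apply: fine_ge0; exact: rearr_ge0. Qed.

Lemma frearr_gt F t l : measurable_fun setT F -> 0 < t < 2 -> 0 <= l -> (l < frearr F t) = (t%:E < distrib F l)%E.
Proof. by move=> mF t02 l0; rewrite -lte_fin frearrE// rearr_gt. Qed.

Lemma frearr_nonincr F s t : measurable_fun setT F -> 0 < s -> s <= t -> t < 2 -> frearr F t <= frearr F s.
Proof.
move=> mF s0 st t2; rewrite leNgt; apply/negP => h.
have t02 : 0 < t < 2 by rewrite (lt_le_trans s0).
have s02 : 0 < s < 2 by rewrite s0 (le_lt_trans st).
have := ltxx (frearr F s); rewrite frearr_gt ?frearr_ge0// => /negbT/negP; apply.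
rewrite frearr_gt ?frearr_ge0// in h; apply: le_lt_trans h; by rewrite lee_fin.
Qed.

Lemma frearr_level F l : measurable_fun setT F -> 0 <= l ->
  D2 `&` [set t | l < frearr F t] = `]0, (fine (distrib F l))[%classic.
Proof.
move=> mF l0; have dE : (fine (distrib F l))%:E = distrib F l by rewrite fineK// distrib_fin.
have d2 : fine (distrib F l) <= 2 by rewrite -lee_fin dE distrib_le2.
apply/seteqP; split=> t /=; rewrite !in_itv/=.
  by move=> [t02]; rewrite frearr_gt// -dE lte_fin => ->; rewrite andbT; case/andP: t02.
move=> /andP[t0 td]; have t02 : 0 < t < 2 by rewrite t0 (lt_le_trans td).
by split=> //; rewrite frearr_gt// -dE lte_fin.
Qed.

Lemma frearr_measurable F : measurable_fun setT F -> measurable_fun setT (frearr F).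
Proof.
move=> mF; apply: (measurability _ (RGenOInfty.measurableE R)) => _ [_ [l ->] <-].
rewrite setTI; have [l0|l0] := leP 0 l.
  rewrite (_ : _ @^-1` _ = `]0, (fine (distrib F l))[%classic); first exact: measurable_itv.
  rewrite -frearr_level//; apply/seteqP; split=> t /=; rewrite !in_itv/= andbT; last by case.
  move=> h; split=> //; move: (le_lt_trans l0 h); rewrite /frearr; case: ifP => //.
  by rewrite ltxx.
rewrite (_ : _ @^-1` _ = setT); first exact: measurableT.
by apply/seteqP; split=> // t _; rewrite /= in_itv/= andbT (lt_le_trans l0)// frearr_ge0.
Qed.

Lemma equimeasurable F (Phi : R -> \bar R) : measurable_fun setT F -> (forall x, 0 <= F x) ->
  measurable_fun setT Phi -> (forall u, (0 <= Phi u)%E) ->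
  (\int[mu]_(x in D) Phi (F x) = \int[mu]_(t in D2) Phi (frearr F t))%E.
Proof.
move=> mF F0 mPhi Phi0; apply: eq_distribution => //.
- exact: frearr_measurable.
- move=> l; have [l0|l0] := leP 0 l.
    rewrite [RHS](_ : _ = mu `]0, (fine (distrib F l))[); last by congr mu; exact: frearr_level.
    rewrite lebesgue_measure_itv/= lte_fin; case: ifPn => d0.
      by rewrite sube0 fineK// distrib_fin.
    apply/eqP; rewrite eq_le measure_ge0 andbT -/(distrib F l) -[distrib F l]fineK ?distrib_fin// lee_fin.
    by rewrite leNgt.
  (* Below level 0 both sets are the full intervals, which have the same length 2. *)
  have -> : D `&` [set x | l < F x] = D.
    by apply: setIidl => x _ /=; exact: lt_le_trans l0 _.
  have -> : D2 `&` [set x | l < frearr F x] = D2.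
    by apply: setIidl => x _ /=; apply: lt_le_trans l0 _; exact: frearr_ge0.
  by rewrite [LHS]muD [RHS](lebesgue_measure_itv `]0, 2[)/= lte_fin ltr0n sube0.
Qed.
End Rearrangement.

(** * Norm inequalities by rearrangement *)

Section ZygmundNorm.
Context (R : realType).
Notation mu := (@lebesgue_measure R).
Notation D := (`]-1, 1[%classic : set R).
Notation D2 := (`]0, 2[%classic : set R).
Local Notation w := (@weight R).
Implicit Types (F G H : R -> R) (x y t s l c : R).

Definition lphi t : R := ln (2 * expR 1 / t).

Lemma lphiE t : 0 < t -> lphi t = 1 + (ln 2 - ln t).
Proof.
move=> t0; rewrite /lphi lnM ?posrE ?mulr_gt0 ?expR_gt0 ?invr_gt0// lnV ?posrE//.
by rewrite lnM ?posrE ?expR_gt0// expRK; ring.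
Qed.

Lemma lphi_ge1 t : 0 < t < 2 -> 1 <= lphi t.
Proof.
move=> /andP[t0 t2]; rewrite lphiE// lerDl subr_ge0 ler_ln ?posrE//; exact: ltW.
Qed.

Lemma lphi_measurable : measurable_fun setT lphi.
Proof.
apply: (measurableT_comp (@measurable_ln R)); apply: measurable_funM => //.
exact: measurable_inv.
Qed.

Definition zyg_norm F : \bar R := (\int[mu]_(t in D2) (frearr F t * lphi t)%:E)%E.

Lemma in_D2 t : D2 t -> 0 < t < 2. Proof. by rewrite /= in_itv. Qed.

Lemma fsl_ge0 F t : 0 < t < 2 -> 0 <= frearr F t * lphi t.
Proof. by move=> t02; rewrite mulr_ge0 ?frearr_ge0// (le_trans _ (lphi_ge1 t02)). Qed.

Lemma fsl_measurable F : measurable_fun setT F -> measurable_fun setT (fun t => (frearr F t * lphi t)%:E).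
Proof.
move=> mF; apply/measurable_EFinP; apply: measurable_funM; first exact: frearr_measurable.
exact: lphi_measurable.
Qed.

Definition pospart l (u : R) : \bar R := (Num.max (u - l) 0)%:E.

Lemma pospart_measurable l : measurable_fun setT (pospart l).
Proof.
by apply/measurable_EFinP; apply: measurable_maxr => //; exact: measurable_funB.
Qed.

Lemma pospart_ge0 l u : (0 <= pospart l u)%E.
Proof. by rewrite lee_fin le_max lexx orbT. Qed.

Lemma pospart0 u : 0 <= u -> pospart 0 u = u%:E.
Proof. by move=> u0; rewrite /pospart subr0 max_l. Qed.

Lemma int_frearr F : measurable_fun setT F -> (forall x, 0 <= F x) ->
  (\int[mu]_(x in D) (F x)%:E = \int[mu]_(t in D2) (frearr F t)%:E)%E.
Proof.
move=> mF F0; have := equimeasurable mF F0 (pospart_measurable 0) (pospart_ge0 0).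
have -> : (\int[mu]_(x in D) pospart 0 (F x) = \int[mu]_(x in D) (F x)%:E)%E.
  by apply: eq_integral => x _; rewrite pospart0.
move=> ->; apply: eq_integral => t _; rewrite pospart0//; exact: frearr_ge0.
Qed.

Lemma int_le_zyg_norm F : measurable_fun setT F -> (forall x, 0 <= F x) ->
  (\int[mu]_(x in D) (F x)%:E <= zyg_norm F)%E.
Proof.
move=> mF F0; rewrite int_frearr//; apply: ge0_le_integral => //.
- by move=> t _; rewrite lee_fin frearr_ge0.
- by apply: measurable_funTS; apply/measurable_EFinP; exact: frearr_measurable.
- by apply: measurable_funTS; exact: fsl_measurable.
- move=> t /in_D2 t02; rewrite lee_fin ler_peMr ?frearr_ge0//; exact: lphi_ge1.
Qed.

Lemma frearr_le_zyg_norm F t : measurable_fun setT F -> 0 < t < 2 -> ((frearr F t * t)%:E <= zyg_norm F)%E.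
Proof.
move=> mF t02; have /andP[t0 t2] := t02.
have sub : `]0, t[%classic `<=` D2.
  by move=> s /=; rewrite !in_itv/= => /andP[-> st]; exact: lt_trans st t2.
apply: (@le_trans _ _ (\int[mu]_(s in `]0%R, t[) (frearr F s * lphi s)%:E)%E); last first.
  apply: ge0_subset_integral => //.
    by apply: measurable_funTS; exact: fsl_measurable.
  by move=> s /in_D2 s02; rewrite lee_fin fsl_ge0.
apply: (@le_trans _ _ (\int[mu]_(s in `]0%R, t[) (cst (frearr F t)%:E) s)%E).
  by rewrite integral_cst//= [X in (_ * X)%E](lebesgue_measure_itv `]0, t[)/= lte_fin t0 sube0 -EFinM.
apply: ge0_le_integral => //.
- by move=> s _; rewrite lee_fin frearr_ge0.
- by apply: measurable_funTS; exact: fsl_measurable.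
- move=> s st; have s02 := in_D2 (sub s st); move: st; rewrite /= in_itv/= => /andP[s0 st].
  rewrite lee_fin; apply: (@le_trans _ _ (frearr F s)); first exact: frearr_nonincr (ltW st) _.
  by rewrite ler_peMr ?frearr_ge0//; exact: lphi_ge1.
Qed.

Lemma zyg_norm_Psi F : measurable_fun setT F -> (forall x, 0 <= F x) -> (zyg_norm F < +oo)%E ->
  (\int[mu]_(x in D) (Psi (F x))%:E < +oo)%E.
Proof.
move=> mF F0 Foo.
have nF0 : (0 <= zyg_norm F)%E by apply: integral_ge0 => t /in_D2 t02; rewrite lee_fin fsl_ge0.
pose A := fine (zyg_norm F).
have AE : A%:E = zyg_norm F by rewrite fineK// ge0_fin_numE.
have A0 : 0 <= A by rewrite fine_ge0.
(* The maximum makes the integrand nonnegative on the whole line, as [equimeasurable] demands. *)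
pose Phi (u : R) : \bar R := (Psi (Num.max u 0))%:E.
have mPhi : measurable_fun setT Phi.
  apply/measurable_EFinP; apply: (measurableT_comp (@measurable_Psi R)).
  by apply: measurable_maxr.
have Phi0 u : (0 <= Phi u)%E by rewrite lee_fin Psi_ge0// le_max lexx orbT.
have PhiE u : 0 <= u -> Phi u = (Psi u)%:E by move=> u0; rewrite /Phi max_l.
have <- : (\int[mu]_(x in D) Phi (F x) = \int[mu]_(x in D) (Psi (F x))%:E)%E.
  by apply: eq_integral => x _; rewrite PhiE.
rewrite (equimeasurable mF F0 mPhi Phi0).
pose K := ln (1 + A) + 1.
have K0 : 0 <= K by rewrite addr_ge0// ln_ge0// lerDl.
apply: (@le_lt_trans _ _ (\int[mu]_(t in D2) (K%:E * (frearr F t * lphi t)%:E))%E); last first.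
  rewrite ge0_integralZl//.
  - by rewrite -/(zyg_norm F) -AE -EFinM ltry.
  - by apply: measurable_funTS; exact: fsl_measurable.
  - by move=> t /in_D2 t02; rewrite lee_fin fsl_ge0.
apply: ge0_le_integral => //.
- by apply: measurable_funTS; apply: measurableT_comp => //; exact: frearr_measurable.
- apply: measurable_funTS; apply: emeasurable_funM => //; exact: fsl_measurable.
- move=> t /in_D2 t02; have /andP[t0 t2] := t02.
  rewrite PhiE ?frearr_ge0// -EFinM lee_fin mulrCA; apply: ler_wpM2l; first exact: frearr_ge0.
  have ft : frearr F t * t <= A by rewrite -lee_fin AE frearr_le_zyg_norm.
  have l1 := lphi_ge1 t02.
  apply: (@le_trans _ _ (ln (1 + A) + lphi t)).
    have ee : 1 <= expR 1 :> R by rewrite -[leLHS]expR0 ler_expR.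
    have q1 : 1 <= 2 * expR 1 / t by rewrite ler_pdivlMr// mul1r; lra.
    have q0 : 0 < 2 * expR 1 / t by apply: lt_le_trans q1.
    rewrite /lphi -lnM ?posrE ?ltr_pwDl// ler_ln ?posrE ?ltr_pwDl ?frearr_ge0//; last first.
      by rewrite mulr_gt0// ltr_pwDl.
    rewrite mulrDl mul1r; apply: lerD => //.
    rewrite mulrA ler_pdivlMr// (le_trans ft)// ler_peMr//; lra.
  have L0 : 0 <= ln (1 + A) by rewrite ln_ge0// lerDl.
  rewrite /K; nra.
Qed.

Definition head_int F s : \bar R := (\int[mu]_(t in `]0%R, s[) (frearr F t)%:E)%E.

Lemma head_int_ge0 F s : (0 <= head_int F s)%E.
Proof. by apply: integral_ge0 => t _; rewrite lee_fin frearr_ge0. Qed.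

Lemma sub0s s : s <= 2 -> `]0, s[%classic `<=` D2.
Proof. by move=> s2 t /=; rewrite !in_itv/= => /andP[-> ts]; exact: lt_le_trans ts s2. Qed.

Lemma pp_fs_measurable F l : measurable_fun setT F -> measurable_fun setT (fun t => pospart l (frearr F t)).
Proof.
by move=> mF; apply: (measurableT_comp (pospart_measurable l)); exact: frearr_measurable.
Qed.

Lemma int_pp_add F l s : measurable_fun setT F -> 0 <= l -> 0 < s ->
  (\int[mu]_(t in `]0%R, s[) (pospart l (frearr F t) + l%:E) =
   \int[mu]_(t in `]0%R, s[) pospart l (frearr F t) + (s * l)%:E)%E.
Proof.
move=> mF l0 s0; rewrite ge0_integralD//; [|by move=> t _; exact: pospart_ge0|by apply: measurable_funTS; exact: pp_fs_measurable].
rewrite integral_cst//= [X in (_ + _ * X)%E](lebesgue_measure_itv `]0, s[)/= lte_fin s0 sube0 -EFinM.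
by rewrite mulrC.
Qed.

(* K_ge and K_eq: the integral of the rearrangement of F over (0, s) is the minimum
   over l of int (F - l)^+ + s l, which is attained at l = frearr F s. *)
Lemma K_ge F l s : measurable_fun setT F -> (forall x, 0 <= F x) -> 0 <= l -> 0 < s <= 2 ->
  (head_int F s <= \int[mu]_(x in D) pospart l (F x) + (s * l)%:E)%E.
Proof.
move=> mF F0 l0 /andP[s0 s2].
rewrite (equimeasurable mF F0 (pospart_measurable l) (pospart_ge0 l)).
apply: (@le_trans _ _ (\int[mu]_(t in `]0%R, s[) pospart l (frearr F t) + (s * l)%:E)%E); last first.
  rewrite leeD2r//; apply: ge0_subset_integral => //.
  - by apply: measurable_funTS; exact: pp_fs_measurable.
  - by move=> t _; exact: pospart_ge0.
  - exact: sub0s.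
rewrite -int_pp_add//; apply: ge0_le_integral => //.
- by move=> t _; rewrite lee_fin frearr_ge0.
- by apply: measurable_funTS; apply/measurable_EFinP; exact: frearr_measurable.
- by apply: emeasurable_funD => //; apply: measurable_funTS; exact: pp_fs_measurable.
- by move=> t _; rewrite /pospart -EFinD lee_fin -lerBlDr le_max lexx.
Qed.

Lemma K_eq F s : measurable_fun setT F -> (forall x, 0 <= F x) -> 0 < s < 2 ->
  (\int[mu]_(x in D) pospart (frearr F s) (F x) + (s * frearr F s)%:E = head_int F s)%E.
Proof.
move=> mF F0 /andP[s0 s2]; set l := frearr F s.
have l0 : 0 <= l by exact: frearr_ge0.
rewrite (equimeasurable mF F0 (pospart_measurable l) (pospart_ge0 l)).
have sD := sub0s (ltW s2).
have -> : (\int[mu]_(t in D2) pospart l (frearr F t) = \int[mu]_(t in `]0%R, s[) pospart l (frearr F t))%E.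
  rewrite -[in RHS](setIidr sD) integral_mkcondr; apply: eq_integral => t /set_mem/in_D2/andP[t0 t2].
  rewrite /patch; case: ifPn => //; rewrite notin_setE/= in_itv/= t0/= => /negP; rewrite -leNgt => st.
  by rewrite /pospart max_r// subr_le0 frearr_nonincr.
rewrite -int_pp_add//; apply: eq_integral => t /set_mem/=; rewrite in_itv/= => /andP[t0 ts].
rewrite /pospart max_l; first by rewrite -EFinD subrK.
by rewrite subr_ge0 frearr_nonincr// ltW.
Qed.

Lemma int_le_add F G H (A : set R) : measurable A -> measurable_fun setT F -> measurable_fun setT G ->
  measurable_fun setT H -> (forall x, 0 <= F x) -> (forall x, 0 <= G x) -> (forall x, 0 <= H x) ->
  (forall x, A x -> H x <= F x + G x) ->
  (\int[mu]_(x in A) (H x)%:E <= \int[mu]_(x in A) (F x)%:E + \int[mu]_(x in A) (G x)%:E)%E.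
Proof.
move=> mA mF mG mH F0 G0 H0 HFG.
rewrite -ge0_integralD//; last 4 first.
- by move=> x _; rewrite lee_fin.
- by apply: measurable_funTS; exact/measurable_EFinP.
- by move=> x _; rewrite lee_fin.
- by apply: measurable_funTS; exact/measurable_EFinP.
apply: ge0_le_integral => //.
- by move=> x _; rewrite lee_fin.
- by apply: measurable_funTS; exact/measurable_EFinP.
- by apply: measurable_funTS; apply/measurable_EFinP; exact: measurable_funD.
Qed.

(** Take the levels l and k at which the minima for [F] and [G] are attained. Then l + k is
    admissible for [H], and (F + G - l - k)^+ <= (F - l)^+ + (G - k)^+. *)
Lemma head_int_sub F G H s : measurable_fun setT F -> measurable_fun setT G -> measurable_fun setT H ->
  (forall x, 0 <= F x) -> (forall x, 0 <= G x) -> (forall x, 0 <= H x) ->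
  (forall x, D x -> H x <= F x + G x) -> 0 < s < 2 -> (head_int H s <= head_int F s + head_int G s)%E.
Proof.
move=> mF mG mH F0 G0 H0 HFG s02; have /andP[s0 s2] := s02.
rewrite -(K_eq mF F0 s02) -(K_eq mG G0 s02).
set l := frearr F s; set k := frearr G s.
have l0 : 0 <= l by exact: frearr_ge0.
have k0 : 0 <= k by exact: frearr_ge0.
have s02' : 0 < s <= 2 by rewrite s0 ltW.
apply: (le_trans (K_ge mH H0 (addr_ge0 l0 k0) s02')).
rewrite addeACA -EFinD -mulrDr leeD2r//.
apply: int_le_add.
- exact: mD.
- by apply/measurable_EFinP; apply: (measurableT_comp (pospart_measurable l)).
- by apply/measurable_EFinP; apply: (measurableT_comp (pospart_measurable k)).
- by apply/measurable_EFinP; apply: (measurableT_comp (pospart_measurable (l + k))).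
- by move=> x; rewrite le_max lexx orbT.
- by move=> x; rewrite le_max lexx orbT.
- by move=> x; rewrite le_max lexx orbT.
- move=> x Dx; have h := HFG x Dx.
  have h1 : F x - l <= Num.max (F x - l) 0 by rewrite le_max lexx.
  have h2 : G x - k <= Num.max (G x - k) 0 by rewrite le_max lexx.
  have h3 : 0 <= Num.max (F x - l) 0 by rewrite le_max lexx orbT.
  have h4 : 0 <= Num.max (G x - k) 0 by rewrite le_max lexx orbT.
  by rewrite ge_max; apply/andP; split; lra.
Qed.

Lemma int_invs t : 0 < t < 2 -> (\int[mu]_(s in `]t, 2%R[) (s^-1)%:E = (ln 2 - ln t)%:E)%E.
Proof.
move=> /andP[t0 t2].
have cV s : t <= s <= 2 -> {for s, continuous (fun s => s^-1)}.
  by move=> /andP[ts _]; apply: ctV; [rewrite gt_eqF// (lt_le_trans t0)|exact: ctI].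
have I : intble mu `]t, 2[ (fun s => s^-1).
  have I2 : intble mu `[t, 2] (fun s => s^-1) by exact: continuous_intble.
  by apply: intbleS I2 => //; exact: subset_itv_oo_cc.
rewrite RintE//; congr EFin; apply: (@ftc_oo_cc _ (fun s => s^-1) (@ln R)) => // s /andP[ts _].
by apply: is_derive1_ln; exact: lt_le_trans ts.
Qed.

(** The rearrangement is not subadditive pointwise, but its integrals over (0, s) are; Tonelli
    expresses the norm through these alone. *)
Lemma zyg_normE F : measurable_fun setT F ->
  (zyg_norm F = \int[mu]_(t in D2) (frearr F t)%:E + \int[mu]_(s in D2) ((s^-1)%:E * head_int F s))%E.
Proof.
move=> mF; have mfs := frearr_measurable mF.
(* The absolute value only matters outside the square (0, 2)^2; it makes the kernel nonnegative
   everywhere. *)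
pose K (z : R * R) : \bar R := (if z.1 < z.2 then `|frearr F z.1 * z.2^-1| else 0)%:E.
have mK : measurable_fun setT K.
  apply/measurable_EFinP; apply: measurable_fun_ifT => //.
    by apply: measurable_fun_ltr; [exact: measurable_fst|exact: measurable_snd].
  apply: measurableT_comp => //; apply: measurable_funM.
    exact: (measurableT_comp mfs measurable_fst).
  exact: (measurableT_comp (@measurable_inv R) measurable_snd).
have K0 z : (0 <= K z)%E by rewrite lee_fin; case: ifP.
have mD2 : measurable (D2 : set R) by exact: measurable_itv.
have E1 t : 0 < t < 2 -> (\int[mu]_(s in D2) K (t, s) = (frearr F t * (ln 2 - ln t))%:E)%E.
  move=> t02; have /andP[t0 t2] := t02.
  have sub : `]t, 2[%classic `<=` D2.
    by move=> s /=; rewrite !in_itv/= => /andP[ts ->]; rewrite (lt_trans t0 ts).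
  rewrite EFinM -int_invs// -ge0_integralZl//; last 3 first.
  - apply/measurable_EFinP; apply: measurable_funTS; exact: measurable_inv.
  - by move=> s /=; rewrite in_itv/= => /andP[ts _]; rewrite lee_fin invr_ge0 ltW// (lt_trans t0).
  - by rewrite lee_fin frearr_ge0.
  rewrite -[in RHS](setIidr sub) integral_mkcondr; apply: eq_integral => s /set_mem/in_D2/andP[s0 s2].
  rewrite /K /patch mem_setE in_itv/= s2 andbT; case: ifP => // _.
  by rewrite -EFinM ger0_norm// mulr_ge0 ?frearr_ge0// invr_ge0 ltW.
have E2 s : 0 < s < 2 -> (\int[mu]_(t in D2) K (t, s) = (s^-1)%:E * head_int F s)%E.
  move=> /andP[s0 s2]; have sub := sub0s (ltW s2).
  rewrite /head_int -ge0_integralZl//; last 3 first.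
  - by apply/measurable_EFinP; exact: measurable_funTS.
  - by move=> t _; rewrite lee_fin frearr_ge0.
  - by rewrite lee_fin invr_ge0 ltW.
  rewrite -[in RHS](setIidr sub) integral_mkcondr; apply: eq_integral => t /set_mem/in_D2/andP[t0 t2].
  rewrite /K /patch mem_setE in_itv/= t0/=; case: ifP => // _.
  by rewrite -EFinM ger0_norm 1?mulrC// mulr_ge0 ?frearr_ge0// invr_ge0 ltW.
have -> : (\int[mu]_(s in D2) ((s^-1)%:E * head_int F s) = \int[mu]_(s in D2) \int[mu]_(t in D2) K (t, s))%E.
  by apply: eq_integral => s /set_mem/in_D2 s02; rewrite E2.
rewrite -(@tonelli_on _ _ _ _ _ mu mu D2 D2 K mD2 mD2 mK K0) -ge0_integralD//; last 4 first.
- by move=> t _; rewrite lee_fin frearr_ge0.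
- by apply/measurable_EFinP; exact: measurable_funTS.
- by move=> t _; exact: integral_ge0.
- by apply: measurable_funTS; exact: measurable_ge0_inner.
apply: eq_integral => t /set_mem/in_D2 t02; rewrite E1// -EFinD lphiE; last by case/andP: t02.
by congr EFin; ring.
Qed.

Lemma zyg_norm_triangle F G H : measurable_fun setT F -> measurable_fun setT G -> measurable_fun setT H ->
  (forall x, 0 <= F x) -> (forall x, 0 <= G x) -> (forall x, 0 <= H x) ->
  (forall x, D x -> H x <= F x + G x) -> (zyg_norm H <= zyg_norm F + zyg_norm G)%E.
Proof.
move=> mF mG mH F0 G0 H0 HFG.
(* Measurability in [s] is that of a partial integral of a jointly measurable kernel, the variable
   bound being moved into the integrand. *)
have mhead (E : R -> R) : measurable_fun setT E -> measurable_fun D2 (fun s => (s^-1)%:E * head_int E s)%E.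
  move=> mE; pose K (z : R * R) : \bar R := (if (0 < z.2) && (z.2 < z.1) then frearr E z.2 else 0)%:E.
  have mK : measurable_fun setT K.
    apply/measurable_EFinP; apply: measurable_fun_ifT => //.
      apply: measurable_and; apply: measurable_fun_ltr => //;
        by [exact: measurable_fst|exact: measurable_snd].
    exact: (measurableT_comp (frearr_measurable mE) measurable_snd).
  have K0 z : (0 <= K z)%E by rewrite lee_fin; case: ifP => // _; exact: frearr_ge0.
  have mI := @measurable_ge0_inner _ _ _ _ _ mu setT K measurableT mK K0.
  apply: emeasurable_funM.
    by apply/measurable_EFinP; apply: measurable_funTS; exact: measurable_inv.
  apply: (eq_measurable_fun (fun s => \int[mu]_(t in setT) K (s, t))%E).
    move=> s _; rewrite /head_int [RHS]integral_mkcond; apply: eq_integral => t _.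
    by rewrite /K /patch mem_setE in_itv/=; case: ifP.
  exact: measurable_funTS.
have IF0 (E : R -> R) s : D2 s -> (0 <= (s^-1)%:E * head_int E s)%E.
  by move=> /in_D2/andP[s0 _]; rewrite mule_ge0 ?head_int_ge0// lee_fin invr_ge0 ltW.
rewrite (zyg_normE mF) (zyg_normE mG) (zyg_normE mH) [leRHS]addeACA; apply: leeD.
  by rewrite -!int_frearr//; apply: int_le_add => //; exact: mD.
rewrite -ge0_integralD//; [|by move=> s; exact: IF0|exact: mhead|by move=> s; exact: IF0|exact: mhead].
apply: ge0_le_integral => //.
- by move=> s; exact: IF0.
- exact: mhead.
- by apply: emeasurable_funD; exact: mhead.
- move=> s /in_D2 s02; have /andP[s0 _] := s02.
  rewrite -ge0_muleDr ?head_int_ge0//; apply: lee_wpmul2l; first by rewrite lee_fin invr_ge0 ltW.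
  exact: head_int_sub.
Qed.

Lemma zyg_norm_scale F G c : measurable_fun setT F -> measurable_fun setT G -> 0 <= c ->
  (forall x, D x -> G x = c * F x) -> (zyg_norm G <= c%:E * zyg_norm F)%E.
Proof.
move=> mF mG c0 GF.
have le t : 0 < t < 2 -> frearr G t <= c * frearr F t.
  move=> t02; have f0 := frearr_ge0 F t; rewrite leNgt; apply/negP; rewrite frearr_gt ?mulr_ge0// => h.
  have [c1|c1] := eqVneq c 0.
    move: h; rewrite /distrib (_ : _ `&` _ = set0) ?measure0 ?lte_fin; last first.
      by apply/seteqP; split=> // x [Dx] /=; rewrite GF// c1 !mul0r ltxx.
    by case/andP: t02 => t0 _; rewrite ltNge (ltW t0).
  have c2 : 0 < c by rewrite lt_def c1.
  have := ltxx (frearr F t); rewrite frearr_gt// => /negbT/negP; apply; apply: (lt_le_trans h).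
  apply: le_measure; rewrite ?inE; [exact: mlev|exact: mlev|].
  by move=> x [Dx] /=; rewrite GF// ltr_pM2l.
rewrite /zyg_norm -ge0_integralZl//; last 2 first.
- by apply: measurable_funTS; exact: fsl_measurable.
- by move=> t /in_D2 t02; rewrite lee_fin fsl_ge0.
apply: ge0_le_integral => //.
- by move=> t /in_D2 t02; rewrite lee_fin fsl_ge0.
- by apply: measurable_funTS; exact: fsl_measurable.
- by apply: measurable_funTS; apply: emeasurable_funM => //; exact: fsl_measurable.
- move=> t /in_D2 t02; rewrite -EFinM lee_fin mulrA ler_wpM2r ?le//.
  by rewrite (le_trans _ (lphi_ge1 t02)).
Qed.

(** With q = (t/2)^(1/4), the rearrangement of 1/w is at most q^-2 and the logarithm at most 4/q.
    The product 4/q^3 has the primitive 32 q, continuous at 0. *)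
Definition fourth_root t : R := Num.sqrt (Num.sqrt (t / 2)).

Lemma fourth_root_gt0 t : 0 < t -> 0 < fourth_root t.
Proof. by move=> t0; rewrite !sqrtr_gt0 divr_gt0. Qed.

Lemma der_fourth_root t : 0 < t -> is_derive t 1 fourth_root ((8 * fourth_root t ^+ 3)^-1).
Proof.
move=> t0; have t2 : 0 < t / 2 by rewrite divr_gt0.
have s0 : 0 < Num.sqrt (t / 2) by rewrite sqrtr_gt0.
have q0 := fourth_root_gt0 t0.
have dh : is_derive t 1 (fun t : R => t / 2) (2^-1).
  by apply: der_eq (derM (derI t) (derC 2^-1 t)) _; ring.
apply: der_eq (der_comp (f := Num.sqrt) (g := fun t => Num.sqrt (t / 2)) (is_derive1_sqrt s0)
  (der_comp (f := Num.sqrt) (g := fun t => t / 2) (is_derive1_sqrt t2) dh)) _.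
rewrite -/(fourth_root t).
have E : Num.sqrt (t / 2) = fourth_root t ^+ 2 by rewrite sqr_sqrtr ?sqrtr_ge0.
rewrite E; field.
by rewrite gt_eqF.
Qed.

Lemma int_fourth_root : (\int[mu]_(t in D2) (4 / fourth_root t ^+ 3)%:E < +oo)%E.
Proof.
have cq : continuous fourth_root.
  move=> t; apply: (@ct_comp _ Num.sqrt (fun t => Num.sqrt (t / 2))); first exact: sqrt_continuous.
  apply: (@ct_comp _ Num.sqrt (fun t => t / 2)); first exact: sqrt_continuous.
  by apply: ctM; [exact: ctI|exact: ctC].
have c32 t : {for t, continuous (fun t => 32 * fourth_root t)} by apply: ctM; [exact: ctC|exact: cq].
have [I E] : intble mu D2 (fun t => 4 / fourth_root t ^+ 3) /\
   \int[mu]_(t in D2) (4 / fourth_root t ^+ 3) = 32 * fourth_root 2 - 32 * fourth_root 0.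
  apply: (@ftc_oo _ (fun t => 4 / fourth_root t ^+ 3) (fun t => 32 * fourth_root t) 0 2).
  - exact: ltr0n.
  - move=> t /andP[t0 _]; have q0 := fourth_root_gt0 t0.
    by apply: der_eq (derZ 32 (der_fourth_root t0)) _; field; rewrite gt_eqF.
  - move=> t /andP[t0 _]; have q0 := fourth_root_gt0 t0.
    apply: ctM; first exact: ctC.
    apply: ctV; first by rewrite gt_eqF// exprn_gt0.
    by rewrite (_ : (fun t => _) = fun t => fourth_root t * (fourth_root t * fourth_root t))//;
      apply: ctM => //; [exact: cq|apply: ctM; exact: cq].
  - by move=> t /andP[t0 _]; rewrite divr_ge0// exprn_ge0// ltW// fourth_root_gt0.
  - by apply: cvg_at_right_filter; exact: c32.
  - by apply: cvg_at_left_filter; exact: c32.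
by rewrite RintE// ltry.
Qed.

(** Where 1/w > l one has 1 - |x| <= 1 - x^2 < l^-2, so the set lies within l^-2 of the end points.
    For l <= 1 the trivial bound 2 suffices. *)
Lemma distrib_iw l : 0 < l -> (distrib (fun x : R => ((w x)^-1)%R) l <= (2 / l ^+ 2)%:E)%E.
Proof.
move=> l0; have [l1|l1] := leP l 1.
  apply: (le_trans (distrib_le2 _ (@inv_weight_measurable R))); rewrite lee_fin ler_pdivlMr ?exprn_gt0//.
  by rewrite ler_piMr// expr_le1// ltW.
set e := l ^- 2.
have e0 : 0 < e by rewrite invr_gt0 exprn_gt0.
have e1 : e < 1 by rewrite invf_lt1 ?exprn_gt0// exprn_egt1.
have sub : D `&` [set x | l < (w x)^-1] `<=` `]-1, (-1 + e)[ `|` `](1 - e), 1[.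
  move=> x [Dx /= lx]; have x1 : -1 < x < 1 by exact/inD.
  have wx := weight_gt0 x1; have /andP[x2 x3] := x1.
  have w1 : w x < l^-1 by rewrite -[w x]invrK ltf_pV2 ?posrE ?invr_gt0.
  have w2 : 1 - x ^+ 2 < e.
    rewrite -weight_sqr ?(ltW x2) ?(ltW x3)// /e -exprVn ltr_pXn2r// nnegrE ltW// invr_gt0//.
  have [x0|x0] := leP 0 x; [right|left]; rewrite /= in_itv/=; apply/andP; split; nra.
have m1 : measurable (`]-1, (-1 + e)[%classic : set R) by exact: measurable_itv.
have m2 : measurable (`](1 - e), 1[%classic : set R) by exact: measurable_itv.
apply: (@le_trans _ _ (mu (`]-1, (-1 + e)[ `|` `](1 - e), 1[))).
  apply: le_measure; rewrite ?inE//; last exact: measurableU.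
  by apply: mlev; [exact: mD|exact: inv_weight_measurable].
apply: (le_trans (@measureU2 _ _ _ mu _ _ m1 m2)).
rewrite [X in (X + _)%E](lebesgue_measure_itv `]-1, (-1 + e)[)/= [X in (_ + X)%E](lebesgue_measure_itv `](1 - e), 1[)/=.
rewrite !lte_fin ltrDl e0 gtrBl e0 -!EFinD lee_fin -/e.
by lra.
Qed.

Lemma zyg_norm_iw_fin : (zyg_norm (fun x : R => ((w x)^-1)%R) < +oo)%E.
Proof.
have mi := @inv_weight_measurable R.
apply: le_lt_trans int_fourth_root; apply: ge0_le_integral => //.
- by move=> t /in_D2 t02; rewrite lee_fin fsl_ge0.
- by apply: measurable_funTS; exact: fsl_measurable.
- apply/measurable_EFinP; apply: measurable_funTS; apply: measurable_funM => //.
  apply: (measurableT_comp (@measurable_inv R)); apply: measurable_funX.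
  apply: continuous_measurable_fun => t; apply: (@ct_comp _ Num.sqrt (fun t => Num.sqrt (t / 2))); first exact: sqrt_continuous.
  apply: (@ct_comp _ Num.sqrt (fun t => t / 2)); first exact: sqrt_continuous.
  by apply: ctM; [exact: ctI|exact: ctC].
- move=> t /in_D2 t02; have /andP[t0 t2] := t02; rewrite lee_fin.
  (* Here t = 2 r^-4, so the logarithm is 1 + 4 ln r, which is at most 4 r - 3. *)
  set r := (fourth_root t)^-1.
  have q0 := fourth_root_gt0 t0.
  have r0 : 0 < r by rewrite invr_gt0.
  have q4 : fourth_root t ^+ 2 ^+ 2 = t / 2.
    by rewrite /fourth_root sqr_sqrtr ?sqrtr_ge0// sqr_sqrtr// divr_ge0// ltW.
  have tr : t = 2 / r ^+ 2 ^+ 2.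
    by rewrite /r !exprVn invrK q4; field.
  have r2 : 0 < r ^+ 2 by rewrite exprn_gt0.
  have f1 : frearr (fun x : R => ((w x)^-1)%R) t <= r ^+ 2.
    rewrite leNgt; apply/negP; rewrite frearr_gt ?(ltW r2)// => h.
    by have := lt_le_trans h (distrib_iw r2); rewrite -tr ltxx.
  have l1 : lphi t <= 4 * r - 3.
    rewrite lphiE// {1}tr lnM ?posrE ?invr_gt0 ?exprn_gt0// lnV ?posrE ?exprn_gt0// !lnXn ?exprn_gt0//.
    have := ln_le_sub1 r0; rewrite !mulr2n; lra.
  have l2 := lphi_ge1 t02.
  rewrite (_ : 4 / fourth_root t ^+ 3 = 4 * (r ^+ 2 * r)); last by rewrite /r; field; rewrite gt_eqF.
  apply: (@le_trans _ _ (r ^+ 2 * (4 * r - 3))).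
    by apply: ler_pM => //; [exact: frearr_ge0|lra].
  by nra.
Qed.
End ZygmundNorm.

(** * Lebesgue measurable and Borel functions *)

Section Completion.
Context (R : realType).
Notation mu := (@lebesgue_measure R).
Notation cmu := (@completed_lebesgue_measure R).
Notation cT := (caratheodory_type (wlength (@idfun R))^*%mu).
Notation D := (`]-1, 1[%classic : set R).
Implicit Types (h F : R -> R) (A N : set R).

Lemma borel_completed_measurable A : measurable A -> @measurable _ cT A.
Proof. exact: sub_caratheodory. Qed.

Lemma completed_measurable_split A : @measurable _ cT A ->
  exists X N, [/\ measurable X, mu.-negligible N & A = X `|` N].
Proof.
move=> mA.
have : completed_algebra_gen mu A.
  by rewrite -g_sigma_completed_algebra_genE completed_caratheodory_measurable.
by move=> [X mX [N N0 <-]]; exists X, N.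
Qed.

Lemma negligible_completed A : mu.-negligible A <-> cmu.-negligible A.
Proof.
split=> [[B [mB B0 AB]]|[B [mB B0 AB]]].
  by exists B; split=> //; exact: borel_completed_measurable.
have [X [N [mX N0 BE]]] := completed_measurable_split mB.
have {}AB : A `<=` X `|` N by rewrite -BE.
apply: (@negligibleS _ _ _ mu _ _ AB); apply: negligibleU => //.
exists X; split=> //; apply/eqP; rewrite eq_le measure_ge0 andbT.
have <- : cmu B = 0%E by [].
by apply: le_outer_measure; rewrite BE.
Qed.

Lemma ae_completed (P : R -> Prop) : {ae mu, forall x, P x} <-> {ae cmu, forall x, P x}.
Proof. exact: negligible_completed. Qed.

Lemma negligible_bigcup_countable (I : countType) (N : I -> set R) :
  (forall i, mu.-negligible (N i)) -> mu.-negligible (\bigcup_i N i).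
Proof.
move=> N0.
rewrite (_ : \bigcup_i N i = \bigcup_n (if unpickle n is Some i then N i else set0)).
  apply: negligible_bigcup => n; case: (unpickle n) => [i|]; first exact: N0.
  exact: negligible_set0.
apply/seteqP; split=> [x [i _ Nx]|x [n _]].
  by exists (pickle i) => //; rewrite pickleK.
by case: (unpickle n) => // i Nx; exists i.
Qed.

(** For each rational threshold the set below it is Borel up to a null set. Off the union of these
    countably many null sets, [h] is Borel; it is replaced by 0 on them. *)
Lemma lebesgue_borel h : lebesgue_measurable D h ->
  exists2 F, measurable_fun setT F & {ae mu, forall x, D x -> h x = F x}.
Proof.
move=> mh.
have mDc : @measurable _ cT D by apply: borel_completed_measurable; exact: mD.
have sp (q : rat) : exists X N, [/\ measurable X, mu.-negligible N &
    D `&` h @^-1` `]-oo, ratr q[ = X `|` N].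
  by apply: completed_measurable_split; apply: mh => //; exact: measurable_itv.
have [X /choice[N0 XN0]] := choice sp.
have XN q : exists N, [/\ measurable N, mu N = 0%E & N0 q `<=` N].
  by have [_ [N Nq] _] := XN0 q; exists N.
have {XN}[N NP] := choice XN.
pose M := \bigcup_q N q.
have mM : measurable M by apply: bigcupT_measurable_rat => q; have [] := NP q.
have M0 : mu.-negligible M.
  by apply: negligible_bigcup_countable => q; have [m1 m2 _] := NP q; exists (N q); split.
have mDM : measurable (D `\` M) by apply: measurableD => //; exact: mD.
have mhM : measurable_fun (D `\` M) h.
  apply: (measurability _ (RGenInftyO.measurableE R)) => // _ [_ [x ->] <-].
  rewrite (_ : _ `&` _ = \bigcup_(q : rat) (if ratr q < x then X q `\` M else set0)).
    apply: bigcupT_measurable_rat => q; case: ifP => // _.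
    by apply: measurableD => //; have [] := XN0 q.
  apply/seteqP; split=> [y [[Dy My]] /=|y [q _]].
    rewrite in_itv/= => hx; have [q] := rat_in_itvoo hx.
    rewrite in_itv/= => /andP[hq qx]; exists q => //; rewrite qx; split=> //.
    have [_ _ E] := XN0 q.
    have : (D `&` h @^-1` `]-oo, ratr q[) y by split=> //=; rewrite in_itv.
    rewrite E => -[//|N0y]; exfalso; apply: My; exists q => //.
    by have [_ _] := NP q; exact.
  case: ifP => // qx [Xy My]; have [_ _ E] := XN0 q.
  have : (D `&` h @^-1` `]-oo, ratr q[) y by rewrite E; left.
  by move=> [Dy /=]; rewrite in_itv/= => hq; split=> //=; rewrite in_itv/= (lt_trans hq).
exists (h \_ (D `\` M)); first exact: (measurable_restrictT h mDM).1 mhM.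
apply: negligibleS M0 => x /= nx; apply: contrapT => Mx; apply: nx => Dx.
by rewrite /patch ifT// inE; split.
Qed.

Lemma ae_borel_lebesgue A h F : measurable A -> measurable_fun A F ->
  {ae mu, forall x, A x -> h x = F x} ->
  @measurable_fun _ _ cT (measurableTypeR R) A h.
Proof.
move=> mA mF hF.
have mFc : @measurable_fun _ _ cT (measurableTypeR R) A F.
  by move=> _ B mB; apply: borel_completed_measurable; exact: mF.
have mFe : @measurable_fun _ _ cT (\bar R) A (EFin \o F) by exact/measurable_EFinP.
have mhe : @measurable_fun _ _ cT (\bar R) A (EFin \o h).
  apply: (@ae_measurable_fun _ cT R cmu (@completed_lebesgue_measure_is_complete R) A (EFin \o F)) => //.
  by apply/ae_completed; apply: ae_imp hF => x Fx Ax /=; rewrite Fx.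
exact/measurable_EFinP.
Qed.

(** The identity map is measurable from the completed to the Borel sigma-algebra and carries the
    completed measure to Lebesgue measure. *)
Lemma ge0_integral_completed A (F : R -> \bar R) : measurable A -> measurable_fun A F ->
  (forall x, 0 <= F x)%E -> (\int[cmu]_(x in A) F x = \int[mu]_(x in A) F x)%E.
Proof.
move=> mA mF F0.
have mid : @measurable_fun _ _ cT (measurableTypeR R) setT (@idfun R).
  by move=> _ B mB; rewrite setTI; exact: borel_completed_measurable.
have := @ge0_integral_pushforward _ _ cT (measurableTypeR R) R (@idfun R) mid cmu A F mA mF (fun x _ => F0 x).
rewrite preimage_id => <-; apply: eq_measure_integral => B mB BA.
exact: (congr1 mu (preimage_id B)).
Qed.

Lemma integral_completed A (F : R -> \bar R) : measurable A -> measurable_fun A F ->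
  (\int[cmu]_(x in A) F x = \int[mu]_(x in A) F x)%E.
Proof.
move=> mA mF; rewrite integralE [RHS]integralE !ge0_integral_completed//.
  exact: measurable_funeneg.
exact: measurable_funepos.
Qed.

Lemma integral_completed_ae A (H F : R -> R) : measurable A -> measurable_fun A F ->
  {ae mu, forall x, A x -> H x = F x} ->
  (\int[cmu]_(x in A) (H x)%:E = \int[mu]_(x in A) (F x)%:E)%E.
Proof.
move=> mA mF HF; rewrite -integral_completed//; last exact/measurable_EFinP.
apply: (@ae_eq_integral _ cT R cmu) => //.
- exact: borel_completed_measurable.
- apply/measurable_EFinP; exact: ae_borel_lebesgue HF.
- apply/measurable_EFinP; apply: (ae_borel_lebesgue (F := F)) => //.
  by apply: aeW.
- by apply/ae_completed; apply: ae_imp HF => x Fx Ax /=; rewrite Fx.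
Qed.
End Completion.

(** * Normalized real transforms *)

Section RealTransforms.
Context (R : realType).
Notation mu := (@lebesgue_measure R).
Notation D := (`]-1, 1[%classic : set R).
Local Notation w := (@weight R).
Implicit Types (a b f g : R -> R) (x t e c : R).

Lemma trunc_int_eq f g t e : (forall x, -1 < x < 1 -> f x = g x) -> -1 < t < 1 -> 0 < e ->
  trunc_int f t e = trunc_int g t e.
Proof.
move=> fg /andP[t1 t2] e0; rewrite /trunc_int; congr (_ + _);
  apply: eq_Rintegral => x /set_mem/=; rewrite in_itv/= => /andP[x1 x2];
  rewrite fg//; apply/andP; split; lra.
Qed.

Lemma trunc_intZ f c t e : intble mu D f -> -1 < t < 1 -> 0 < e ->
  trunc_int (fun x => c * f x) t e = c * trunc_int f t e.
Proof.
move=> If t1 e0; rewrite !trunc_intE//; last exact: DI_Z.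
rewrite /Sk -DZl; last exact: Skt_intble.
by apply: Deq => s _; rewrite mulrA.
Qed.

Lemma trunc_int_cvgZ f c t (l : R) : intble mu D f -> -1 < t < 1 ->
  trunc_int f t e @[e --> 0^'+] --> l ->
  trunc_int (fun x => c * f x) t e @[e --> 0^'+] --> c * l.
Proof.
move=> If t1 fl.
have h : c * trunc_int f t e @[e --> 0^'+] --> c * l by exact: (cvgM (cvg_cst c) fl).
apply: cvg_trans h; apply: near_eq_cvg; near=> e.
by rewrite trunc_intZ//; near: e; exact: nbhs_right_gt.
Unshelve. all: by end_near. Qed.

Lemma trunc_int_cvg_eq f g t (l : R) : (forall x, -1 < x < 1 -> f x = g x) -> -1 < t < 1 ->
  trunc_int f t e @[e --> 0^'+] --> l -> trunc_int g t e @[e --> 0^'+] --> l.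
Proof.
move=> fg t1 fl; apply: cvg_trans fl; apply: near_eq_cvg; near=> e.
by apply: trunc_int_eq => //; near: e; exact: nbhs_right_gt.
Unshelve. all: by end_near. Qed.

Lemma restrictD f x : -1 < x < 1 -> (f \_ D) x = f x.
Proof. by move=> /inD Dx; rewrite /patch ifT// inE. Qed.

Lemma restrictD_measurable f : intble mu D f -> measurable_fun setT (f \_ D).
Proof. by move=> If; apply: (measurable_restrictT f (@mD R)).1; exact: DI_mf. Qed.

Lemma weightM_intble f : intble mu D f -> intble mu D (fun x => w x * f x).
Proof.
move=> If; apply: (@DI_le _ _ (fun x => `|f x|)); last exact: DI_norm.
  by apply: measurable_funM; [apply: measurable_funTS; exact: weight_measurable|exact: DI_mf].
by move=> x _; rewrite normrM ler_piMl// weight_norm_le1.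
Qed.

Lemma pi_neq0 : (pi : R) != 0. Proof. by rewrite gt_eqF// pi_gt0. Qed.

(** The limits carry a factor [pi], to be cancelled by that of [truncated_hilbert]. In the second
    one, multiplication by - 1/w turns the bracket into [a] minus its projection, the formula of
    (iv). *)
Lemma exists_hilbert a : measurable_fun setT a -> intble mu D (fun t => Psi `|a t|) ->
  exists2 V : R -> R, measurable_fun setT V /\ intble mu D V &
    {ae mu, forall t, D t ->
      trunc_int a t e @[e --> 0^'+] --> pi * V t /\
      trunc_int (fun x => w x * V x) t e @[e --> 0^'+] -->
        pi * (w t * (pi^-1 * (\int[mu]_(s in D) a s) / w t - a t))}.
Proof.
move=> ma Ia; have [V [U [IV _ _ HV]]] := real_hilbert ma Ia.
have IV1 : intble mu D (fun x => pi^-1 * V x) by exact: DI_Z.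
exists ((fun x => pi^-1 * V x) \_ D).
  split; first exact: restrictD_measurable.
  by apply: DI_eq IV1 => x x1; rewrite restrictD.
apply: ae_imp HV => t Ht Dt; have t1 : -1 < t < 1 by exact/inD.
have [h1 h2 _ _] := Ht Dt; split; first by rewrite restrictD// mulrA divff ?mul1r// pi_neq0.
apply: (@trunc_int_cvg_eq (fun x => pi^-1 * (w x * V x))) => //.
  by move=> x x1; rewrite restrictD// mulrCA.
have E : pi * (w t * (pi^-1 * (\int[mu]_(s in D) a s) / w t - a t)) =
    pi^-1 * (- (pi ^+ 2 * (w t * a t)) + pi * \int[mu]_(s in D) a s).
  have w0 : w t != 0 by rewrite gt_eqF// weight_gt0.
  move: (\int[mu]_(s in D) a s) w0 pi_neq0 => A; move: (w t) (a t) (pi : R) => u v p u0 p0.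
  by field; rewrite u0 p0.
by rewrite E; apply: trunc_int_cvgZ => //; exact: weightM_intble.
Qed.

(** The factor - 1/pi and the sign in the first limit match the factor - 1/w of [hilbert_hat], so
    that [U] is the transform itself. *)
Lemma exists_hilbert_hat a : measurable_fun setT a -> intble mu D (fun t => Psi `|a t|) ->
  exists2 U : R -> R, [/\ measurable_fun setT U, intble mu D U & \int[mu]_(t in D) U t = 0] &
    {ae mu, forall t, D t ->
      trunc_int (fun x => w x * a x) t e @[e --> 0^'+] --> pi * (- (w t * U t)) /\
      trunc_int U t e @[e --> 0^'+] --> pi * a t}.
Proof.
move=> ma Ia; have [V [U [_ IU U0 HU]]] := real_hilbert ma Ia.
have IU1 : intble mu D (fun x => - pi^-1 * U x) by exact: DI_Z.
exists ((fun x => - pi^-1 * U x) \_ D).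
  split; first exact: restrictD_measurable.
    by apply: DI_eq IU1 => x x1; rewrite restrictD.
  by rewrite (@Deq _ _ (fun x => - pi^-1 * U x)) ?DZl ?U0 ?mulr0// => x x1; rewrite restrictD.
apply: ae_imp HU => t Ht Dt; have t1 : -1 < t < 1 by exact/inD.
have [_ _ h1 h2] := Ht Dt; split.
  rewrite restrictD// (_ : pi * _ = w t * U t)//.
  by rewrite mulNr !mulrN opprK (mulrCA (w t)) (mulVKf pi_neq0).
apply: (@trunc_int_cvg_eq (fun x => - pi^-1 * U x)) => //.
  by move=> x x1; rewrite restrictD.
have E : pi * a t = - pi^-1 * - (pi ^+ 2 * a t).
  by rewrite mulrNN expr2 !mulrA mulVf ?pi_neq0// mul1r.
by rewrite E; apply: trunc_int_cvgZ.
Qed.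
End RealTransforms.

(** * From real Borel functions to complex classes *)

Section ComplexVersions.
Local Open Scope complex_scope.
Context (R : realType).
Notation mu := (@lebesgue_measure R).
Notation cmu := (@completed_lebesgue_measure R).
Notation D := (`]-1, 1[%classic : set R).
Local Notation w := (@weight R).
Implicit Types (a b : R -> R) (f g : R -> R[i]) (x t e c : R).

Definition cmod a b x : R := Num.sqrt (a x ^+ 2 + b x ^+ 2).

(** Functions of the theorem are Lebesgue measurable and matter only almost everywhere on (-1, 1);
    all analysis is done on Borel real and imaginary parts defined on the whole line. *)
Definition borel_version f a b : Prop :=
  [/\ measurable_fun setT a, measurable_fun setT b &
      {ae mu, forall x, D x -> f x = a x +i* b x}].

Lemma aeD_and (P Q : R -> Prop) : {ae mu, forall x, D x -> P x} -> {ae mu, forall x, D x -> Q x} ->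
  {ae mu, forall x, D x -> P x /\ Q x}.
Proof.
move=> hP hQ; apply: negligibleS (negligibleU hP hQ) => x /= nx.
by apply: contrapT => /not_orP[/contrapT h1] /contrapT h2; apply: nx => Dx; split; [exact: h1|exact: h2].
Qed.

Lemma cmod_ge0 a b x : 0 <= cmod a b x. Proof. exact: sqrtr_ge0. Qed.

Lemma sqr_cmod a b x : cmod a b x ^+ 2 = a x ^+ 2 + b x ^+ 2.
Proof. by rewrite sqr_sqrtr// addr_ge0 ?sqr_ge0. Qed.

Lemma cmod_measurable a b : measurable_fun setT a -> measurable_fun setT b ->
  measurable_fun setT (cmod a b).
Proof.
move=> ma mb; apply: (measurableT_comp (continuous_measurable_fun (@sqrt_continuous R))).
by apply: measurable_funD; exact: measurable_funX.
Qed.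

Lemma le_cmod_l a b x : `|a x| <= cmod a b x.
Proof. by rewrite -sqrtr_sqr ler_wsqrtr// lerDl sqr_ge0. Qed.

Lemma le_cmod_r a b x : `|b x| <= cmod a b x.
Proof. by rewrite -sqrtr_sqr ler_wsqrtr// lerDr sqr_ge0. Qed.

Lemma cmod_le a b x : cmod a b x <= `|a x| + `|b x|.
Proof.
rewrite -[leRHS]ger0_norm ?addr_ge0// -sqrtr_sqr ler_wsqrtr// sqrrD !real_normK ?num_real//.
by rewrite addrAC lerDl mulrn_wge0// mulr_ge0.
Qed.

Lemma exists_borel_version f : cmeasurable f -> exists a b, borel_version f a b.
Proof.
move=> [/lebesgue_borel[a ma fa] /lebesgue_borel[b mb fb]]; exists a, b; split=> //.
by apply: ae_imp (aeD_and fa fb) => x h Dx; have [<- <-] := h Dx; case: (f x).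
Qed.

Lemma borel_version_cmeasurable f a b : borel_version f a b -> cmeasurable f.
Proof.
move=> [ma mb fab]; split.
  apply: (@ae_borel_lebesgue _ _ _ a) => //; first exact: measurable_funTS.
  by apply: ae_imp fab => x h Dx; rewrite h.
apply: (@ae_borel_lebesgue _ _ _ b) => //; first exact: measurable_funTS.
by apply: ae_imp fab => x h Dx; rewrite h.
Qed.

Lemma ae_equalE f g : ae_equal f g <-> {ae mu, forall x, D x -> f x = g x}.
Proof. by split=> h; apply/ae_completed. Qed.

Lemma borel_version_ae f g a b : ae_equal f g -> borel_version f a b -> borel_version g a b.
Proof.
move=> /ae_equalE fg [ma mb fab]; split=> //.
by apply: ae_imp (aeD_and fg fab) => x h Dx; have [<-] := h Dx.
Qed.

Lemma borel_version_uniq f g a b : borel_version f a b -> borel_version g a b -> ae_equal f g.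
Proof.
move=> [_ _ fab] [_ _ gab]; apply/ae_equalE.
by apply: ae_imp (aeD_and fab gab) => x h Dx; have [-> ->] := h Dx.
Qed.

Lemma Rintegral_completed_ae (A : set R) (h F : R -> R) : measurable A -> measurable_fun A F ->
  {ae mu, forall x, A x -> h x = F x} ->
  \int[cmu]_(x in A) h x = \int[mu]_(x in A) F x.
Proof. by move=> mA mF hF; rewrite /Rintegral (integral_completed_ae mA mF hF). Qed.

Lemma cintegral_borel f a b (A : set R) : measurable A -> A `<=` D -> borel_version f a b ->
  cintegral A f = \int[mu]_(x in A) a x +i* \int[mu]_(x in A) b x.
Proof.
move=> mA AD [ma mb fab]; rewrite /cintegral; congr (_ +i* _);
  apply: Rintegral_completed_ae => //; try exact: measurable_funTS;
  by apply: ae_imp fab => x h /AD Dx; rewrite h.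
Qed.

Lemma mul_complexr (a b c : R) : (a +i* b) * c%:C = (a * c) +i* (b * c).
Proof. by apply/eqP; rewrite eq_complex /= !mulr0 subr0 add0r !eqxx. Qed.

Lemma mulc_real (a b c : R) : c%:C * (a +i* b) = (c * a) +i* (c * b).
Proof. by rewrite mulrC mul_complexr ![c * _]mulrC. Qed.

Lemma div_complexr (a b c : R) : (a +i* b) / c%:C = (a / c) +i* (b / c).
Proof. by rewrite -[c%:C^-1](fmorphV (real_complex R)) mul_complexr. Qed.

Lemma borel_versionZ f a b (u : R -> R) : measurable_fun setT u -> borel_version f a b ->
  borel_version (fun x => (u x)%:C * f x) (fun x => u x * a x) (fun x => u x * b x).
Proof.
move=> mu' [ma mb fab]; split; [exact: measurable_funM|exact: measurable_funM|].
by apply: ae_imp fab => x h Dx; rewrite h// mulc_real.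
Qed.

Lemma truncated_hilbert_borel f a b t e : borel_version f a b -> -1 < t < 1 -> 0 < e ->
  truncated_hilbert f t e = (pi^-1 * trunc_int a t e) +i* (pi^-1 * trunc_int b t e).
Proof.
move=> fab /andP[t1 t2] e0.
have h : borel_version (fun x => f x / (x - t)%:C) (fun x => a x / (x - t)) (fun x => b x / (x - t)).
  case: fab => ma mb fab.
  have mi : measurable_fun setT (fun x => (x - t)^-1) by exact: (shift_measurable1 t (@measurable_inv R)).
  split; [exact: measurable_funM|exact: measurable_funM|].
  by apply: ae_imp fab => x h Dx; rewrite h// div_complexr.
rewrite /truncated_hilbert !(cintegral_borel _ _ h); try exact: measurable_itv.
- by rewrite mulc_real /trunc_int.
- by move=> x /=; rewrite !in_itv/= => /andP[x1 x2]; apply/andP; split; lra.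
- by move=> x /=; rewrite !in_itv/= => /andP[x1 x2]; apply/andP; split; lra.
Qed.

Lemma cvg_complex (a b : R -> R) (A B : R) :
  a e @[e --> 0^'+] --> A -> b e @[e --> 0^'+] --> B ->
  ((a e +i* b e) : R[i]^o) @[e --> (0:R)^'+] --> ((A +i* B) : R[i]^o).
Proof.
move=> aA bB; apply/(@cvgrPdist_lt _ R[i]^o) => eps eps0.
(* In the order of [R[i]] a positive element is real. *)
have E : eps = (complex.Re eps)%:C.
  by move: eps0; case: eps => r s; rewrite ltcE /= => /andP[/eqP -> _].
have r0 : 0 < complex.Re eps by move: eps0; rewrite ltcE => /andP[].
move: (complex.Re eps) E r0 => r -> r0.
have r2 : 0 < r / 2 by rewrite divr_gt0.
have nA : \forall e \near (0 : R)^'+, `|A - a e| < r / 2 by move/cvgrPdist_lt : aA; exact.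
have nB : \forall e \near (0 : R)^'+, `|B - b e| < r / 2 by move/cvgrPdist_lt : bB; exact.
near=> e.
rewrite normc_def ltcE /= eqxx/=.
have h1 : `|A - a e| < r / 2 by near: e.
have h2 : `|B - b e| < r / 2 by near: e.
apply: (le_lt_trans (cmod_le (fun=> A - a e) (fun=> B - b e) 0)).
by rewrite (splitr r) ltrD.
Unshelve. all: by end_near. Qed.

Lemma hilbert_lim f a b t (A B : R) : borel_version f a b -> -1 < t < 1 ->
  trunc_int a t e @[e --> 0^'+] --> pi * A -> trunc_int b t e @[e --> 0^'+] --> pi * B ->
  hilbert f t = A +i* B.
Proof.
move=> fab t1 ha hb; rewrite /hilbert; apply: (@cvg_lim R[i]^o); first exact: norm_hausdorff.
have scale (u : R -> R) (U : R) : u e @[e --> 0^'+] --> pi * U -> pi^-1 * u e @[e --> 0^'+] --> U.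
  move=> hu; rewrite -[X in _ --> X](mulKf (pi_neq0 R) U).
  exact: (cvgM (cvg_cst pi^-1) hu).
apply: cvg_trans (cvg_complex (scale _ _ ha) (scale _ _ hb)); apply: near_eq_cvg; near=> e.
by rewrite (truncated_hilbert_borel fab)//; near: e; exact: nbhs_right_gt.
Unshelve. all: by end_near. Qed.
End ComplexVersions.

(** * The operators on L log L *)

Section Zygmund.
Local Open Scope complex_scope.
Context (R : realType).
Notation mu := (@lebesgue_measure R).
Notation cmu := (@completed_lebesgue_measure R).
Notation D := (`]-1, 1[%classic : set R).
Notation D2 := (`]0, 2[%classic : set R).
Local Notation w := (@weight R).
Local Notation iw := (fun x : R => (weight x)^-1).
Implicit Types (a b : R -> R) (f g : R -> R[i]) (x t e c N : R).

(** For arbitrary sets, by the outer measure: the level sets of a class member need not be Borel. *)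
Lemma lebesgue_measure_le_negl (A B N : set R) : mu.-negligible N -> A `<=` B `|` N ->
  (mu A <= mu B)%E.
Proof.
move=> [M [mM M0 NM]] AB.
have AB' : A `<=` B `|` M by move=> x /AB[Bx|/NM Mx]; [left|right].
have h : (mu A <= mu (B `|` M))%E by apply: le_outer_measure.
apply: (le_trans h); have h2 : (mu (B `|` M) <= mu B + mu M)%E by apply: outer_measureU2.
by rewrite M0 adde0 in h2.
Qed.

Lemma rearrangement_borel f a b t : borel_version f a b -> rearrangement f t = rearr (cmod a b) t.
Proof.
move=> [ma mb fab]; rewrite /rearrangement /rearr.
have d l : cmu (I11 `&` [set x | (l < Normc.normc (f x))%R]) = distrib (cmod a b) l.
  apply/eqP; rewrite eq_le; apply/andP; split; apply: (lebesgue_measure_le_negl fab) => x [Dx /= lx].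
    have [fx|nfx] := pselect (f x = a x +i* b x); first by left; split => //=; move: lx; rewrite fx.
    by right => /(_ Dx).
  have [fx|nfx] := pselect (f x = a x +i* b x); first by left; split => //=; rewrite fx.
  by right => /(_ Dx).
by under eq_set do rewrite d.
Qed.

Lemma llogl_norm_borel f a b : borel_version f a b -> llogl_norm f = zyg_norm (cmod a b).
Proof.
move=> fab; have [ma mb _] := fab; have mc := cmod_measurable ma mb.
rewrite /llogl_norm /zyg_norm -integral_completed; last 2 first.
- exact: measurable_itv.
- by apply: measurable_funTS; exact: fsl_measurable.
apply: eq_integral => t /set_mem/in_D2 t02.
by rewrite (rearrangement_borel _ fab) -frearrE// -EFinM.
Qed.

Lemma LlogL_borel f : LlogL f -> exists a b, borel_version f a b /\ (zyg_norm (cmod a b) < +oo)%E.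
Proof.
move=> [/exists_borel_version[a [b fab]] foo]; exists a, b; split=> //.
by rewrite -(llogl_norm_borel fab).
Qed.

Lemma borel_LlogL f a b : borel_version f a b -> (zyg_norm (cmod a b) < +oo)%E -> LlogL f.
Proof.
move=> fab foo; split; first exact: borel_version_cmeasurable fab.
by rewrite (llogl_norm_borel fab).
Qed.

Lemma LlogL_ae f g : ae_equal f g -> LlogL f -> LlogL g.
Proof.
move=> fg /LlogL_borel[a [b [fab foo]]]; exact: borel_LlogL (borel_version_ae fg fab) foo.
Qed.

Lemma llogl_norm_ae f g : LlogL f -> ae_equal f g -> llogl_norm g = llogl_norm f.
Proof.
move=> /LlogL_borel[a [b [fab foo]]] fg.
by rewrite (llogl_norm_borel fab) (llogl_norm_borel (borel_version_ae fg fab)).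
Qed.

Lemma zyg_norm_intble_Psi a b : measurable_fun setT a -> measurable_fun setT b ->
  (zyg_norm (cmod a b) < +oo)%E ->
  intble mu D (fun t => Psi `|a t|) /\ intble mu D (fun t => Psi `|b t|).
Proof.
move=> ma mb foo; have mc := cmod_measurable ma mb.
have mPsi (u : R -> R) : measurable_fun setT u -> measurable_fun D (fun t => Psi (u t)).
  by move=> mu'; apply: measurable_funTS; exact: (measurableT_comp (@measurable_Psi R)).
have I : intble mu D (fun t => Psi (cmod a b t)).
  apply/integrableP; split; first by apply/measurable_EFinP; exact: mPsi.
  apply: le_lt_trans (zyg_norm_Psi mc (cmod_ge0 a b) foo).
  under eq_integral do rewrite /= ger0_norm ?Psi_ge0 ?cmod_ge0//.
  by [].
split; apply: (@DI_le _ _ (fun t => Psi (cmod a b t))) => //.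
- by apply: mPsi; exact: measurableT_comp.
- by move=> t _; rewrite ger0_norm ?Psi_ge0// Psi_le// le_cmod_l.
- by apply: mPsi; exact: measurableT_comp.
- by move=> t _; rewrite ger0_norm ?Psi_ge0// Psi_le// le_cmod_r.
Qed.

Lemma cmod_intble a b : measurable_fun setT a -> measurable_fun setT b ->
  intble mu D a -> intble mu D b -> intble mu D (cmod a b).
Proof.
move=> ma mb Ia Ib; apply: (@DI_le _ _ (fun t => `|a t| + `|b t|)).
- by apply: measurable_funTS; exact: cmod_measurable.
- by move=> t _; rewrite ger0_norm ?cmod_ge0// cmod_le.
- by apply: DI_D; exact: DI_norm.
Qed.

Lemma borel_L1 f a b : borel_version f a b -> intble mu D a -> intble mu D b -> L1 f.
Proof.
move=> fab Ia Ib; have [ma mb hab] := fab; split; first exact: borel_version_cmeasurable fab.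
have mc := cmod_measurable ma mb.
rewrite (integral_completed_ae (F := cmod a b)); last 3 first.
- exact: mD.
- exact: measurable_funTS.
- by apply: ae_imp hab => x h Dx; rewrite h.
by rewrite RintE ?ltry//; [exact: mD|exact: cmod_intble].
Qed.

Lemma cintegral_I11 f a b : borel_version f a b ->
  cintegral (@I11 R) f = \int[mu]_(x in D) a x +i* \int[mu]_(x in D) b x.
Proof. by move=> fab; apply: cintegral_borel fab => //; exact: mD. Qed.

Lemma zyg_norm_intble a b : measurable_fun setT a -> measurable_fun setT b ->
  (zyg_norm (cmod a b) < +oo)%E -> intble mu D a /\ intble mu D b.
Proof.
move=> ma mb foo; have [Ia Ib] := zyg_norm_intble_Psi ma mb foo.
by split; [apply: Psi_intble Ia|apply: Psi_intble Ib]; exact: measurable_funTS.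
Qed.

Lemma llogl_proj_complexE f a b x : borel_version f a b ->
  llogl_proj f x = (pi^-1 * (\int[mu]_(s in D) a s) / w x) +i* (pi^-1 * (\int[mu]_(s in D) b s) / w x).
Proof.
by move=> fab; rewrite /llogl_proj (cintegral_I11 fab) mulc_real /inv_weight mul_complexr.
Qed.

Lemma borel_version_proj f a b : borel_version f a b ->
  borel_version (llogl_proj f) (fun x => pi^-1 * (\int[mu]_(s in D) a s) / w x)
    (fun x => pi^-1 * (\int[mu]_(s in D) b s) / w x).
Proof.
move=> fab; split; try by apply: measurable_funM => //; exact: inv_weight_measurable.
by apply: aeW => x _; rewrite (llogl_proj_complexE _ fab).
Qed.

Lemma borel_versionB f g a b a' b' : borel_version f a b -> borel_version g a' b' ->
  borel_version (fun x => f x - g x) (fun x => a x - a' x) (fun x => b x - b' x).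
Proof.
move=> [ma mb fab] [ma' mb' gab]; split; [exact: measurable_funB|exact: measurable_funB|].
by apply: ae_imp (aeD_and fab gab) => x h Dx; have [-> ->] := h Dx.
Qed.

Lemma llogl_normB f g : cmeasurable f -> cmeasurable g ->
  (llogl_norm (fun x => f x - g x)%R <= llogl_norm f + llogl_norm g)%E.
Proof.
move=> /exists_borel_version[a [b fab]] /exists_borel_version[a' [b' gab]].
rewrite (llogl_norm_borel fab) (llogl_norm_borel gab) (llogl_norm_borel (borel_versionB fab gab)).
have [ma mb _] := fab; have [ma' mb' _] := gab.
apply: zyg_norm_triangle; try exact: cmod_measurable; try exact: cmod_ge0.
  by apply: cmod_measurable; exact: measurable_funB.
move=> x _; have := ler_normB (a x +i* b x) (a' x +i* b' x).
by rewrite !normc_def lecE /= => /andP[_].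
Qed.

(** [Va] and [Vb] are chosen before [f], so members of one class have the same transform;
    compatibility with a.e. equality comes for free. *)
Lemma hilbert_borel a b : measurable_fun setT a -> measurable_fun setT b ->
  (zyg_norm (cmod a b) < +oo)%E -> exists Va Vb, [/\ intble mu D Va, intble mu D Vb &
    forall f, borel_version f a b -> borel_version (hilbert f) Va Vb /\
      ae_equal (fun x => f x - llogl_proj f x) (hilbert_hat (hilbert f))].
Proof.
move=> ma mb foo; have [Pa Pb] := zyg_norm_intble_Psi ma mb foo.
have [Va [mVa IVa] Ha] := exists_hilbert ma Pa.
have [Vb [mVb IVb] Hb] := exists_hilbert mb Pb.
exists Va, Vb; split=> // f fab.
have H := aeD_and Ha Hb.
have fV : borel_version (hilbert f) Va Vb.
  split=> //; apply: ae_imp H => t h Dt; have [[h1 _] [h2 _]] := h Dt.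
  by apply: (hilbert_lim fab) => //; exact/inD.
split=> //; apply/ae_equalE.
have [_ _ fabE] := fab.
apply: ae_imp (aeD_and H fabE) => t h Dt; have [[[_ h1] [_ h2]] ft] := h Dt.
have t1 : -1 < t < 1 by exact/inD.
have w0 : w t != 0 by rewrite gt_eqF// weight_gt0.
rewrite (llogl_proj_complexE _ fab) ft /hilbert_hat.
rewrite (hilbert_lim (borel_versionZ (@weight_measurable R) fV) t1 h1 h2) mulc_real.
move: (pi^-1 * \int[mu]_(s in D) a s) (pi^-1 * \int[mu]_(s in D) b s) => A B.
by apply/eqP; rewrite eq_complex /=; apply/andP; split; apply/eqP; field.
Qed.

Lemma hilbert_hat_borel a b : measurable_fun setT a -> measurable_fun setT b ->
  (zyg_norm (cmod a b) < +oo)%E -> exists Ua Ub,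
    [/\ intble mu D Ua, intble mu D Ub, \int[mu]_(t in D) Ua t = 0, \int[mu]_(t in D) Ub t = 0 &
    forall g, borel_version g a b -> borel_version (hilbert_hat g) Ua Ub /\
      ae_equal (hilbert (hilbert_hat g)) g].
Proof.
move=> ma mb foo; have [Pa Pb] := zyg_norm_intble_Psi ma mb foo.
have [Ua [mUa IUa Ua0] Ha] := exists_hilbert_hat ma Pa.
have [Ub [mUb IUb Ub0] Hb] := exists_hilbert_hat mb Pb.
exists Ua, Ub; split=> // g gab.
have H := aeD_and Ha Hb.
have gU : borel_version (hilbert_hat g) Ua Ub.
  split=> //; apply: ae_imp H => t h Dt; have [[h1 _] [h2 _]] := h Dt.
  have t1 : -1 < t < 1 by exact/inD.
  have w0 : w t != 0 by rewrite gt_eqF// weight_gt0.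
  rewrite /hilbert_hat (hilbert_lim (borel_versionZ (@weight_measurable R) gab) t1 h1 h2) mulc_real.
  by apply/eqP; rewrite eq_complex /=; apply/andP; split; apply/eqP; field.
split=> //; apply/ae_equalE; have [_ _ gabE] := gab.
apply: ae_imp (aeD_and H gabE) => t h Dt; have [[[_ h1] [_ h2]] ->] := h Dt.
by apply: (hilbert_lim gU) => //; exact/inD.
Qed.

(** The modulus of the integral is at most the integral of the modulus: A^2 + B^2 is the integral of
    A a + B b, to which Cauchy-Schwarz is applied pointwise. *)
Lemma cmod_Rintegral_le a b : measurable_fun setT a -> measurable_fun setT b ->
  intble mu D a -> intble mu D b ->
  Num.sqrt ((\int[mu]_(x in D) a x) ^+ 2 + (\int[mu]_(x in D) b x) ^+ 2) <=
  \int[mu]_(x in D) cmod a b x.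
Proof.
move=> ma mb Ia Ib; have Ic := cmod_intble ma mb Ia Ib.
set A := \int[mu]_(x in D) a x; set B := \int[mu]_(x in D) b x; set r := Num.sqrt _.
have r0 : 0 <= r by exact: sqrtr_ge0.
have r2 : r ^+ 2 = A ^+ 2 + B ^+ 2 by rewrite sqr_sqrtr// addr_ge0 ?sqr_ge0.
have C0 : 0 <= \int[mu]_(x in D) cmod a b x by apply: Rintegral_ge0 => x _; exact: cmod_ge0.
have [-> //|rn0] := eqVneq r 0.
have rp : 0 < r by rewrite lt_def rn0.
rewrite -(ler_pM2l rp) -expr2 r2 !expr2 -!DZl// -DD; try exact: DI_Z.
apply: Dle; [by apply: DI_D; exact: DI_Z|exact: DI_Z|] => x _.
apply: (le_trans (ler_norm _)).
rewrite -(@ler_pXn2r _ 2)// ?nnegrE ?mulr_ge0 ?cmod_ge0//.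
rewrite real_normK ?num_real// exprMn r2 sqr_cmod.
have := sqr_ge0 (A * b x - B * a x); nra.
Qed.

Lemma zyg_norm_iw_complex : zyg_norm (cmod iw (fun=> 0)) = zyg_norm iw.
Proof.
congr zyg_norm; apply/funext => x.
by rewrite /cmod expr0n/= addr0 sqrtr_sqr ger0_norm// invr_ge0 weight_ge0.
Qed.

Lemma borel_version_iw : borel_version (@inv_weight R) iw (fun=> 0).
Proof. by split=> //; [exact: inv_weight_measurable|apply: aeW]. Qed.

Lemma llogl_norm_inv_weight : llogl_norm (@inv_weight R) = zyg_norm iw.
Proof. by rewrite (llogl_norm_borel borel_version_iw) zyg_norm_iw_complex. Qed.

Lemma inv_weight_LlogL : LlogL (@inv_weight R).
Proof.
by apply: (borel_LlogL borel_version_iw); rewrite zyg_norm_iw_complex; exact: zyg_norm_iw_fin.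
Qed.

Lemma llogl_norm_ge0 f : cmeasurable f -> (0 <= llogl_norm f)%E.
Proof.
move=> /exists_borel_version[a [b fab]]; rewrite (llogl_norm_borel fab).
by apply: integral_ge0 => t /in_D2 t02; rewrite lee_fin fsl_ge0.
Qed.

(** The projection is a multiple of 1/w by a number of modulus |int f| / pi, and |int f| <= int |f|
    <= ||f|| because the logarithmic weight is at least 1. The real [N] is taken to be 1 for the
    operator norm and the norm itself for membership. *)
Lemma llogl_proj_norm f N : LlogL f -> (llogl_norm f <= N%:E)%E ->
  (llogl_norm (llogl_proj f) <= (pi^-1 * N)%:E * llogl_norm (@inv_weight R))%E.
Proof.
move=> /LlogL_borel[a [b [fab foo]]].
rewrite (llogl_norm_borel fab) (llogl_norm_borel (borel_version_proj fab)) llogl_norm_inv_weight => fN.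
have [ma mb _] := fab; have [mpa mpb _] := borel_version_proj fab.
have [Ia Ib] := zyg_norm_intble ma mb foo.
have mc := cmod_measurable ma mb.
set A := \int[mu]_(s in D) a s; set B := \int[mu]_(s in D) b s.
have p0 : 0 <= (pi : R)^-1 by rewrite invr_ge0 pi_ge0.
pose r := Num.sqrt (A ^+ 2 + B ^+ 2).
have rN : r <= N.
  apply: (le_trans (cmod_Rintegral_le ma mb Ia Ib)); rewrite -lee_fin -RintE; last 2 first.
  - exact: mD.
  - exact: cmod_intble.
  apply: (le_trans _ fN); apply: int_le_zyg_norm => //; exact: cmod_ge0.
have n0 : (0 <= zyg_norm iw)%E by apply: integral_ge0 => t /in_D2 t02; rewrite lee_fin fsl_ge0.
apply: (@le_trans _ _ ((pi^-1 * r)%:E * zyg_norm iw)%E); last first.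
  by apply: lee_wpmul2r => //; rewrite lee_fin ler_wpM2l.
apply: zyg_norm_scale.
- exact: inv_weight_measurable.
- exact: cmod_measurable.
- by rewrite mulr_ge0// sqrtr_ge0.
- move=> x _; rewrite /cmod /r.
  have -> : (pi^-1 * A / w x) ^+ 2 + (pi^-1 * B / w x) ^+ 2 = (pi^-1 / w x) ^+ 2 * (A ^+ 2 + B ^+ 2).
    by rewrite !exprMn; ring.
  rewrite sqrtrM ?sqr_ge0// sqrtr_sqr ger0_norm; last by rewrite mulr_ge0// invr_ge0 weight_ge0.
  by rewrite mulrAC.
Qed.
End Zygmund.

(** * The operators on classes and their norms *)

Section Theorem4p10.
Local Open Scope complex_scope.
Context (R : realType).
Implicit Types (f g : R -> R[i]) (c : R[i]) (t x : R).

(** The normalization int 1/w = pi. As all values of the projection are multiples of 1/w,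
    idempotence follows. *)
Lemma llogl_proj_inv_weight c x :
  llogl_proj (fun x => c * @inv_weight R x) x = c * inv_weight x.
Proof.
have cv : borel_version (fun x => c * @inv_weight R x) (fun x => complex.Re c / weight x) (fun x => complex.Im c / weight x).
  split; try by apply: measurable_funM => //; exact: inv_weight_measurable.
  by apply: aeW => y _; case: c => u v; rewrite /inv_weight mul_complexr.
have [I1 I2] := int_inv_weight R.
rewrite (llogl_proj_complexE x cv) !DZl// I2 -![pi^-1 * (_ * pi)]mulrCA mulVf ?pi_neq0// !mulr1.
by case: (c) => u v; rewrite /inv_weight mul_complexr.
Qed.

(** Yields both the failure of injectivity and the vanishing of the transform on the range of the
    projection. *)
Lemma hilbert_inv_weight c t : -1 < t < 1 ->
  hilbert (fun x => c * @inv_weight R x) t = 0.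
Proof.
move=> t1.
have cv : borel_version (fun x => c * @inv_weight R x) (fun x => complex.Re c / weight x) (fun x => complex.Im c / weight x).
  split; try by apply: measurable_funM => //; exact: inv_weight_measurable.
  by apply: aeW => y _; case: c => u v; rewrite /inv_weight mul_complexr.
have [I1 I2] := int_inv_weight R.
have h (u : R) : trunc_int (fun x => u / weight x) t e @[e --> 0^'+] --> pi * 0.
  rewrite (_ : pi * 0 = u * 0); last by rewrite !mulr0.
  exact: trunc_int_cvgZ (pv_inv_weight t1).
exact: (hilbert_lim cv t1 (h _) (h _)).
Qed.

Lemma ae_equal_inv_weight0  : ~ ae_equal (@inv_weight R) (fun=> 0).
Proof.
move=> /ae_equalE; move=> [N [mN N0 DN]].
have : (lebesgue_measure (@I11 R) <= lebesgue_measure N)%E.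
  apply: le_measure; rewrite ?inE//; first exact: mD.
  move=> x Dx; apply: DN => /= /(_ Dx); rewrite /inv_weight => -[/eqP].
  by rewrite invr_eq0 gt_eqF// weight_gt0//; exact/inD.
by rewrite N0 [leLHS](muD R) lee_fin leNgt ltr0n.
Qed.

Lemma ae_equal_sym f g : ae_equal f g -> ae_equal g f.
Proof. by move=> /ae_equalE h; apply/ae_equalE; apply: ae_imp h => x fg Dx; rewrite fg. Qed.

Lemma ae_equal_trans g f h : ae_equal f g -> ae_equal g h -> ae_equal f h.
Proof.
move=> /ae_equalE fg /ae_equalE gh; apply/ae_equalE.
by apply: ae_imp (aeD_and fg gh) => x e Dx; have [-> ->] := e Dx.
Qed.

Lemma ae_equalW f g : (forall x, -1 < x < 1 -> f x = g x) -> ae_equal f g.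
Proof. by move=> fg; apply/ae_equalE; apply: aeW => x /inD; exact: fg. Qed.

Lemma hilbert_operator : operator (@LlogL R) (@L1 R) (@hilbert R).
Proof.
split=> [f /LlogL_borel[a [b [fab foo]]]|f g /LlogL_borel[a [b [fab foo]]] _ fg];
  have [ma mb _] := fab; have [Va [Vb [Ia Ib H]]] := hilbert_borel ma mb foo.
  by have [fV _] := H f fab; exact: borel_L1 fV Ia Ib.
have [fV _] := H f fab; have [gV _] := H g (borel_version_ae fg fab).
exact: borel_version_uniq fV gV.
Qed.

Lemma hilbert_hat_hilbert f : LlogL f ->
  ae_equal (fun x => f x - llogl_proj f x) (hilbert_hat (hilbert f)).
Proof.
move=> /LlogL_borel[a [b [fab foo]]]; have [ma mb _] := fab.
by have [Va [Vb [_ _ /(_ f fab)[_]]]] := hilbert_borel ma mb foo.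
Qed.

Lemma llogl_proj_ae f g : LlogL f -> ae_equal f g -> llogl_proj f = llogl_proj g.
Proof.
move=> /LlogL_borel[a [b [fab foo]]] fg; apply/funext => x.
by rewrite (llogl_proj_complexE _ fab) (llogl_proj_complexE _ (borel_version_ae fg fab)).
Qed.

Lemma llogl_norm_inv_weight_fin : llogl_norm (@inv_weight R) \is a fin_num.
Proof.
have [mi oo] := inv_weight_LlogL R.
by rewrite ge0_fin_numE// llogl_norm_ge0.
Qed.

Lemma llogl_norm_fin f : LlogL f -> llogl_norm f \is a fin_num.
Proof. by move=> [mf foo]; rewrite ge0_fin_numE// llogl_norm_ge0. Qed.

Lemma llogl_proj_LlogL f : LlogL f -> LlogL (llogl_proj f).
Proof.
move=> Lf; have [a [b [fab _]]] := LlogL_borel Lf.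
split; first exact: borel_version_cmeasurable (borel_version_proj fab).
apply: le_lt_trans (llogl_proj_norm (N := fine (llogl_norm f)) Lf _) _.
  by rewrite fineK// llogl_norm_fin.
by rewrite -(fineK llogl_norm_inv_weight_fin) -EFinM ltry.
Qed.

Lemma llogl_projB_LlogL f : LlogL f -> LlogL (fun x => f x - llogl_proj f x).
Proof.
move=> Lf; have [a [b [fab _]]] := LlogL_borel Lf; have LP := llogl_proj_LlogL Lf.
split; first exact: borel_version_cmeasurable (borel_versionB fab (borel_version_proj fab)).
apply: le_lt_trans (llogl_normB _ _) _; [by case: Lf|by case: LP|].
by rewrite -(fineK (llogl_norm_fin Lf)) -(fineK (llogl_norm_fin LP)) -EFinD ltry.
Qed.

Lemma llogl_proj_linear : linear_operator (@LlogL R) (@llogl_proj R).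
Proof.
move=> c f g /LlogL_borel[a [b [fab foo]]] /LlogL_borel[a' [b' [gab goo]]].
have [ma mb fabE] := fab; have [ma' mb' gabE] := gab.
have [Ia Ib] := zyg_norm_intble ma mb foo; have [Ia' Ib'] := zyg_norm_intble ma' mb' goo.
apply: ae_equalW => x _; case: c => u v.
have h : borel_version (fun x => (u +i* v) * f x + g x)
    (fun x => (u * a x - v * b x) + a' x) (fun x => (u * b x + v * a x) + b' x).
  split.
  - by apply: measurable_funD => //; apply: measurable_funB; exact: measurable_funM.
  - by apply: measurable_funD => //; apply: measurable_funD; exact: measurable_funM.
  - by apply: ae_imp (aeD_and fabE gabE) => y e Dy; have [-> ->] := e Dy.
rewrite (llogl_proj_complexE _ h) (llogl_proj_complexE _ fab) (llogl_proj_complexE _ gab).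
rewrite (@DD _ (fun x => u * a x - v * b x))//; last by apply: DI_B; exact: DI_Z.
rewrite (@DD _ (fun x => u * b x + v * a x))//; last by apply: DI_D; exact: DI_Z.
rewrite DB ?DD ?DZl//; try exact: DI_Z.
apply/eqP; rewrite eq_complex /=; apply/andP; split; apply/eqP; ring.
Qed.

Lemma llogl_proj_idem f : LlogL f -> llogl_proj (llogl_proj f) = llogl_proj f.
Proof. by move=> _; apply/funext => x; exact: llogl_proj_inv_weight. Qed.

Lemma llogl_opnorm_proj : (llogl_opnorm (@llogl_proj R) <=
  (pi^-1)%:E * llogl_norm (@inv_weight R))%E.
Proof.
apply: ge_ereal_sup => _ [f [Lf f1] <-].
by rewrite -[pi^-1]mulr1; exact: llogl_proj_norm.
Qed.

Lemma llogl_proj_bounded_projection : bounded_projection (@llogl_proj R).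
Proof.
split; first split.
- exact: llogl_proj_LlogL.
- by move=> f g Lf _ fg; rewrite (llogl_proj_ae Lf fg); exact: ae_equalW.
- exact: llogl_proj_linear.
- apply: (le_lt_trans llogl_opnorm_proj).
  by rewrite -(fineK llogl_norm_inv_weight_fin) -EFinM ltry.
- by move=> f Lf; rewrite llogl_proj_idem//; exact: ae_equalW.
Qed.

Lemma llogl_opnorm_hilbert_hat_hilbert :
  (llogl_opnorm (fun f => @hilbert_hat R (hilbert f)) <=
   1 + (pi^-1)%:E * llogl_norm (@inv_weight R))%E.
Proof.
apply: ge_ereal_sup => _ [f [Lf f1] <-].
rewrite (llogl_norm_ae (llogl_projB_LlogL Lf) (hilbert_hat_hilbert Lf)).
apply: (le_trans (llogl_normB _ _)); [by case: Lf|by case: (llogl_proj_LlogL Lf)|].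
by apply: leeD => //; rewrite -[pi^-1]mulr1; exact: llogl_proj_norm.
Qed.

Lemma hilbert_not_injective : ~ injective_operator (@LlogL R) (@hilbert R).
Proof.
move=> inj; apply: ae_equal_inv_weight0.
have zE (c : R[i]) : (fun x => c * inv_weight x) = (fun x => c * @inv_weight R x) by [].
(* The zero function arises as 1/w minus its projection, so its membership follows from
   [llogl_projB_LlogL]. *)
have L0 : LlogL (fun _ : R => 0 : R[i]).
  have := llogl_projB_LlogL (inv_weight_LlogL R).
  apply: LlogL_ae; apply: ae_equalW => x _.
  have := llogl_proj_inv_weight 1 x; rewrite mul1r => <-.
  by under [X in llogl_proj X]eq_fun do rewrite mul1r; rewrite subrr.
apply: inj; [exact: inv_weight_LlogL|exact: L0|].
apply: ae_equalW => t t1.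
have := hilbert_inv_weight 1 t1; under eq_fun do rewrite mul1r; move=> ->.
by have := hilbert_inv_weight 0 t1; under eq_fun do rewrite mul0r; move=> ->.
Qed.
End Theorem4p10.

Theorem theorem4p10 (R : realType) :
  (* (i) *)
  (operator (@LlogL R) (@L1 R) (@hilbert R) /\
   ~ injective_operator (@LlogL R) (@hilbert R))
  /\
  (* (ii) *)
  (forall g : R -> R[i], LlogL g ->
    [/\ L1 (hilbert_hat g),
        ae_equal (hilbert (hilbert_hat g)) g
      & cintegral (@I11 R) (hilbert_hat g) = 0])
  /\
  (* (iii) *)
  [/\ bounded_projection (@llogl_proj R),
      (llogl_opnorm (@llogl_proj R) <=
         (pi^-1)%:E * llogl_norm (@inv_weight R))%E
    & forall f : R -> R[i], LlogL f ->
        ae_equal (hilbert (llogl_proj f)) (fun _ => 0)]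
  /\
  (* (iv) *)
  [/\ forall f : R -> R[i], LlogL f ->
        ae_equal (fun x => f x - llogl_proj f x) (hilbert_hat (hilbert f)),
      operator (@LlogL R) (@LlogL R) (fun f => hilbert_hat (hilbert f))
    & (llogl_opnorm (fun f => @hilbert_hat R (hilbert f)) <=
         1 + (pi^-1)%:E * llogl_norm (@inv_weight R))%E].
Proof.
split; first by split; [exact: hilbert_operator|exact: hilbert_not_injective].
split.
  move=> g /LlogL_borel[a [b [gab goo]]]; have [ma mb _] := gab.
  have [Ua [Ub [Ia Ib Ua0 Ub0 /(_ g gab)[gU Hg]]]] := hilbert_hat_borel ma mb goo.
  by split; [exact: borel_L1 gU Ia Ib|exact: Hg|rewrite (cintegral_I11 gU) Ua0 Ub0].
split.
  split; [exact: llogl_proj_bounded_projection|exact: llogl_opnorm_proj|].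
  by move=> f _; apply: ae_equalW => t t1; exact: hilbert_inv_weight.
split; first exact: hilbert_hat_hilbert; last exact: llogl_opnorm_hilbert_hat_hilbert.
split=> [f Lf|f g Lf Lg fg].
  exact: LlogL_ae (hilbert_hat_hilbert Lf) (llogl_projB_LlogL Lf).
(* Both sides are replaced by [f] and [g] minus their projections, and the projection depends only
   on the class. *)
apply: (ae_equal_trans (ae_equal_sym (hilbert_hat_hilbert Lf))).
apply: ae_equal_trans (hilbert_hat_hilbert Lg).
rewrite (llogl_proj_ae Lf fg); apply/ae_equalE; move/ae_equalE : fg => fg.
by apply: ae_imp fg => x h Dx; rewrite h.
Qed.
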